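(* Let $m,n\in\mathbb{N}_0$ with $n\ge m$, $\sigma,\sigma'\in(0,\infty)$, and $\theta'\in(0,\pi)$. Then \[ \int_0^\pi Q_{m-1/2}(\chi)\,\mathrm{P}^m_n(\cos\theta)\sqrt{\sin\theta}\,d\theta =2\pi(-1)^m\frac{(n-m)!}{(n+m)!}\sqrt{\sinh\sigma\sinh\sigma'\sin\theta'}\;\mathrm{P}^m_n(\cos\theta')\,P^m_n(\cosh\sigma_<)\,Q^m_n(\cosh\sigma_>), \] where \[ \chi=\frac{\cosh^2\sigma+\cosh^2\sigma'-\sin^2\theta-\sin^2\theta'-2\cosh\sigma\cosh\sigma'\cos\theta\cos\theta'}{2\sinh\sigma\sinh\sigma'\sin\theta\sin\theta'} \] and $\sigma_<=\min\{\sigma,\sigma'\}$, $\sigma_>=\max\{\sigma,\sigma'\}$.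
   Context: For $z\in\mathbb{C}\setminus(-\infty,1]$ (principal branches, $\mathbf{F}={}_2F_1/\Gamma(c)$ regularized hypergeometric function): the associated Legendre functions are $P^\mu_\nu(z)=\left(\frac{z+1}{z-1}\right)^{\mu/2}\mathbf{F}\!\left(\nu+1,-\nu;1-\mu;\frac{1-z}{2}\right)$ and $Q^\mu_\nu(z)=e^{\mu\pi i}\frac{\sqrt{\pi}\,\Gamma(\nu+\mu+1)(z^2-1)^{\mu/2}}{2^{\nu+1}z^{\nu+\mu+1}}\,\mathbf{F}\!\left(\frac{\nu+\mu}{2}+1,\frac{\nu+\mu+1}{2};\nu+\frac32;\frac{1}{z^2}\right)$, and $Q_\nu=Q^0_\nu$. $\mathrm{P}^m_n$ is the Ferrers function of the first kind: for integers $0\le m\le n$ and $x\in(-1,1)$, $\mathrm{P}^m_n(x)=(-1)^m(1-x^2)^{m/2}\frac{d^m}{dx^m}P_n(x)$ with $P_n$ the Legendre polynomial. Note $\chi\ge1$, with $\chi=1$ only when $\sigma=\sigma'$ and $\theta=\theta'$ (where $Q_{m-1/2}(\chi)$ has an integrable logarithmic singularity). *)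

(* Defs.v *)
From mathcomp Require Import all_boot all_order all_algebra.
From mathcomp Require Import all_classical all_reals all_analysis.
From mathcomp Require Import Rstruct Rstruct_topology.
From Stdlib Require Import Reals.
From Coquelicot Require Import Coquelicot.

Open Scope R_scope.

Fixpoint poch (a : R) (k : nat) : R :=
  match k with O => 1 | S k' => poch a k' * (a + INR k') end.

(** Reciprocal Gamma function at an integer j: 1/Gamma(j), equal to 0 at the
    poles j <= 0 and to 1/(j-1)! for j >= 1. *)
Definition rgamma_int (j : Z) : R :=
  if (j <=? 0)%Z then 0 else / INR (Factorial.fact (Z.to_nat (j - 1))).

(** Gamma at a half-integer: gamma_half j = Gamma(j + 1/2), j in N. *)
Fixpoint gamma_half (j : nat) : R :=
  match j with O => sqrt PI | S j' => gamma_half j' * (INR j' + /2) end.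

(** Regularized Gauss hypergeometric series
    F(a,b;c;x) = sum_k (a)_k (b)_k / (Gamma(c+k) k!) x^k,
    where the argument [rgc k] supplies 1/Gamma(c+k). *)
Definition hyp2F1reg (a b : R) (rgc : nat -> R) (x : R) : R :=
  Series (fun k => poch a k * poch b k * rgc k / INR (Factorial.fact k) * x ^ k).

(** Associated Legendre function of the first kind P^m_n(z), z > 1,
    integer degree n and order m (principal branch):
    ((z+1)/(z-1))^{m/2} F(n+1, -n; 1-m; (1-z)/2). *)
Definition legP (m n : nat) (z : R) : R :=
  sqrt ((z + 1) / (z - 1)) ^ m *
  hyp2F1reg (INR n + 1) (- INR n)
    (fun k => rgamma_int (1 - Z.of_nat m + Z.of_nat k)%Z) ((1 - z) / 2).

(** Associated Legendre function of the second kind Q^m_n(z), z > 1: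
    e^{m pi i} sqrt(pi) Gamma(n+m+1) (z^2-1)^{m/2} / (2^{n+1} z^{n+m+1})
      * F((n+m)/2+1, (n+m+1)/2; n+3/2; 1/z^2),
    with 1/Gamma(n+3/2+k) = 1/gamma_half (n+k+1). *)
Definition legQ (m n : nat) (z : R) : R :=
  (-1) ^ m * sqrt PI * INR (Factorial.fact (n + m)) * sqrt (z ^ 2 - 1) ^ m
  / (2 ^ (n + 1) * z ^ (n + m + 1))
  * hyp2F1reg ((INR n + INR m) / 2 + 1) ((INR n + INR m + 1) / 2)
      (fun k => / gamma_half (n + k + 1)) (/ z ^ 2).

(** Q_{m-1/2}(z) = Q^0_{m-1/2}(z), z > 1:
    sqrt(pi) Gamma(m+1/2) / (2^{m+1/2} z^{m+1/2})
      * F((m-1/2)/2+1, (m+1/2)/2; m+1; 1/z^2),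
    with 1/Gamma(m+1+k) = 1/(m+k)!. *)
Definition legQhalf (m : nat) (z : R) : R :=
  sqrt PI * gamma_half m / (2 ^ m * sqrt 2 * (z ^ m * sqrt z))
  * hyp2F1reg ((INR m - /2) / 2 + 1) ((INR m + /2) / 2)
      (fun k => / INR (Factorial.fact (m + k))) (/ z ^ 2).

(** Legendre polynomials (Bonnet recurrence):
    P_0 = 1, P_1 = x, (k+2) P_{k+2} = (2k+3) x P_{k+1} - (k+1) P_k. *)
Fixpoint legendre_pair (n : nat) (x : R) : R * R :=
  match n with
  | O => (1, x)
  | S n' => let (p, q) := legendre_pair n' x in
            (q, ((2 * INR n' + 3) * x * q - (INR n' + 1) * p) / (INR n' + 2))
  end.
Definition legendre (n : nat) (x : R) : R := fst (legendre_pair n x).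

Definition ferrersP (m n : nat) (x : R) : R :=
  (-1) ^ m * sqrt (1 - x ^ 2) ^ m * Derive_n (legendre n) m x.

Definition chi (s s' t t' : R) : R :=
  (cosh s ^ 2 + cosh s' ^ 2 - sin t ^ 2 - sin t' ^ 2
     - 2 * cosh s * cosh s' * cos t * cos t')
  / (2 * sinh s * sinh s' * sin t * sin t').

(* Main.v *)
Require Import Defs.
From Stdlib Require Import Reals Lra Lia Psatz.
From Coquelicot Require Import Coquelicot.
Open Scope R_scope.

(** With [x = cos t], [y = cos t'], [a = cosh s], [b = cosh s'], put
    [S = x^2 + y^2 + a^2 + b^2 - 2 - 2 x y a b].  Then [Q_(m-1/2)(chi)] is, up to powers of the
    sines, the kernel [k = G(u) / S^(m+1/2)] with [u = 1/chi^2], which is symmetric in the four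
    variables.  The hypergeometric equation of [G] makes the operator
    [A = (1-x^2) D^2 - 2(m+1) x D] act on [k] in the same way in each variable, and [P_n^(m)] is an
    eigenfunction of [A].  Green's identity therefore shows that
    [J = int_0^pi (sin t)^(2m+1) P_n^(m)(cos t) k dt] satisfies the eigenvalue equation in [b] and
    in [y].  Being regular at [b = 1] and at [y = 1], it is a multiple of [P_n^(m)(b) P_n^(m)(y)],
    with factor given by [b = y = 1], where [k] reduces to a multiple of [(a - x)^(-2m-1)].
    Expanding that power and computing the moments of the weight by the same Green identity gives
    the series of [Q_n^m(a)].  For [s = s'] let [s'] increase to [s]: since
    [G(u) = O((1-u)^(-1/4))], the integrands are dominated by a multiple of [|t - t'|^(-1/2)]. *)

(** * Derivatives of the Legendre polynomials *)

(** Dividing out the sines leaves a polynomial eigenfunction and the weight [(1-x^2)^m], for which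
    [A] is symmetric; the kernel then no longer distinguishes angles from radii, so derivatives are
    computed in one slot only. The obstacle is that the equations in [b] and [y] are singular at 1,
    where the usual uniqueness theorem does not apply. Putting [b = cosh tau] or [y = cos tau] turns
    regularity into a vanishing derivative at [tau = 0], and the singular coefficient
    [(2m+1) coth tau] or [(2m+1) cot tau] becomes a friction term that is bounded below, so an
    energy estimate applies. At equal radii the exponent 1/4 is a convenient overestimate of a
    logarithm: [1-u] is at least a multiple of [(t-t')^2], so every exponent below 1/2 would give an
    integrable bound. Integrability of [|t-t'|^(-1/2)] is itself obtained by monotone convergence
    from continuous functions with bounded Riemann integrals, so that no improper integral
    occurs. *)

(* The pair (P_n^(m)(x), P_(n+1)^(m)(x)), by the Bonnet recurrence differentiated [m] times. *)
Fixpoint legendre_deriv_pair (n m : nat) (x : R) : R * R :=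
  match n with
  | O => (match m with O => 1 | _ => 0 end,
          match m with O => x | S O => 1 | _ => 0 end)
  | S n' =>
      (snd (legendre_deriv_pair n' m x),
       ((2 * INR n' + 3) * (x * snd (legendre_deriv_pair n' m x)
          + INR m * snd (legendre_deriv_pair n' (pred m) x))
        - (INR n' + 1) * fst (legendre_deriv_pair n' m x)) / (INR n' + 2))
  end.

Definition legendre_deriv (n m : nat) (x : R) : R := fst (legendre_deriv_pair n m x).

(** Leibniz' rule applied to [x P_(n+1)] produces the term with [pred m]. At [m = 0] its factor
    [INR m] vanishes, so the value of [pred 0] is immaterial. *)
Lemma legendre_deriv_bonnet n m x :
  legendre_deriv (S (S n)) m x =
  ((2 * INR n + 3) * (x * legendre_deriv (S n) m x
     + INR m * legendre_deriv (S n) (pred m) x)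
   - (INR n + 1) * legendre_deriv n m x) / (INR n + 2).
Proof. reflexivity. Qed.

Lemma nat_ind2 (P : nat -> Prop) :
  P O -> P 1%nat -> (forall n, P n -> P (S n) -> P (S (S n))) -> forall n, P n.
Proof.
  intros H0 H1 H n. enough (P n /\ P (S n)) by tauto.
  induction n; firstorder.
Qed.

(** The family is closed under differentiation, so differentiability of every order comes with the
    recurrence instead of being a side condition on iterated [Derive]. *)
Lemma is_derive_legendre_deriv n : forall m x,
  is_derive (legendre_deriv n m) x (legendre_deriv n (S m) x).
Proof.
  induction n as [| |n IH0 IH1] using nat_ind2; intros m x.
  - destruct m as [|m]; unfold legendre_deriv; simpl; auto_derive; trivial.
  - destruct m as [|[|m]]; unfold legendre_deriv; simpl; auto_derive; trivial.
  - apply (is_derive_ext (fun x => ((2 * INR n + 3) * (x * legendre_deriv (S n) m x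
       + INR m * legendre_deriv (S n) (pred m) x)
       - (INR n + 1) * legendre_deriv n m x) / (INR n + 2))).
    { intros; now rewrite legendre_deriv_bonnet. }
    pose proof (IH1 m x) as D1. pose proof (IH0 m x) as D0.
    pose proof (IH1 (pred m) x) as D2.
    assert (INR n + 2 <> 0) by (pose proof (pos_INR n); lra).
    auto_derive.
    { repeat split; trivial; eexists; eassumption. }
    replace (Derive (fun x0 => legendre_deriv (S n) m x0) x)
      with (legendre_deriv (S n) (S m) x) by (symmetry; now apply is_derive_unique).
    replace (Derive (fun x0 => legendre_deriv (S n) (pred m) x0) x)
      with (legendre_deriv (S n) (S (pred m)) x) by (symmetry; now apply is_derive_unique).
    replace (Derive (fun x0 => legendre_deriv n m x0) x)
      with (legendre_deriv n (S m) x) by (symmetry; now apply is_derive_unique).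
    rewrite legendre_deriv_bonnet. rewrite S_INR.
    destruct m as [|m]; cbn [pred].
    + change (INR 0) with 0. field; trivial.
    + field; trivial.
Qed.

Lemma legendre_pair_snd n x : snd (legendre_pair n x) = fst (legendre_pair (S n) x).
Proof. simpl. now destruct (legendre_pair n x). Qed.

Lemma legendre_deriv_0 n : forall x, legendre_deriv n 0 x = legendre n x.
Proof.
  induction n as [| |n IH0 IH1] using nat_ind2; intros x; [reflexivity..|].
  rewrite legendre_deriv_bonnet, IH0, IH1. unfold legendre.
  rewrite <- (legendre_pair_snd (S n)).
  change (legendre_pair (S n) x) with
    (let (p, q) := legendre_pair n x in
      (q, ((2 * INR n + 3) * x * q - (INR n + 1) * p) / (INR n + 2))).
  destruct (legendre_pair n x) as [p q]. simpl.
  field. pose proof (pos_INR n); lra.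
Qed.

Lemma Derive_n_legendre n m : forall x, Derive_n (legendre n) m x = legendre_deriv n m x.
Proof.
  induction m as [|m IH]; intros x; simpl.
  - now rewrite legendre_deriv_0.
  - rewrite (Derive_ext _ _ _ IH). apply is_derive_unique, is_derive_legendre_deriv.
Qed.

Lemma legendre_deriv_gt n : forall m x, (n < m)%nat -> legendre_deriv n m x = 0.
Proof.
  induction n as [| |n IH0 IH1] using nat_ind2; intros m x Hm.
  - destruct m; [lia|reflexivity].
  - destruct m as [|[|m]]; [lia|lia|reflexivity].
  - rewrite legendre_deriv_bonnet, IH0, !IH1 by lia.
    field. pose proof (pos_INR n); lra.
Qed.

(** The two first-order relations are proved together: the second one at [n] eliminates [P_n'] from
    the differentiated recurrence and yields the first one at [n + 1]. *)
Lemma legendre_deriv_rec n : forall x,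
  legendre_deriv (S n) 1 x = x * legendre_deriv n 1 x + (INR n + 1) * legendre_deriv n 0 x /\
  x * legendre_deriv (S n) 1 x = legendre_deriv n 1 x + (INR n + 1) * legendre_deriv (S n) 0 x.
Proof.
  induction n as [|n IH]; intros x.
  - cbn. lra.
  - destruct (IH x) as [H1 H2].
    assert (Hn : INR n + 2 <> 0) by (pose proof (pos_INR n); lra).
    pose proof (legendre_deriv_bonnet n 0 x) as B0.
    pose proof (legendre_deriv_bonnet n 1 x) as B1.
    cbn [pred] in B0, B1. change (INR 0) with 0 in B0. change (INR 1) with 1 in B1.
    assert (C0 : (INR n + 2) * legendre_deriv (S (S n)) 0 x =
      (2 * INR n + 3) * (x * legendre_deriv (S n) 0 x) - (INR n + 1) * legendre_deriv n 0 x)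
      by (rewrite B0; field; trivial).
    rewrite S_INR.
    assert (A : legendre_deriv (S (S n)) 1 x =
      x * legendre_deriv (S n) 1 x + (INR n + 1 + 1) * legendre_deriv (S n) 0 x).
    { rewrite B1.
      replace (legendre_deriv n 1 x) with
        (x * legendre_deriv (S n) 1 x - (INR n + 1) * legendre_deriv (S n) 0 x) by lra.
      field; trivial. }
    split; [exact A|]. rewrite A.
    replace (INR n + 1 + 1) with (INR n + 2) by ring. rewrite C0.
    assert (E : x * (x * legendre_deriv (S n) 1 x) - legendre_deriv (S n) 1 x =
       (INR n + 1) * (x * legendre_deriv (S n) 0 x) - (INR n + 1) * legendre_deriv n 0 x).
    { rewrite H2 at 1. rewrite H1 at 1. ring. }
    nra.
Qed.

(** Legendre's equation arises by differentiating [(1 - x^2) P_(n+1)' = (n+1) (P_n - x P_(n+1))], a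
    combination of the two first-order relations, and eliminating [P_n'] once more. *)
Lemma legendre_deriv_ode0 n x :
  (1 - x ^ 2) * legendre_deriv n 2 x - 2 * x * legendre_deriv n 1 x
  + INR n * (INR n + 1) * legendre_deriv n 0 x = 0.
Proof.
  destruct n as [|n]; [cbn; ring|].
  assert (E : forall x, (1 - x ^ 2) * legendre_deriv (S n) 1 x =
     (INR n + 1) * (legendre_deriv n 0 x - x * legendre_deriv (S n) 0 x)).
  { intros z. destruct (legendre_deriv_rec n z) as [H1 H2].
    replace ((1 - z ^ 2) * legendre_deriv (S n) 1 z)
      with (legendre_deriv (S n) 1 z - z * (z * legendre_deriv (S n) 1 z)) by ring.
    rewrite H2, H1. ring. }
  assert (D1 : is_derive (fun x => (1 - x ^ 2) * legendre_deriv (S n) 1 x) x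
     ((1 - x ^ 2) * legendre_deriv (S n) 2 x - 2 * x * legendre_deriv (S n) 1 x)).
  { pose proof (is_derive_legendre_deriv (S n) 1 x) as D. auto_derive.
    - eexists; eassumption.
    - replace (Derive (fun x0 => legendre_deriv (S n) 1 x0) x)
      with (legendre_deriv (S n) 2 x) by (symmetry; now apply is_derive_unique). ring. }
  assert (D2 : is_derive (fun x => (1 - x ^ 2) * legendre_deriv (S n) 1 x) x
     ((INR n + 1) * (legendre_deriv n 1 x - legendre_deriv (S n) 0 x
        - x * legendre_deriv (S n) 1 x))).
  { apply (is_derive_ext
      (fun x => (INR n + 1) * (legendre_deriv n 0 x - x * legendre_deriv (S n) 0 x))).
    { intros; now rewrite E. }
    pose proof (is_derive_legendre_deriv (S n) 0 x) as D.
    pose proof (is_derive_legendre_deriv n 0 x) as D'. auto_derive.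
    - repeat split; eexists; eassumption.
    - replace (Derive (fun x0 => legendre_deriv (S n) 0 x0) x)
      with (legendre_deriv (S n) 1 x) by (symmetry; now apply is_derive_unique).
      replace (Derive (fun x0 => legendre_deriv n 0 x0) x)
      with (legendre_deriv n 1 x) by (symmetry; now apply is_derive_unique). ring. }
  apply is_derive_unique in D1. apply is_derive_unique in D2. rewrite D1 in D2.
  rewrite D2, S_INR. destruct (legendre_deriv_rec n x) as [_ H2]. rewrite H2. ring.
Qed.

(** Each differentiation of Legendre's equation adds [-2x] to the first-order coefficient; after [m]
    of them the operator is [A] of the overview. *)
Lemma legendre_deriv_ode n m : forall x,
  (1 - x ^ 2) * legendre_deriv n (S (S m)) x
  - 2 * (INR m + 1) * x * legendre_deriv n (S m) x
  + (INR n * (INR n + 1) - INR m * (INR m + 1)) * legendre_deriv n m x = 0.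
Proof.
  induction m as [|m IH]; intros x.
  - rewrite <- (legendre_deriv_ode0 n x). simpl INR. ring.
  - assert (D0 : is_derive (fun x => (1 - x ^ 2) * legendre_deriv n (S (S m)) x
      - 2 * (INR m + 1) * x * legendre_deriv n (S m) x
      + (INR n * (INR n + 1) - INR m * (INR m + 1)) * legendre_deriv n m x) x 0).
    { apply (is_derive_ext (fun _ => 0)); [intros; now rewrite IH|auto_derive; trivial]. }
    apply is_derive_unique in D0. rewrite <- D0. symmetry. apply is_derive_unique.
    pose proof (is_derive_legendre_deriv n m x) as Da.
    pose proof (is_derive_legendre_deriv n (S m) x) as Db.
    pose proof (is_derive_legendre_deriv n (S (S m)) x) as Dc.
    auto_derive.
    { repeat split; eexists; eassumption. }
    replace (Derive (fun x0 => legendre_deriv n m x0) x)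
      with (legendre_deriv n (S m) x) by (symmetry; now apply is_derive_unique).
    replace (Derive (fun x0 => legendre_deriv n (S m) x0) x)
      with (legendre_deriv n (S (S m)) x) by (symmetry; now apply is_derive_unique).
    replace (Derive (fun x0 => legendre_deriv n (S (S m)) x0) x)
      with (legendre_deriv n (S (S (S m))) x) by (symmetry; now apply is_derive_unique).
    rewrite S_INR. ring.
Qed.

Lemma legendre_at_1 n : legendre_deriv n 0 1 = 1.
Proof.
  induction n as [| |n IH0 IH1] using nat_ind2; [reflexivity..|].
  rewrite legendre_deriv_bonnet, IH0, IH1. simpl INR.
  field. pose proof (pos_INR n); lra.
Qed.

(** At 1 the leading coefficient of the equation vanishes, which leaves [2 (k+1) P^(k+1)(1) = (n-k)
    (n+k+1) P^(k)(1)]. The Pochhammer form is the one that matches the series defining [legP]. *)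
Lemma legendre_deriv_at_1 n k :
  legendre_deriv n k 1 =
  poch (INR n + 1) k * poch (- INR n) k / INR (Factorial.fact k) * (- / 2) ^ k.
Proof.
  induction k as [|k IH].
  - rewrite legendre_at_1. simpl. field.
  - pose proof (legendre_deriv_ode n k 1) as O. rewrite IH in O.
    assert (K : 2 * (INR k + 1) <> 0) by (pose proof (pos_INR k); lra).
    apply (Rmult_eq_reg_l (2 * (INR k + 1))); [|trivial].
    assert (F := INR_fact_neq_0 k).
    rewrite fact_simpl, mult_INR, S_INR. simpl poch. simpl pow.
    transitivity ((INR n * (INR n + 1) - INR k * (INR k + 1)) *
      (poch (INR n + 1) k * poch (- INR n) k / INR (Factorial.fact k) * (- / 2) ^ k)); [lra|].
    field. split; trivial. lra.
Qed.

(** The same recurrence solved in factorials; this form shows that the value is nonzero and supplies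
    the normalization of both separations. *)
Lemma legendre_deriv_at_1_fact n m : (m <= n)%nat ->
  legendre_deriv n m 1 =
  INR (Factorial.fact (n + m)) / (2 ^ m * INR (Factorial.fact m) * INR (Factorial.fact (n - m))).
Proof.
  induction m as [|m IH]; intros Hm.
  - rewrite legendre_at_1, Nat.add_0_r, Nat.sub_0_r. simpl. field. apply INR_fact_neq_0.
  - pose proof (legendre_deriv_ode n m 1) as O. rewrite (IH ltac:(lia)) in O.
    assert (K : 2 * (INR m + 1) <> 0) by (pose proof (pos_INR m); lra).
    apply (Rmult_eq_reg_l (2 * (INR m + 1))); [|trivial].
    assert (F := INR_fact_neq_0 m). assert (F' := INR_fact_neq_0 (n - S m)).
    replace (n - m)%nat with (S (n - S m)) in O by lia.
    rewrite <- plus_n_Sm.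
    rewrite fact_simpl, mult_INR, S_INR, plus_INR.
    rewrite (fact_simpl m), mult_INR, (S_INR m). simpl pow.
    rewrite (fact_simpl (n - S m)), mult_INR in O.
    assert (E : INR (S (n - S m)) = INR n - INR m).
    { replace (S (n - S m)) with (n - m)%nat by lia. rewrite minus_INR by lia. ring. }
    assert (E' : INR n - INR m <> 0) by (rewrite <- E; apply not_0_INR; lia).
    rewrite E in O.
    assert (H2 := pow_nonzero 2 m ltac:(lra)).
    transitivity ((INR n * (INR n + 1) - INR m * (INR m + 1)) *
      (INR (Factorial.fact (n + m)) / (2 ^ m * INR (Factorial.fact m)
        * ((INR n - INR m) * INR (Factorial.fact (n - S m)))))); [lra|].
    field. repeat split; trivial. lra.
Qed.

(** * Hypergeometric and binomial power series *)

Lemma is_lim_seq_shift_ratio p q : 0 < q -> is_lim_seq (fun k => (p + INR k) / (q + INR k)) 1.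
Proof.
  intros Hq.
  apply (is_lim_seq_ext (fun k => 1 + (p - q) * / (q + INR k))).
  { intros k. field. pose proof (pos_INR k); lra. }
  replace (Finite 1) with (Rbar_plus 1 ((p - q) * 0)) by (simpl; f_equal; ring).
  apply is_lim_seq_plus'; [apply is_lim_seq_const|].
  apply (is_lim_seq_scal_l (fun k => / (q + INR k)) (p - q) 0).
  replace (Finite 0) with (Rbar_inv p_infty) by reflexivity.
  apply is_lim_seq_inv; [|easy].
  replace p_infty with (Rbar_plus q p_infty) by reflexivity.
  eapply is_lim_seq_plus; [apply is_lim_seq_const|apply is_lim_seq_INR|reflexivity].
Qed.

Lemma poch_pos a k : 0 < a -> 0 < poch a k.
Proof.
  intros Ha. induction k as [|k IH]; simpl; [lra|].
  apply Rmult_lt_0_compat; trivial. pose proof (pos_INR k); lra.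
Qed.

Lemma CV_radius_1 (a : nat -> R) :
  (forall k, 0 < a k) -> is_lim_seq (fun k => a (S k) / a k) 1 -> CV_radius a = 1.
Proof.
  intros Ha Hl. rewrite (CV_radius_finite_DAlembert a 1); [now rewrite Rinv_1| |lra|].
  - intros k; specialize (Ha k); lra.
  - apply is_lim_seq_ext with (2 := Hl). intros k. rewrite Rabs_pos_eq; trivial.
    apply Rlt_le, Rdiv_lt_0_compat; trivial.
Qed.

Lemma ex_pseries_in_unit (a : nat -> R) x : CV_radius a = 1 -> Rabs x < 1 -> ex_pseries a x.
Proof. intros Ha Hx. apply CV_radius_inside. now rewrite Ha. Qed.

(** Taylor coefficients of [(1 - x)^(-al)]. *)
Definition binom_coef (al : R) (k : nat) : R := poch al k / INR (Factorial.fact k).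

Lemma binom_coef_pos al k : 0 < al -> 0 < binom_coef al k.
Proof. intros. apply Rdiv_lt_0_compat; [now apply poch_pos|apply INR_fact_lt_0]. Qed.

Lemma binom_coef_S al k : binom_coef al (S k) * (INR k + 1) = (al + INR k) * binom_coef al k.
Proof.
  unfold binom_coef. rewrite fact_simpl, mult_INR, S_INR. simpl poch.
  field. split; [apply INR_fact_neq_0|]. pose proof (pos_INR k); lra.
Qed.

Lemma CV_radius_binom al : 0 < al -> CV_radius (binom_coef al) = 1.
Proof.
  intros Ha. apply CV_radius_1; [intros; now apply binom_coef_pos|].
  apply is_lim_seq_ext with (2 := is_lim_seq_shift_ratio al 1 Rlt_0_1).
  intros k. pose proof (binom_coef_pos al k Ha). pose proof (pos_INR k).
  pose proof (binom_coef_S al k).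
  apply (Rmult_eq_reg_r ((1 + INR k) * binom_coef al k)); [|nra].
  field_simplify; lra.
Qed.

(** The coefficient recurrence says [(1 - z) f' = al f] for the sum [f], so the product with
    [(1 - z)^al] has zero derivative and keeps its value at 0. *)
Lemma binomial_series al x : 0 < al -> Rabs x < 1 ->
  PSeries (binom_coef al) x * Rpower (1 - x) al = 1.
Proof.
  intros Ha Hx. pose proof (CV_radius_binom al Ha) as Hr.
  assert (HD : forall z, Rabs z < 1 ->
    is_derive (fun z => PSeries (binom_coef al) z * Rpower (1 - z) al) z 0).
  { intros z Hz.
    assert (D := is_derive_PSeries (binom_coef al) z). rewrite Hr in D. specialize (D Hz).
    apply Rabs_def2 in Hz as Hz'.
    assert (E : (1 - z) * PSeries (PS_derive (binom_coef al)) z = al * PSeries (binom_coef al) z).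
    { rewrite Rmult_minus_distr_r, Rmult_1_l, <- PSeries_incr_1, <- PSeries_scal.
      cut (PSeries (PS_derive (binom_coef al)) z =
        PSeries (PS_scal al (binom_coef al)) z + PSeries (PS_incr_1 (PS_derive (binom_coef al))) z);
        [lra|].
      rewrite <- PSeries_plus.
      - apply PSeries_ext. intros k. unfold PS_plus, PS_scal, PS_incr_1, PS_derive.
        rewrite S_INR. change plus with Rplus; change scal with Rmult.
        rewrite Rmult_comm, binom_coef_S. destruct k as [|k].
        + simpl. change zero with 0. ring.
        + change (@zero R_AbelianGroup) with 0. rewrite Rmult_plus_distr_r. reflexivity.
      - apply ex_pseries_in_unit; [|easy]. rewrite CV_radius_scal; [easy|lra].
      - apply ex_pseries_incr_1, ex_pseries_in_unit; [|easy]. now rewrite CV_radius_derive. }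
    unfold Rpower. auto_derive.
    { repeat split; [eexists; eassumption|lra]. }
    replace (Derive (fun x0 => PSeries (binom_coef al) x0) z)
      with (PSeries (PS_derive (binom_coef al)) z) by (symmetry; now apply is_derive_unique).
    replace (1 + - z) with (1 - z) by ring.
    apply (Rmult_eq_reg_l (1 - z)); [|lra].
    transitivity (((1 - z) * PSeries (PS_derive (binom_coef al)) z
      - al * PSeries (binom_coef al) z) * exp (al * ln (1 - z))); [field; lra|].
    rewrite E. ring. }
  assert (H0 : PSeries (binom_coef al) 0 * Rpower (1 - 0) al = 1).
  { rewrite PSeries_0. unfold binom_coef, Rpower. simpl.
    rewrite Rminus_0_r, ln_1, Rmult_0_r, exp_0. field. }
  transitivity (PSeries (binom_coef al) 0 * Rpower (1 - 0) al); [|exact H0].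
  apply Rabs_def2 in Hx.
  destruct (Rtotal_order x 0) as [L|[->|L]]; trivial.
  - apply (eq_is_derive (fun z => PSeries (binom_coef al) z * Rpower (1 - z) al)); trivial.
    intros t Ht. apply HD, Rabs_def1; lra.
  - symmetry.
    apply (eq_is_derive (fun z => PSeries (binom_coef al) z * Rpower (1 - z) al)); trivial.
    intros t Ht. apply HD, Rabs_def1; lra.
Qed.

(** * The hypergeometric factor of [Q_(m-1/2)]: equation and growth at 1 *)

Definition Qhalf_coef (m k : nat) : R :=
  poch ((INR m - /2) / 2 + 1) k * poch ((INR m + /2) / 2) k
  * / INR (Factorial.fact (m + k)) / INR (Factorial.fact k).

Lemma Qhalf_coef_pos m k : 0 < Qhalf_coef m k.
Proof.
  pose proof (pos_INR m).
  repeat apply Rmult_lt_0_compat; try apply poch_pos; try lra;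
    apply Rinv_0_lt_compat, INR_fact_lt_0.
Qed.

Lemma Qhalf_coef_S m k :
  (INR k + 1) * (INR m + 1 + INR k) * Qhalf_coef m (S k) =
  ((INR m - /2) / 2 + 1 + INR k) * ((INR m + /2) / 2 + INR k) * Qhalf_coef m k.
Proof.
  unfold Qhalf_coef. rewrite <- plus_n_Sm, !fact_simpl, !mult_INR, !S_INR, plus_INR. simpl poch.
  pose proof (pos_INR k). pose proof (pos_INR m).
  field. repeat split; try apply INR_fact_neq_0; lra.
Qed.

Lemma CV_radius_Qhalf m : CV_radius (Qhalf_coef m) = 1.
Proof.
  apply CV_radius_1; [apply Qhalf_coef_pos|].
  pose proof (pos_INR m).
  replace (Finite 1) with (Finite (1 * 1)) by (f_equal; ring).
  apply is_lim_seq_ext with (2 := is_lim_seq_mult' _ _ _ _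
    (is_lim_seq_shift_ratio ((INR m - /2) / 2 + 1) 1 Rlt_0_1)
    (is_lim_seq_shift_ratio ((INR m + /2) / 2) (INR m + 1) ltac:(lra))).
  intros k. pose proof (Qhalf_coef_pos m k). pose proof (pos_INR k).
  pose proof (Qhalf_coef_S m k) as E.
  apply (Rmult_eq_reg_r ((INR k + 1) * (INR m + 1 + INR k) * Qhalf_coef m k)).
  - transitivity (((INR m - /2) / 2 + 1 + INR k) * ((INR m + /2) / 2 + INR k) * Qhalf_coef m k).
    + field. split; lra.
    + rewrite <- E. field. lra.
  - assert (0 < (INR k + 1) * (INR m + 1 + INR k)) by nra. nra.
Qed.

Definition G0 (m : nat) (u : R) : R := PSeries (Qhalf_coef m) u.
Definition G1 (m : nat) (u : R) : R := PSeries (PS_derive (Qhalf_coef m)) u.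
Definition G2 (m : nat) (u : R) : R := PSeries (PS_derive (PS_derive (Qhalf_coef m))) u.

Lemma is_derive_G0 m u : Rabs u < 1 -> is_derive (G0 m) u (G1 m u).
Proof. intros. apply is_derive_PSeries. now rewrite CV_radius_Qhalf. Qed.

Lemma is_derive_G1 m u : Rabs u < 1 -> is_derive (G1 m) u (G2 m u).
Proof. intros. apply is_derive_PSeries. now rewrite CV_radius_derive, CV_radius_Qhalf. Qed.

Lemma continuous_G2 m u : Rabs u < 1 -> continuous (G2 m) u.
Proof.
  intros. apply continuity_pt_filterlim, PSeries_continuity.
  now rewrite !CV_radius_derive, CV_radius_Qhalf.
Qed.

(** Both sides of the coefficient recurrence are summed: one gives [u G'' + (m+1) G'], the other
    [u^2 G'' + (al+be+1) u G' + al be G]. Here [al + be = m + 1] equals the lower parameter, the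
    logarithmic case at [u = 1]. *)
Lemma G_ode m u : Rabs u < 1 ->
  u * (1 - u) * G2 m u + (INR m + 1 - (INR m + 2) * u) * G1 m u
  - (INR m + /2) * (INR m + 3 / 2) / 4 * G0 m u = 0.
Proof.
  intros Hu.
  set (g := Qhalf_coef m).
  assert (R0 : CV_radius g = 1) by apply CV_radius_Qhalf.
  assert (R1 : CV_radius (PS_derive g) = 1) by now rewrite CV_radius_derive.
  assert (R2 : CV_radius (PS_derive (PS_derive g)) = 1) by now rewrite CV_radius_derive.
  set (al := (INR m - /2) / 2 + 1). set (be := (INR m + /2) / 2).
  assert (L : u * G2 m u + (INR m + 1) * G1 m u =
    PSeries (fun k => (al + INR k) * (be + INR k) * g k) u).
  { unfold G2, G1. rewrite <- PSeries_incr_1, <- PSeries_scal, <- PSeries_plus.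
    - apply PSeries_ext. intros k. unfold g, al, be. rewrite <- Qhalf_coef_S.
      unfold PS_plus, PS_scal, PS_incr_1. change plus with Rplus; change scal with Rmult.
      destruct k as [|k]; unfold PS_derive.
      + change (@zero R_NormedModule) with 0. simpl. ring.
      + rewrite !S_INR. ring.
    - apply ex_pseries_incr_1, ex_pseries_in_unit; easy.
    - apply ex_pseries_scal; [apply Rmult_comm|]. apply ex_pseries_in_unit; easy. }
  assert (Rr : u * (u * G2 m u) + (INR m + 2) * (u * G1 m u) + al * be * G0 m u =
    PSeries (fun k => (al + INR k) * (be + INR k) * g k) u).
  { unfold G2, G1, G0.
    rewrite <- !PSeries_incr_1. rewrite <- !PSeries_scal, <- !PSeries_plus.
    - apply PSeries_ext. intros k. fold g.
      unfold PS_plus, PS_scal, PS_incr_1. change plus with Rplus; change scal with Rmult.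
      change (@zero R_NormedModule) with 0.
      destruct k as [|[|k]]; unfold PS_derive; rewrite ?S_INR; simpl INR;
        unfold al, be; change (@zero R_AbelianGroup) with 0; field.
    - apply ex_pseries_plus.
      + apply ex_pseries_incr_1, ex_pseries_incr_1, ex_pseries_in_unit; easy.
      + apply ex_pseries_scal; [apply Rmult_comm|]. apply ex_pseries_incr_1, ex_pseries_in_unit; easy.
    - apply ex_pseries_scal; [apply Rmult_comm|]. apply ex_pseries_in_unit; easy.
    - apply ex_pseries_incr_1, ex_pseries_incr_1, ex_pseries_in_unit; easy.
    - apply ex_pseries_scal; [apply Rmult_comm|]. apply ex_pseries_incr_1, ex_pseries_in_unit; easy. }
  rewrite <- L in Rr. unfold al, be in Rr. lra.
Qed.

(* For [k >= m^2 + m] the ratio of consecutive coefficients is at most that of the binomial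
   series of exponent [-1/4]. *)
Lemma Qhalf_coef_le_binom m : exists C, 0 < C /\ forall k, Qhalf_coef m k <= C * binom_coef (/4) k.
Proof.
  set (N := (m * m + m)%nat).
  assert (P : exists C, 0 < C /\ forall k, (k <= N)%nat -> Qhalf_coef m k <= C * binom_coef (/4) k).
  { induction N as [|N [C [HC IH]]].
    - exists (Qhalf_coef m 0). split; [apply Qhalf_coef_pos|]. intros k Hk.
      replace k with O by lia. unfold binom_coef; simpl. lra.
    - exists (C + Qhalf_coef m (S N) / binom_coef (/4) (S N)).
      assert (B := binom_coef_pos (/4) (S N) ltac:(lra)).
      assert (0 < Qhalf_coef m (S N) / binom_coef (/4) (S N))
        by (apply Rdiv_lt_0_compat; trivial; apply Qhalf_coef_pos).
      split; [lra|]. intros k Hk.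
      destruct (Nat.eq_dec k (S N)) as [->|Ne].
      + rewrite Rmult_plus_distr_r. unfold Rdiv at 1.
        rewrite Rmult_assoc, Rinv_l by lra. nra.
      + specialize (IH k ltac:(lia)). assert (B' := binom_coef_pos (/4) k ltac:(lra)). nra. }
  destruct P as [C [HC P]]. exists C. split; [easy|]. intros k.
  destruct (Nat.le_gt_cases k N) as [Hk|Hk]; [now apply P|].
  induction k as [|k IH]; [lia|].
  assert (Hk' : (N <= k)%nat) by lia.
  assert (IH' : Qhalf_coef m k <= C * binom_coef (/4) k).
  { destruct (Nat.eq_dec k N) as [->|Ne]; [now apply P|apply IH; lia]. }
  clear IH.
  pose proof (Qhalf_coef_S m k) as E. pose proof (binom_coef_S (/4) k) as E'.
  assert (Hm := pos_INR m). assert (Hkp := pos_INR k).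
  assert (HkN : INR m * INR m + INR m <= INR k).
  { apply le_INR in Hk'. unfold N in Hk'. rewrite plus_INR, mult_INR in Hk'. exact Hk'. }
  set (M := INR m) in *. set (K := INR k) in *.
  apply (Rmult_le_reg_l ((K + 1) * (M + 1 + K))); [nra|].
  rewrite E.
  apply Rle_trans with ((/ 4 + K) * (M + 1 + K) * Qhalf_coef m k).
  (* After cancellation this reads [(M + 1/2) (M + 3/2) <= M + 1 + K], which is what the threshold
     on [K] guarantees. *)
  - apply Rmult_le_compat_r; [apply Rlt_le, Qhalf_coef_pos|]. nra.
  - apply Rle_trans with ((/ 4 + K) * (M + 1 + K) * (C * binom_coef (/4) k)).
    + apply Rmult_le_compat_l; [nra|easy].
    + apply Req_le.
      transitivity (C * (M + 1 + K) * ((/4 + K) * binom_coef (/4) k)); [ring|].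
      rewrite <- E'. ring.
Qed.

Lemma PSeries_le (a b : nat -> R) u : 0 <= u -> (forall k, 0 <= a k <= b k) -> ex_pseries b u ->
  0 <= PSeries a u <= PSeries b u.
Proof.
  intros Hu Hab Hb. unfold PSeries.
  assert (Hb' : ex_series (fun k => b k * u ^ k)).
  { apply (ex_series_ext (fun k => scal (pow_n u k) (b k))); [|exact Hb].
    intros k. rewrite pow_n_pow. apply Rmult_comm. }
  assert (T : forall k, 0 <= a k * u ^ k <= b k * u ^ k).
  { intros k. destruct (Hab k). assert (0 <= u ^ k) by now apply pow_le. nra. }
  split.
  - replace 0 with (Series (fun _ => 0 * 0)) by (rewrite Series_scal_l; ring).
    apply Series_le; [intros k; rewrite Rmult_0_l; split; [lra|apply T]|].
    apply (@ex_series_le R_AbsRing R_CompleteNormedModule _ (fun k => b k * u ^ k)); trivial.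
    intros k. change norm with Rabs. rewrite Rabs_pos_eq; apply T.
  - now apply Series_le.
Qed.

(** Coefficientwise comparison with [C (1 - u)^(-1/4)]. The bound is kept as a product, which avoids
    a negative power. *)
Lemma G0_bound m : exists C, 0 < C /\ forall u, 0 <= u < 1 ->
  0 <= G0 m u /\ G0 m u * Rpower (1 - u) (/4) <= C.
Proof.
  destruct (Qhalf_coef_le_binom m) as [C [HC H]]. exists C. split; [easy|]. intros u Hu.
  assert (Hau : Rabs u < 1) by (rewrite Rabs_pos_eq; lra).
  assert (B : 0 <= G0 m u <= PSeries (PS_scal C (binom_coef (/4))) u).
  { apply PSeries_le; [lra| |].
    - intros k. split; [apply Rlt_le, Qhalf_coef_pos|apply H].
    - apply ex_pseries_scal; [apply Rmult_comm|]. apply ex_pseries_in_unit; trivial.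
      apply CV_radius_binom; lra. }
  split; [apply B|]. rewrite PSeries_scal in B.
  apply Rle_trans with (C * PSeries (binom_coef (/4)) u * Rpower (1 - u) (/4)).
  - apply Rmult_le_compat_r; [apply Rlt_le, exp_pos|apply B].
  - rewrite Rmult_assoc, (binomial_series (/4) u ltac:(lra) Hau). lra.
Qed.

Lemma G0_at_0 m : G0 m 0 = / INR (Factorial.fact m).
Proof.
  unfold G0. rewrite PSeries_0. unfold Qhalf_coef. simpl. rewrite Nat.add_0_r. field.
  apply INR_fact_neq_0.
Qed.

(** * The kernel as a symmetric function of four variables *)

Section RealContinuity.
Context {T : UniformSpace}.
Implicit Types (f g : T -> R) (z : T).

(** The domain is an arbitrary uniform space because the same integrands must be continuous in the
    angle alone and jointly in the angle and a parameter. Stating the rules with the real operations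
    lets [cont_step] match goals syntactically. *)
Lemma cont_plus f g z : continuous f z -> continuous g z -> continuous (fun z => f z + g z) z.
Proof. apply @continuous_plus. Qed.
Lemma cont_minus f g z : continuous f z -> continuous g z -> continuous (fun z => f z - g z) z.
Proof. apply @continuous_minus. Qed.
Lemma cont_opp f z : continuous f z -> continuous (fun z => - f z) z.
Proof. apply @continuous_opp. Qed.
Lemma cont_mult f g z : continuous f z -> continuous g z -> continuous (fun z => f z * g z) z.
Proof. apply @continuous_mult. Qed.
Lemma cont_pow f z n : continuous f z -> continuous (fun z => f z ^ n) z.
Proof.
  intros Hf. induction n as [|n IH]; simpl; [apply continuous_const|now apply cont_mult].
Qed.
Lemma cont_inv f z : continuous f z -> f z <> 0 -> continuous (fun z => / f z) z.
Proof. intros. apply (continuous_comp f Rinv); [easy|]. now apply continuous_Rinv. Qed.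
Lemma cont_div f g z : continuous f z -> continuous g z -> g z <> 0 ->
  continuous (fun z => f z / g z) z.
Proof. intros. apply cont_mult; [easy|]. now apply cont_inv. Qed.
Lemma cont_comp (h : R -> R) f z l : continuous f z -> is_derive h (f z) l ->
  continuous (fun z => h (f z)) z.
Proof.
  intros Hf Hh. apply (continuous_comp f h); [easy|].
  apply @ex_derive_continuous. now exists l.
Qed.
Lemma cont_sqrt f z : continuous f z -> continuous (fun z => sqrt (f z)) z.
Proof. intros. apply (continuous_comp f sqrt); [easy|apply continuous_sqrt]. Qed.
Lemma cont_cos f z : continuous f z -> continuous (fun z => cos (f z)) z.
Proof. intros. apply (continuous_comp f cos); [easy|apply continuous_cos]. Qed.
Lemma cont_sin f z : continuous f z -> continuous (fun z => sin (f z)) z.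
Proof. intros. apply (continuous_comp f sin); [easy|apply continuous_sin]. Qed.
End RealContinuity.

Ltac cont_step :=
  lazymatch goal with
  | |- continuous (fun _ => ?c) _ => apply continuous_const
  | |- continuous (fun z => @?f z + @?g z) _ => apply (cont_plus f g)
  | |- continuous (fun z => @?f z - @?g z) _ => apply (cont_minus f g)
  | |- continuous (fun z => - @?f z) _ => apply (cont_opp f)
  | |- continuous (fun z => @?f z * @?g z) _ => apply (cont_mult f g)
  | |- continuous (fun z => @?f z / @?g z) _ => apply (cont_div f g)
  | |- continuous (fun z => @?f z ^ _) _ => apply (cont_pow f)
  | |- continuous (fun z => cos (@?f z)) _ => apply (cont_cos f)
  | |- continuous (fun z => sin (@?f z)) _ => apply (cont_sin f)
  end.

Definition Sq (x y a b : R) : R := x ^ 2 + y ^ 2 + a ^ 2 + b ^ 2 - 2 - 2 * x * y * a * b.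
(** The square of the denominator of [chi], whose numerator is [Sq]; the signs of [1 - a^2] and
    [1 - b^2] cancel. Hence [ker_arg] is [1 / chi^2]. *)
Definition Pi4 (x y a b : R) : R := 4 * (1 - x ^ 2) * (1 - y ^ 2) * (1 - a ^ 2) * (1 - b ^ 2).
(** Positivity gives a meaning to the half-integer power, the second condition puts the argument in
    the open unit disc. With the absolute value the condition is invariant under all permutations of
    the variables. *)
Definition good (x y a b : R) : Prop := 0 < Sq x y a b /\ Rabs (Pi4 x y a b) < Sq x y a b ^ 2.
Definition ker_arg (x y a b : R) : R := Pi4 x y a b / Sq x y a b ^ 2.
Definition hpow (m : nat) (s : R) : R := / (s ^ m * sqrt s).

Definition ker (m : nat) (x y a b : R) : R := G0 m (ker_arg x y a b) * hpow m (Sq x y a b).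

(* [ker_arg1], [ker_arg2] and [ker1], [ker2]: first and second derivatives in [x]. *)
Definition Sq1 (x y a b : R) : R := 2 * x - 2 * y * a * b.
Definition ker_arg1 (x y a b : R) : R :=
  let S := Sq x y a b in let S1 := Sq1 x y a b in
  let q := (1 - y ^ 2) * ((1 - a ^ 2) * (1 - b ^ 2)) in
  - 8 * x * q / S ^ 2 - 8 * (1 - x ^ 2) * q * S1 / S ^ 3.
Definition ker_arg2 (x y a b : R) : R :=
  let S := Sq x y a b in let S1 := Sq1 x y a b in
  let q := (1 - y ^ 2) * ((1 - a ^ 2) * (1 - b ^ 2)) in
  - 8 * q / S ^ 2 + 32 * x * q * S1 / S ^ 3 - 16 * (1 - x ^ 2) * q / S ^ 3
  + 24 * (1 - x ^ 2) * q * S1 ^ 2 / S ^ 4.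
Definition ker1 (m : nat) (x y a b : R) : R :=
  let S := Sq x y a b in let S1 := Sq1 x y a b in
  (ker_arg1 x y a b * G1 m (ker_arg x y a b)
   - (INR m + /2) * S1 / S * G0 m (ker_arg x y a b)) * hpow m S.
Definition ker2 (m : nat) (x y a b : R) : R :=
  let S := Sq x y a b in let S1 := Sq1 x y a b in
  (* [al] is the logarithmic derivative of [S^(-m-1/2)] and [al1] its derivative, so the second
     derivative of that power is [al^2 + al1] times it. *)
  let al := - (INR m + /2) * S1 / S in
  let al1 := - (INR m + /2) * (2 / S - S1 ^ 2 / S ^ 2) in
  let u1 := ker_arg1 x y a b in
  ((al ^ 2 + al1) * G0 m (ker_arg x y a b)
   + (2 * al * u1 + ker_arg2 x y a b) * G1 m (ker_arg x y a b)
   + u1 ^ 2 * G2 m (ker_arg x y a b)) * hpow m S.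

Lemma good_arg x y a b : good x y a b -> Rabs (ker_arg x y a b) < 1.
Proof.
  intros [HS HP]. unfold ker_arg. rewrite Rabs_div, (Rabs_pos_eq (_ ^ 2)) by nra.
  apply (Rmult_lt_reg_r (Sq x y a b ^ 2)); [nra|].
  unfold Rdiv. rewrite Rmult_assoc, Rinv_l by nra. lra.
Qed.

Lemma is_derive_hpow m s : 0 < s -> is_derive (hpow m) s (- (INR m + /2) / s * hpow m s).
Proof.
  intros Hs. assert (Hq := sqrt_lt_R0 s Hs). assert (Hp := pow_lt s m Hs).
  assert (E : sqrt s * sqrt s = s) by (apply sqrt_sqrt; lra).
  unfold hpow. auto_derive.
  - split; [easy|]. split; [nra|easy].
  - destruct m as [|m].
    + simpl. set (r := sqrt s) in *. rewrite <- E. field. nra.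
    + rewrite S_INR. simpl pred. simpl pow in *.
      assert (Hp' := pow_lt s m Hs).
      set (r := sqrt s) in *. set (p := s ^ m) in *. clearbody p. rewrite <- E. field. nra.
Qed.

Lemma is_derive_Sq x y a b : is_derive (fun x => Sq x y a b) x (Sq1 x y a b).
Proof. unfold Sq, Sq1. auto_derive; trivial. ring. Qed.

Lemma is_derive_ker_arg x y a b : 0 < Sq x y a b ->
  is_derive (fun x => ker_arg x y a b) x (ker_arg1 x y a b).
Proof.
  intros HS. pose proof (is_derive_Sq x y a b) as D.
  unfold ker_arg, ker_arg1, Pi4. auto_derive.
  - repeat split; [eexists; eassumption|]. nra.
  - replace (Derive (fun x0 => Sq x0 y a b) x) with (Sq1 x y a b)
      by (symmetry; now apply is_derive_unique).
    field. nra.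
Qed.

Lemma is_derive_ker_arg1 x y a b : 0 < Sq x y a b ->
  is_derive (fun x => ker_arg1 x y a b) x (ker_arg2 x y a b).
Proof.
  intros HS. pose proof (is_derive_Sq x y a b) as D.
  assert (D1 : is_derive (fun x => Sq1 x y a b) x 2) by (unfold Sq1; auto_derive; trivial; ring).
  unfold ker_arg1, ker_arg2. cbv zeta. auto_derive.
  - repeat split; try (eexists; eassumption); try nra.
    assert (0 < Sq x y a b ^ 3) by now apply pow_lt. simpl in H; lra.
  - replace (Derive (fun x0 => Sq x0 y a b) x) with (Sq1 x y a b)
      by (symmetry; now apply is_derive_unique).
    replace (Derive (fun x0 => Sq1 x0 y a b) x) with 2
      by (symmetry; now apply is_derive_unique).
    field. nra.
Qed.

Lemma is_derive_comp_R (f g : R -> R) x df dg :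
  is_derive f (g x) df -> is_derive g x dg -> is_derive (fun x => f (g x)) x (df * dg).
Proof. intros Hf Hg. rewrite Rmult_comm. now apply @is_derive_comp. Qed.

Lemma is_derive_mult_R (f g : R -> R) x df dg :
  is_derive f x df -> is_derive g x dg -> is_derive (fun x => f x * g x) x (df * g x + f x * dg).
Proof. intros Hf Hg. apply @is_derive_mult; trivial. apply Rmult_comm. Qed.

Lemma is_derive_eq (f : R -> R) (x l l' : R) : is_derive f x l -> l = l' -> is_derive f x l'.
Proof. now intros H <-. Qed.

Lemma is_derive_ker m x y a b : good x y a b ->
  is_derive (fun x => ker m x y a b) x (ker1 m x y a b).
Proof.
  intros Hg. pose proof (good_arg _ _ _ _ Hg) as Hu. destruct Hg as [HS _].
  pose proof (is_derive_comp_R (G0 m) (fun x => ker_arg x y a b) x _ _ (is_derive_G0 m _ Hu) (is_derive_ker_arg x y a b HS)) as A.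
  pose proof (is_derive_comp_R (hpow m) (fun x => Sq x y a b) x _ _ (is_derive_hpow m _ HS) (is_derive_Sq x y a b)) as B.
  eapply is_derive_eq; [exact (is_derive_mult_R _ _ _ _ _ A B)|].
  unfold ker1. cbv beta zeta. field. lra.
Qed.

Lemma is_derive_ker1 m x y a b : good x y a b ->
  is_derive (fun x => ker1 m x y a b) x (ker2 m x y a b).
Proof.
  intros Hg. pose proof (good_arg _ _ _ _ Hg) as Hu. destruct Hg as [HS _].
  pose proof (is_derive_comp_R (G0 m) (fun x => ker_arg x y a b) x _ _ (is_derive_G0 m _ Hu) (is_derive_ker_arg x y a b HS)) as A.
  pose proof (is_derive_comp_R (G1 m) (fun x => ker_arg x y a b) x _ _ (is_derive_G1 m _ Hu) (is_derive_ker_arg x y a b HS)) as A1.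
  pose proof (is_derive_comp_R (hpow m) (fun x => Sq x y a b) x _ _ (is_derive_hpow m _ HS) (is_derive_Sq x y a b)) as B.
  pose proof (is_derive_mult_R _ _ _ _ _ (is_derive_ker_arg1 x y a b HS) A1) as C1.
  assert (D1 : is_derive (fun x => (INR m + /2) * Sq1 x y a b / Sq x y a b) x
     ((INR m + /2) * (2 / Sq x y a b - Sq1 x y a b ^ 2 / Sq x y a b ^ 2))).
  { pose proof (is_derive_Sq x y a b) as D.
    unfold Sq1 at 1. auto_derive.
    - repeat split; [eexists; eassumption|]. lra.
    - replace (Derive (fun x0 => Sq x0 y a b) x) with (Sq1 x y a b)
        by (symmetry; now apply is_derive_unique).
      unfold Sq1. field. lra. }
  pose proof (is_derive_mult_R _ _ _ _ _ D1 A) as C0.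
  pose proof (is_derive_minus _ _ _ _ _ C1 C0) as C.
  eapply is_derive_eq; [exact (is_derive_mult_R _ _ _ _ _ C B)|].
  unfold ker2. change minus with Rminus. cbv beta zeta. change (@minus R_AbelianGroup) with Rminus.
  set (h := hpow m _). set (g0 := G0 m _). set (g1 := G1 m _). set (g2 := G2 m _).
  set (u1 := ker_arg1 _ _ _ _). set (u2 := ker_arg2 _ _ _ _).
  unfold minus, plus, opp; simpl. field. lra.
Qed.

Lemma Sq_swap x y a b : Sq y x a b = Sq x y a b.
Proof. unfold Sq; ring. Qed.

Lemma ker_arg_swap x y a b : ker_arg y x a b = ker_arg x y a b.
Proof. unfold ker_arg. rewrite Sq_swap. f_equal. unfold Pi4; ring. Qed.

(** All derivatives are taken in the first slot; rotation and transposition together bring any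
    variable there. *)
Lemma ker_rot m x y a b : ker m x y a b = ker m b x y a.
Proof.
  unfold ker, ker_arg. replace (Sq b x y a) with (Sq x y a b) by (unfold Sq; ring).
  now replace (Pi4 b x y a) with (Pi4 x y a b) by (unfold Pi4; ring).
Qed.

Lemma ker_swap m x y a b : ker m x y a b = ker m y x a b.
Proof. unfold ker. now rewrite Sq_swap, ker_arg_swap. Qed.

Lemma good_swap x y a b : good x y a b -> good y x a b.
Proof.
  unfold good. rewrite Sq_swap.
  now replace (Pi4 y x a b) with (Pi4 x y a b) by (unfold Pi4; ring).
Qed.

(* Both sides agree up to a multiple of the hypergeometric equation, with factor
   [16 (x^2 - y^2) (1 - a^2) (1 - b^2) / S^2]. *)
Lemma ker_pde m x y a b : good x y a b ->
  (1 - x ^ 2) * ker2 m x y a b - 2 * (INR m + 1) * x * ker1 m x y a b =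
  (1 - y ^ 2) * ker2 m y x a b - 2 * (INR m + 1) * y * ker1 m y x a b.
Proof.
  intros Hg. pose proof (G_ode m _ (good_arg _ _ _ _ Hg)) as O. destruct Hg as [HS _].
  unfold ker2, ker1, ker_arg2, ker_arg1. rewrite (Sq_swap x y), (ker_arg_swap x y). cbv zeta.
  (* These two polynomial identities are all that is needed about [S] and its derivatives;
     afterwards they are treated as independent symbols, which keeps the calls to [field] small. *)
  assert (L1 : x * Sq1 x y a b - y * Sq1 y x a b - 2 * (x ^ 2 - y ^ 2) = 0)
    by (unfold Sq1; ring).
  assert (L2 : (1 - x ^ 2) * Sq1 x y a b ^ 2 - (1 - y ^ 2) * Sq1 y x a b ^ 2
     + 4 * (x ^ 2 - y ^ 2) * (Sq x y a b + (1 - a ^ 2) * (1 - b ^ 2)) = 0)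
    by (unfold Sq1, Sq; ring).
  assert (Hu : ker_arg x y a b = 4 * (1 - x ^ 2) * (1 - y ^ 2) * ((1 - a ^ 2) * (1 - b ^ 2))
     / Sq x y a b ^ 2) by (unfold ker_arg, Pi4; field; lra).
  set (h := hpow m _). set (g0 := G0 m _) in *. set (g1 := G1 m _) in *. set (g2 := G2 m _) in *.
  clearbody h g0 g1 g2.
  rewrite Hu in O. clear Hu.
  set (S := Sq x y a b) in *. set (Sx := Sq1 x y a b) in *. set (Sy := Sq1 y x a b) in *.
  set (w := (1 - a ^ 2) * (1 - b ^ 2)) in *. clearbody S Sx Sy w.
  set (M := INR m) in *. clearbody M.
  set (X := 1 - x ^ 2) in *. set (Y := 1 - y ^ 2) in *.
  assert (EX : x ^ 2 = 1 - X) by (unfold X; ring). assert (EY : y ^ 2 = 1 - Y) by (unfold Y; ring).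
  rewrite EX, EY in L1, L2. clearbody X Y.
  replace (1 - X - (1 - Y)) with (Y - X) in L1, L2 by ring.
  assert (L1' : x * Sx = y * Sy + 2 * (Y - X)) by lra. clear L1.
  assert (L2' : X * Sx ^ 2 = Y * Sy ^ 2 - 4 * (Y - X) * (S + w)) by lra. clear L2.
  (* The claim is linear in [G], [G'], [G'']. [C0], [C1] and [C2] compare the three coefficients;
     each difference is the common factor times the corresponding coefficient of the hypergeometric
     equation. *)
  assert (C0 : X * ((- (M + / 2) * Sx / S) ^ 2 + - (M + / 2) * (2 / S - Sx ^ 2 / S ^ 2))
     + 2 * (M + 1) * x * ((M + / 2) * Sx / S)
     = Y * ((- (M + / 2) * Sy / S) ^ 2 + - (M + / 2) * (2 / S - Sy ^ 2 / S ^ 2))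
     + 2 * (M + 1) * y * ((M + / 2) * Sy / S)
     - 16 * (Y - X) * w / S ^ 2 * ((M + / 2) * (M + 3 / 2) / 4)).
  { transitivity ((M + /2) * (M + 3/2) / S ^ 2 * (X * Sx ^ 2) - (M + / 2) * 2 * X / S
      + 2 * (M + 1) * (M + /2) / S * (x * Sx)); [field; lra|].
    rewrite L1', L2'. field. lra. }
  set (u1x := - 8 * x * (Y * w) / S ^ 2 - 8 * X * (Y * w) * Sx / S ^ 3) in *.
  set (u1y := - 8 * y * (X * w) / S ^ 2 - 8 * Y * (X * w) * Sy / S ^ 3) in *.
  set (u2x := - 8 * (Y * w) / S ^ 2 + 32 * x * (Y * w) * Sx / S ^ 3
    - 16 * X * (Y * w) / S ^ 3 + 24 * X * (Y * w) * Sx ^ 2 / S ^ 4) in *.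
  set (u2y := - 8 * (X * w) / S ^ 2 + 32 * y * (X * w) * Sy / S ^ 3
    - 16 * Y * (X * w) / S ^ 3 + 24 * Y * (X * w) * Sy ^ 2 / S ^ 4) in *.
  assert (C1 : X * (2 * (- (M + / 2) * Sx / S) * u1x + u2x) - 2 * (M + 1) * x * u1x
     = Y * (2 * (- (M + / 2) * Sy / S) * u1y + u2y) - 2 * (M + 1) * y * u1y
     + 16 * (Y - X) * w / S ^ 2 * (M + 1 - (M + 2) * (4 * X * Y * w / S ^ 2))).
  { transitivity (X * Y * w * ((32 * M + 56) / S ^ 3 * (x * Sx)
       + (16 * M + 32) / S ^ 4 * (X * Sx ^ 2) - 8 / S ^ 2 - 16 * X / S ^ 3)
       + 16 * (M + 1) * x ^ 2 * Y * w / S ^ 2); [unfold u1x, u2x; field; lra|].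
    transitivity (X * Y * w * ((32 * M + 56) / S ^ 3 * (y * Sy)
       + (16 * M + 32) / S ^ 4 * (Y * Sy ^ 2) - 8 / S ^ 2 - 16 * Y / S ^ 3)
       + 16 * (M + 1) * y ^ 2 * X * w / S ^ 2
       + 16 * (Y - X) * w / S ^ 2 * (M + 1 - (M + 2) * (4 * X * Y * w / S ^ 2)));
       [|unfold u1y, u2y; field; lra].
    rewrite L1', L2', EX, EY. field. lra. }
  assert (C2 : X * u1x ^ 2 = Y * u1y ^ 2 + 16 * (Y - X) * w / S ^ 2 *
     (4 * X * Y * w / S ^ 2 * (1 - 4 * X * Y * w / S ^ 2))).
  { transitivity (64 * X * Y ^ 2 * w ^ 2 / S ^ 6 *
       (x ^ 2 * S ^ 2 + 2 * S * X * (x * Sx) + X * (X * Sx ^ 2))); [unfold u1x; field; lra|].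
    transitivity (64 * Y * X ^ 2 * w ^ 2 / S ^ 6 *
       (y ^ 2 * S ^ 2 + 2 * S * Y * (y * Sy) + Y * (Y * Sy ^ 2))
       + 16 * (Y - X) * w / S ^ 2 *
     (4 * X * Y * w / S ^ 2 * (1 - 4 * X * Y * w / S ^ 2))); [|unfold u1y; field; lra].
    rewrite L1', L2', EX, EY. field. lra. }
  clear L1' L2' EX EY. clearbody u1x u1y u2x u2y.
  set (ka := 16 * (Y - X) * w / S ^ 2) in *. clearbody ka.
  set (v := 4 * X * Y * w / S ^ 2) in *. clearbody v.
  set (A0x := (- (M + / 2) * Sx / S) ^ 2 + - (M + / 2) * (2 / S - Sx ^ 2 / S ^ 2)) in *.
  set (A0y := (- (M + / 2) * Sy / S) ^ 2 + - (M + / 2) * (2 / S - Sy ^ 2 / S ^ 2)) in *.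
  set (A1x := 2 * (- (M + / 2) * Sx / S) * u1x + u2x) in *.
  set (A1y := 2 * (- (M + / 2) * Sy / S) * u1y + u2y) in *.
  set (Bx := (M + / 2) * Sx / S) in *. set (By := (M + / 2) * Sy / S) in *.
  clearbody A0x A0y A1x A1y Bx By.
  transitivity (h * (g0 * (X * A0x + 2 * (M + 1) * x * Bx)
     + g1 * (X * A1x - 2 * (M + 1) * x * u1x) + g2 * (X * u1x ^ 2))); [ring|].
  rewrite C0, C1, C2.
  match type of O with ?o = 0 =>
  transitivity (h * (g0 * (Y * A0y + 2 * (M + 1) * y * By)
     + g1 * (Y * A1y - 2 * (M + 1) * y * u1y) + g2 * (Y * u1y ^ 2)) + h * ka * o) end.
  - field.
  - rewrite O. ring.
Qed.

(** * Joint continuity of the kernel and its derivatives *)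

Section KernelContinuity.
Context {T : UniformSpace} (x y a b : T -> R) (z : T).
Hypotheses (Hx : continuous x z) (Hy : continuous y z) (Ha : continuous a z) (Hb : continuous b z).
Hypothesis Hg : good (x z) (y z) (a z) (b z).

Lemma continuous_Sq : continuous (fun z => Sq (x z) (y z) (a z) (b z)) z.
Proof.
  unfold Sq. repeat cont_step; try eassumption.
Qed.

Lemma continuous_Sq1 : continuous (fun z => Sq1 (x z) (y z) (a z) (b z)) z.
Proof.
  unfold Sq1. repeat cont_step; try eassumption.
Qed.

Lemma continuous_ker_arg : continuous (fun z => ker_arg (x z) (y z) (a z) (b z)) z.
Proof.
  unfold ker_arg, Pi4. destruct Hg.
  repeat cont_step; try assumption; try apply continuous_Sq.
  nra.
Qed.

Lemma continuous_hpow m : continuous (fun z => hpow m (Sq (x z) (y z) (a z) (b z))) z.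
Proof.
  eapply cont_comp; [apply continuous_Sq|]. apply is_derive_hpow. apply Hg.
Qed.

Lemma continuous_ker_arg1 : continuous (fun z => ker_arg1 (x z) (y z) (a z) (b z)) z.
Proof.
  unfold ker_arg1. cbv zeta. destruct Hg as [HS _].
  repeat cont_step; try assumption; try apply continuous_Sq; try apply continuous_Sq1;
    apply pow_nonzero; lra.
Qed.

Lemma continuous_ker_arg2 : continuous (fun z => ker_arg2 (x z) (y z) (a z) (b z)) z.
Proof.
  unfold ker_arg2. cbv zeta. destruct Hg as [HS _].
  repeat cont_step; try assumption; try apply continuous_Sq; try apply continuous_Sq1;
    apply pow_nonzero; lra.
Qed.

Lemma continuous_ker m : continuous (fun z => ker m (x z) (y z) (a z) (b z)) z.
Proof.
  apply cont_mult; [|apply continuous_hpow].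
  eapply cont_comp; [apply continuous_ker_arg|apply is_derive_G0, good_arg, Hg].
Qed.

Lemma continuous_ker1 m : continuous (fun z => ker1 m (x z) (y z) (a z) (b z)) z.
Proof.
  unfold ker1. cbv zeta. destruct Hg as [HS _].
  apply cont_mult; [|apply continuous_hpow].
  apply cont_minus; apply cont_mult.
  - apply continuous_ker_arg1.
  - eapply cont_comp; [apply continuous_ker_arg|apply is_derive_G1, good_arg, Hg].
  - apply cont_div; [apply cont_mult|apply continuous_Sq|lra];
      [apply continuous_const|apply continuous_Sq1].
  - eapply cont_comp; [apply continuous_ker_arg|apply is_derive_G0, good_arg, Hg].
Qed.

Lemma continuous_ker2 m : continuous (fun z => ker2 m (x z) (y z) (a z) (b z)) z.
Proof.
  unfold ker2. cbv zeta. destruct Hg as [HS _].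
  assert (C0 : continuous (fun z => G0 m (ker_arg (x z) (y z) (a z) (b z))) z)
    by (eapply cont_comp; [apply continuous_ker_arg|apply is_derive_G0, good_arg, Hg]).
  assert (C1 : continuous (fun z => G1 m (ker_arg (x z) (y z) (a z) (b z))) z)
    by (eapply cont_comp; [apply continuous_ker_arg|apply is_derive_G1, good_arg, Hg]).
  assert (C2 : continuous (fun z => G2 m (ker_arg (x z) (y z) (a z) (b z))) z).
  { apply (continuous_comp (fun z => ker_arg (x z) (y z) (a z) (b z)) (G2 m));
      [apply continuous_ker_arg|apply continuous_G2, good_arg, Hg]. }
  repeat cont_step; try assumption.
  all: lazymatch goal with
    | |- continuous (fun z => Sq _ _ _ _) _ => apply continuous_Sq
    | |- continuous (fun z => Sq1 _ _ _ _) _ => apply continuous_Sq1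
    | |- continuous (fun z => ker_arg1 _ _ _ _) _ => apply continuous_ker_arg1
    | |- continuous (fun z => ker_arg2 _ _ _ _) _ => apply continuous_ker_arg2
    | |- continuous (fun z => hpow _ _) _ => apply continuous_hpow
    | |- _ ^ _ <> 0 => apply pow_nonzero; lra
    | |- _ => lra end.
Qed.
End KernelContinuity.

(** * Separation of variables *)

Lemma cosh_add s s' : cosh (s + s') = cosh s * cosh s' + sinh s * sinh s'.
Proof. unfold cosh, sinh. rewrite Ropp_plus_distr, !exp_plus. field. Qed.

Lemma cosh_sub s s' : cosh (s - s') = cosh s * cosh s' - sinh s * sinh s'.
Proof.
  unfold cosh, sinh. unfold Rminus. rewrite Ropp_plus_distr, Ropp_involutive, !exp_plus. field.
Qed.

Lemma cosh2_sinh2 s : cosh s ^ 2 = 1 + sinh s ^ 2.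
Proof.
  unfold cosh, sinh.
  assert (E : exp s * exp (- s) = 1) by (rewrite <- exp_plus, Rplus_opp_r; apply exp_0).
  nra.
Qed.

Lemma sin2_cos2' t : sin t ^ 2 = 1 - cos t ^ 2.
Proof. pose proof (sin2_cos2 t). unfold Rsqr in *. lra. Qed.

Lemma cosh_gt_1 s : s <> 0 -> 1 < cosh s.
Proof.
  intros Hs. assert (0 < sinh s ^ 2).
  { rewrite <- Rsqr_pow2. apply Rsqr_pos_lt. intros E. apply Hs.
    destruct (Rtotal_order s 0) as [L|[L|L]]; trivial;
      apply sinh_lt in L; rewrite sinh_0 in L; lra. }
  pose proof (cosh2_sinh2 s). assert (0 < cosh s) by (unfold cosh; pose proof (exp_pos s);
    pose proof (exp_pos (- s)); lra). nra.
Qed.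

Lemma cosh_ge_1 s : 1 <= cosh s.
Proof.
  destruct (Req_dec s 0) as [->|H]; [rewrite cosh_0; lra|]. apply cosh_gt_1 in H; lra.
Qed.

Lemma sinh_pos s : 0 < s -> 0 < sinh s.
Proof. intros H. apply sinh_lt in H. now rewrite sinh_0 in H. Qed.

(** Up to the denominator this is [chi - 1]. For positive radii the first factor on the right is
    positive, so a zero can come only from [cosh (s - s') - cos (t - t')], that is, from the
    singular point. *)
Lemma Sq_factor_minus s s' t t' :
  Sq (cos t) (cos t') (cosh s) (cosh s') - 2 * sinh s * sinh s' * sin t * sin t' =
  (cosh (s + s') - cos (t + t')) * (cosh (s - s') - cos (t - t')).
Proof.
  rewrite cosh_add, cosh_sub, cos_plus, cos_minus.
  transitivity ((cosh s * cosh s' - cos t * cos t') ^ 2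
     - sinh s ^ 2 * sinh s' ^ 2 - sin t ^ 2 * sin t' ^ 2
     - 2 * sinh s * sinh s' * sin t * sin t'); [|ring].
  replace (sinh s ^ 2) with (cosh s ^ 2 - 1) by (rewrite cosh2_sinh2; ring).
  replace (sinh s' ^ 2) with (cosh s' ^ 2 - 1) by (rewrite cosh2_sinh2; ring).
  rewrite !sin2_cos2'. unfold Sq. ring.
Qed.

Lemma Sq_factor_plus s s' t t' :
  Sq (cos t) (cos t') (cosh s) (cosh s') + 2 * sinh s * sinh s' * sin t * sin t' =
  (cosh (s + s') - cos (t - t')) * (cosh (s - s') - cos (t + t')).
Proof.
  pose proof (Sq_factor_minus s s' t (- t')) as H.
  rewrite cos_neg, sin_neg in H. replace (t - - t') with (t + t') in H by ring.
  replace (t + - t') with (t - t') in H by ring. rewrite <- H. ring.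
Qed.

Lemma Pi4_trig s s' t t' : Pi4 (cos t) (cos t') (cosh s) (cosh s') =
  (2 * sinh s * sinh s' * sin t * sin t') ^ 2.
Proof.
  unfold Pi4. rewrite !cosh2_sinh2.
  transitivity (4 * sinh s ^ 2 * sinh s' ^ 2 * sin t ^ 2 * sin t' ^ 2); [|ring].
  rewrite !sin2_cos2'. ring.
Qed.

(** With [D] the denominator of [chi], the four inequalities make [S - D] and [S + D] positive, and
    [D^2] is the quartic product [Pi4]. *)
Lemma good_trig s s' t t' :
  cos (t + t') < cosh (s + s') -> cos (t - t') < cosh (s + s') ->
  cos (t + t') < cosh (s - s') -> cos (t - t') < cosh (s - s') ->
  good (cos t) (cos t') (cosh s) (cosh s').
Proof.
  intros H1 H2 H3 H4.
  pose proof (Sq_factor_minus s s' t t') as A. pose proof (Sq_factor_plus s s' t t') as B.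
  assert (A' : 0 < (cosh (s + s') - cos (t + t')) * (cosh (s - s') - cos (t - t')))
    by (apply Rmult_lt_0_compat; lra).
  assert (B' : 0 < (cosh (s + s') - cos (t - t')) * (cosh (s - s') - cos (t + t')))
    by (apply Rmult_lt_0_compat; lra).
  rewrite <- A in A'. rewrite <- B in B'. split; [lra|].
  rewrite Pi4_trig. rewrite Rabs_pos_eq by apply pow2_ge_0. nra.
Qed.

Lemma good_trig_neq s s' t t' : s + s' <> 0 -> s - s' <> 0 ->
  good (cos t) (cos t') (cosh s) (cosh s').
Proof.
  intros H1 H2. apply cosh_gt_1 in H1. apply cosh_gt_1 in H2.
  pose proof (COS_bound (t + t')). pose proof (COS_bound (t - t')).
  apply good_trig; lra.
Qed.

(** In the variable [x = cos t] this is [(1-x^2)^m P_n^(m)(x) dx]; the operator [A] is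
    [(1-x^2)^(-m) D (1-x^2)^(m+1) D], symmetric for the weight [(1-x^2)^m]. *)
Definition legendre_weight (m n : nat) (t : R) : R :=
  sin t ^ (2 * m + 1) * legendre_deriv n m (cos t).

Definition legendre_eig (m n : nat) : R := INR n * (INR n + 1) - INR m * (INR m + 1).

Lemma continuous_legendre_deriv {T : UniformSpace} n m (f : T -> R) z :
  continuous f z -> continuous (fun z => legendre_deriv n m (f z)) z.
Proof. intros. eapply cont_comp; [easy|apply is_derive_legendre_deriv]. Qed.

Lemma continuous_legendre_weight {T : UniformSpace} m n (f : T -> R) z :
  continuous f z -> continuous (fun z => legendre_weight m n (f z)) z.
Proof.
  intros. apply cont_mult; [now apply cont_pow, cont_sin|].
  now apply continuous_legendre_deriv, cont_cos.
Qed.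

(* Green's identity for the Gegenbauer operator
   [(1-x^2) D^2 - 2 (m+1) x D]; the boundary terms carry a power of [sin t]. *)
Lemma legendre_green m n (phi phi1 phi2 : R -> R) :
  (forall t, 0 <= t <= PI -> is_derive phi (cos t) (phi1 (cos t))) ->
  (forall t, 0 <= t <= PI -> is_derive phi1 (cos t) (phi2 (cos t))) ->
  (forall t, 0 <= t <= PI -> continuous (fun t => phi2 (cos t)) t) ->
  is_RInt (fun t => legendre_weight m n t *
    ((1 - cos t ^ 2) * phi2 (cos t) - 2 * (INR m + 1) * cos t * phi1 (cos t)
     + legendre_eig m n * phi (cos t))) 0 PI 0.
Proof.
  intros D0 D1 C2.
  (* An explicit primitive: [(1-x^2)^(m+1)] times the Wronskian of [P_n^(m)] and [phi], with the
     sign that comes from [dx = - sin t dt]. *)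
  pose (Z := fun t => - sin t ^ (2 * m + 2) *
    (legendre_deriv n m (cos t) * phi1 (cos t) - legendre_deriv n (S m) (cos t) * phi (cos t))).
  assert (HZ : forall t, 0 <= t <= PI -> is_derive Z t (legendre_weight m n t *
    ((1 - cos t ^ 2) * phi2 (cos t) - 2 * (INR m + 1) * cos t * phi1 (cos t)
     + legendre_eig m n * phi (cos t)))).
  { intros t Ht.
    assert (Dc : is_derive cos t (- sin t)) by (auto_derive; trivial; ring).
    pose proof (is_derive_comp_R phi cos t _ _ (D0 t Ht) Dc) as E0.
    pose proof (is_derive_comp_R phi1 cos t _ _ (D1 t Ht) Dc) as E1.
    pose proof (is_derive_comp_R _ cos t _ _ (is_derive_legendre_deriv n m (cos t)) Dc) as P0.
    pose proof (is_derive_comp_R _ cos t _ _ (is_derive_legendre_deriv n (S m) (cos t)) Dc) as P1.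
    pose proof (is_derive_mult_R _ _ _ _ _ P0 E1) as A.
    pose proof (is_derive_mult_R _ _ _ _ _ P1 E0) as B.
    pose proof (is_derive_minus _ _ _ _ _ A B) as AB.
    assert (Ds : is_derive (fun t => - sin t ^ (2 * m + 2)) t
      (- (2 * INR m + 2) * cos t * sin t ^ (2 * m + 1))).
    { assert (Dsin : is_derive sin t (cos t)) by (auto_derive; trivial; ring).
      pose proof (is_derive_opp _ _ _ (is_derive_pow sin (2 * m + 2) t _ Dsin)) as D.
      eapply is_derive_eq; [exact D|].
      replace (pred (2 * m + 2)) with (2 * m + 1)%nat by lia.
      rewrite plus_INR, mult_INR. unfold opp; simpl. ring. }
    eapply is_derive_eq; [exact (is_derive_mult_R _ _ _ _ _ Ds AB)|].
    pose proof (legendre_deriv_ode n m (cos t)) as O.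
    unfold legendre_weight, legendre_eig.
    replace (2 * m + 2)%nat with (S (2 * m + 1)) by lia.
    change (sin t ^ S (2 * m + 1)) with (sin t * sin t ^ (2 * m + 1)).
    set (w := sin t ^ (2 * m + 1)). clearbody w.
    pose proof (sin2_cos2' t) as SC.
    set (c := cos t) in *. set (s := sin t) in *.
    set (p0 := legendre_deriv n m c) in *. set (p1 := legendre_deriv n (S m) c) in *.
    set (p2 := legendre_deriv n (S (S m)) c) in *.
    unfold minus, plus, opp; simpl.
    rewrite <- SC in *.
    transitivity (w * (s ^ 2 * (p0 * phi2 c - p2 * phi c)
      - 2 * (INR m + 1) * c * (p0 * phi1 c - p1 * phi c))); [ring|].
    replace (s ^ 2 * (p0 * phi2 c - p2 * phi c)) with
      (s ^ 2 * p0 * phi2 c - (s ^ 2 * p2) * phi c) by ring.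
    replace (s ^ 2 * p2) with (2 * (INR m + 1) * c * p1
      - (INR n * (INR n + 1) - INR m * (INR m + 1)) * p0) by lra.
    rewrite SC. ring. }
  pose proof PI_RGT_0.
  replace 0 with (minus (Z PI) (Z 0)) at 2.
  - apply (is_RInt_derive Z); rewrite Rmin_left, Rmax_right by lra; [exact HZ|].
    intros t Ht.
    apply cont_mult; [apply continuous_legendre_weight, continuous_id|].
    assert (Cc : continuous cos t) by apply continuous_cos.
    pose proof (cont_comp phi1 cos t _ Cc (D1 t Ht)).
    pose proof (cont_comp phi cos t _ Cc (D0 t Ht)).
    specialize (C2 t Ht).
    repeat cont_step; try assumption; apply continuous_id.
  - unfold Z. rewrite sin_PI, sin_0, pow_i by lia. unfold minus, plus, opp; simpl. ring.
Qed.

(** In the applications [q] grows like [1 / tau] at 0. A lower bound on [q] is enough, because a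
    large positive [q] only damps the energy. *)
Lemma linear_ode_unique (v v1 q : R -> R) (L M la : R) :
  (forall tau, 0 <= tau < L -> is_derive v tau (v1 tau)) ->
  (forall tau, 0 < tau < L -> is_derive v1 tau (- q tau * v1 tau + la * v tau)) ->
  continuous v1 0 -> v 0 = 0 -> v1 0 = 0 ->
  (forall tau, 0 < tau < L -> - M <= q tau) ->
  forall tau, 0 <= tau < L -> v tau = 0.
Proof.
  intros Dv Dv1 C1 V0 V10 HM tau Ht.
  (* The cross terms [2 (1 + la) v v1] cost at most [Rabs (1 + la)] times the energy, and the
     friction [-2 q v1^2] at most [2 Rabs M] times it. *)
  set (C := Rabs (1 + la) + 2 * Rabs M).
  (* The energy [v^2 + v1^2], damped by [exp (- C t)], is nonincreasing and starts at 0. *)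
  pose (F := fun t => (v t ^ 2 + v1 t ^ 2) * exp (- C * t)).
  pose (dF := fun t => (2 * v t * v1 t + 2 * v1 t * (- q t * v1 t + la * v t)
     - C * (v t ^ 2 + v1 t ^ 2)) * exp (- C * t)).
  destruct (Req_dec tau 0) as [->|Hne]; [easy|].
  destruct (MVT_gen F 0 tau dF) as [c [Hc E]].
  - rewrite Rmin_left, Rmax_right by lra. intros t Htt.
    pose proof (Dv t ltac:(lra)) as A. pose proof (Dv1 t ltac:(lra)) as B.
    unfold F, dF. auto_derive.
    + repeat split; eexists; eassumption.
    + replace (Derive (fun x => v x) t) with (v1 t) by (symmetry; now apply is_derive_unique).
      replace (Derive (fun x => v1 x) t) with (- q t * v1 t + la * v t)
        by (symmetry; now apply is_derive_unique). ring.
  - rewrite Rmin_left, Rmax_right by lra. intros t Htt.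
    apply continuity_pt_filterlim.
    assert (Cv : continuous v t).
    { apply @ex_derive_continuous. eexists. apply Dv; lra. }
    assert (Cv1 : continuous v1 t).
    { destruct (Req_dec t 0) as [->|]; [easy|].
      apply @ex_derive_continuous. eexists. apply Dv1; lra. }
    apply (cont_mult (fun t => v t ^ 2 + v1 t ^ 2) (fun t => exp (- C * t))).
    + now apply cont_plus; apply cont_pow.
    + apply @ex_derive_continuous. auto_derive; trivial.
  - rewrite Rmin_left, Rmax_right in Hc by lra.
    assert (Hd : dF c <= 0).
    { unfold dF. pose proof (exp_pos (- C * c)).
      enough (2 * v c * v1 c + 2 * v1 c * (- q c * v1 c + la * v c)
         - C * (v c ^ 2 + v1 c ^ 2) <= 0) by nra.
      destruct (Req_dec c 0) as [->|]; [rewrite V0, V10; lra|].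
      specialize (HM c ltac:(lra)). pose proof (Rle_abs M). pose proof (Rabs_pos M).
      pose proof (Rle_abs (1 + la)). pose proof (Rle_abs (- (1 + la))) as N.
      rewrite Rabs_Ropp in N. unfold C.
      set (x := v c). set (y := v1 c). set (k := Rabs (1 + la)) in *. set (j := Rabs M) in *.
      assert (- 2 * q c * y ^ 2 <= 2 * j * y ^ 2) by (pose proof (pow2_ge_0 y); nra).
      assert (2 * (1 + la) * (x * y) <= k * (x ^ 2 + y ^ 2)).
      { assert (0 <= (k - (1 + la)) * (x + y) ^ 2)
          by (apply Rmult_le_pos; [lra|apply pow2_ge_0]).
        assert (0 <= (k + (1 + la)) * (x - y) ^ 2)
          by (apply Rmult_le_pos; [lra|apply pow2_ge_0]). nra. }
      assert (0 <= 2 * j * x ^ 2) by (pose proof (pow2_ge_0 x); nra). nra. }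
    assert (F0 : F 0 = 0) by (unfold F; rewrite V0, V10; ring).
    assert (F tau <= 0) by (rewrite F0 in E; nra).
    unfold F in H. pose proof (exp_pos (- C * tau)).
    assert (v tau ^ 2 + v1 tau ^ 2 <= 0) by nra.
    pose proof (pow2_ge_0 (v tau)). pose proof (pow2_ge_0 (v1 tau)). nra.
Qed.

Lemma is_derive_RInt_param_strip (f f1 : R -> R -> R) (L tau : R) :
  (forall z, Rabs z < L -> forall t, is_derive (fun z => f z t) z (f1 z t)) ->
  (forall z, Rabs z < L -> forall t, continuous (fun p : R * R => f1 (fst p) (snd p)) (z, t)) ->
  (forall z, Rabs z < L -> forall t, continuous (f z) t) ->
  Rabs tau < L ->
  is_derive (fun z => RInt (f z) 0 PI) tau (RInt (f1 tau) 0 PI).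
Proof.
  intros Df C1 C0 Ht.
  assert (Loc : locally tau (fun z => Rabs z < L)).
  { assert (Hp : 0 < L - Rabs tau) by lra. exists (mkposreal _ Hp). intros z Hz.
    change (Rabs (z - tau) < L - Rabs tau) in Hz.
    pose proof (Rabs_triang_inv z tau). lra. }
  eapply is_derive_eq.
  - apply (is_derive_RInt_param f 0 PI tau).
    + apply (filter_imp (fun z => Rabs z < L)); [|exact Loc].
      intros z Hz t _. eexists. now apply Df.
    + intros t _. apply (continuity_2d_pt_ext_loc f1).
      * destruct Loc as [d Hd]. exists d. intros u w Hu _. symmetry.
        apply is_derive_unique, Df, Hd. exact Hu.
      * apply continuity_2d_pt_filterlim, C1, Ht.
    + apply (filter_imp (fun z => Rabs z < L)); [|exact Loc].
      intros z Hz. apply @ex_RInt_continuous. intros; now apply C0.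
  - apply RInt_ext. intros t _. now apply is_derive_unique, Df.
Qed.

(** Both separations at once: [c = cosh] with [eps = -1] for the radius, [c = cos] with [eps = 1]
    for the angle. At [tau = 0] the curve starts at 1 with zero velocity, which is how regularity at
    the singular point enters. *)
Section Separation.
Variables (m n : nat) (a b L M eps : R) (c c1 : R -> R).
Hypotheses (Hc : forall tau, is_derive c tau (c1 tau))
  (Hc1 : forall tau, is_derive c1 tau (- eps * c tau))
  (Hsq : forall tau, c1 tau ^ 2 = eps * (1 - c tau ^ 2))
  (c_0 : c 0 = 1) (c1_0 : c1 0 = 0)
  (Hgood : forall tau, Rabs tau < L -> forall t, good (c tau) (cos t) a b)
  (Hne : forall tau, 0 < tau < L -> c1 tau <> 0)
  (HM : forall tau, 0 < tau < L -> - M <= (2 * INR m + 1) * (- eps * c tau / c1 tau)).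

Let J (tau : R) : R := RInt (fun t => legendre_weight m n t * ker m (c tau) (cos t) a b) 0 PI.
Let J1 (tau : R) : R :=
  RInt (fun t => legendre_weight m n t * (ker1 m (c tau) (cos t) a b * c1 tau)) 0 PI.
Let J2 (tau : R) : R :=
  RInt (fun t => legendre_weight m n t *
    (ker2 m (c tau) (cos t) a b * c1 tau ^ 2 + ker1 m (c tau) (cos t) a b * (- eps * c tau))) 0 PI.

Let cont_c {T : UniformSpace} (f : T -> R) z : continuous f z -> continuous (fun z => c (f z)) z.
Proof. intros. eapply cont_comp; [easy|apply Hc]. Qed.
Let cont_c1 {T : UniformSpace} (f : T -> R) z : continuous f z -> continuous (fun z => c1 (f z)) z.
Proof. intros. eapply cont_comp; [easy|apply Hc1]. Qed.

Let is_derive_J tau : Rabs tau < L -> is_derive J tau (J1 tau).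
Proof.
  apply (is_derive_RInt_param_strip
    (fun tau t => legendre_weight m n t * ker m (c tau) (cos t) a b)
    (fun tau t => legendre_weight m n t * (ker1 m (c tau) (cos t) a b * c1 tau))).
  - intros z Hz t.
    pose proof (is_derive_comp_R (fun x => ker m x (cos t) a b) c z _ _
      (is_derive_ker m _ _ _ _ (Hgood z Hz t)) (Hc z)) as A.
    now apply (is_derive_scal (fun z => ker m (c z) (cos t) a b)).
  - intros z Hz t.
    apply cont_mult; [apply continuous_legendre_weight, continuous_snd|].
    apply cont_mult; [|apply cont_c1, continuous_fst].
    apply continuous_ker1; [apply cont_c, continuous_fst|apply cont_cos, continuous_snd
      |apply continuous_const ..|now apply Hgood].
  - intros z Hz t.
    apply cont_mult; [apply continuous_legendre_weight, continuous_id|].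
    apply continuous_ker; [apply continuous_const|apply continuous_cos
      |apply continuous_const ..|now apply Hgood].
Qed.

Let is_derive_J1 tau : Rabs tau < L -> is_derive J1 tau (J2 tau).
Proof.
  apply (is_derive_RInt_param_strip
    (fun tau t => legendre_weight m n t * (ker1 m (c tau) (cos t) a b * c1 tau))
    (fun tau t => legendre_weight m n t *
    (ker2 m (c tau) (cos t) a b * c1 tau ^ 2 + ker1 m (c tau) (cos t) a b * (- eps * c tau)))).
  - intros z Hz t.
    pose proof (is_derive_comp_R (fun x => ker1 m x (cos t) a b) c z _ _
      (is_derive_ker1 m _ _ _ _ (Hgood z Hz t)) (Hc z)) as A.
    pose proof (is_derive_mult_R _ _ _ _ _ A (Hc1 z)) as B.
    eapply is_derive_eq; [exact (is_derive_scal _ _ (legendre_weight m n t) _ B)|].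
    unfold scal; simpl; unfold mult; simpl. ring.
  - intros z Hz t.
    apply cont_mult; [apply continuous_legendre_weight, continuous_snd|].
    apply cont_plus; apply cont_mult.
    + apply continuous_ker2; [apply cont_c, continuous_fst|apply cont_cos, continuous_snd
      |apply continuous_const ..|now apply Hgood].
    + apply cont_pow, cont_c1, continuous_fst.
    + apply continuous_ker1; [apply cont_c, continuous_fst|apply cont_cos, continuous_snd
      |apply continuous_const ..|now apply Hgood].
    + apply cont_mult; [apply continuous_const|apply cont_c, continuous_fst].
  - intros z Hz t.
    apply cont_mult; [apply continuous_legendre_weight, continuous_id|].
    apply cont_mult; [|apply continuous_const].
    apply continuous_ker1; [apply continuous_const|apply continuous_cos
      |apply continuous_const ..|now apply Hgood].
Qed.

(** Along [c] the second [tau]-derivative is [eps A] plus the first-order term with [2m+1]. Under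
    the integral [ker_pde] moves [A] from [c tau] to [cos t], where Green's identity turns it into
    multiplication by [- legendre_eig m n]. *)
Let J_ode tau : 0 < tau < L ->
  J2 tau = - ((2 * INR m + 1) * (- eps * c tau / c1 tau)) * J1 tau
    + - eps * legendre_eig m n * J tau.
Proof.
  intros Ht. assert (Ha : Rabs tau < L) by (rewrite Rabs_pos_eq; lra).
  set (w := legendre_weight m n).
  assert (I0 : is_RInt (fun t => w t * ker m (c tau) (cos t) a b) 0 PI (J tau)).
  { apply (@RInt_correct R_CompleteNormedModule), @ex_RInt_continuous. intros t _.
    apply cont_mult; [apply continuous_legendre_weight, continuous_id|].
    apply continuous_ker; [apply continuous_const|apply continuous_cos
      |apply continuous_const ..|now apply Hgood]. }
  assert (E1 : ex_RInt (fun t => w t * ker1 m (c tau) (cos t) a b) 0 PI).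
  { apply @ex_RInt_continuous. intros t _.
    apply cont_mult; [apply continuous_legendre_weight, continuous_id|].
    apply continuous_ker1; [apply continuous_const|apply continuous_cos
      |apply continuous_const ..|now apply Hgood]. }
  assert (E2 : ex_RInt (fun t => w t * ker2 m (c tau) (cos t) a b) 0 PI).
  { apply @ex_RInt_continuous. intros t _.
    apply cont_mult; [apply continuous_legendre_weight, continuous_id|].
    apply continuous_ker2; [apply continuous_const|apply continuous_cos
      |apply continuous_const ..|now apply Hgood]. }
  destruct E1 as [R1 I1]. destruct E2 as [R2 I2].
  assert (HJ1 : J1 tau = c1 tau * R1).
  { apply is_RInt_unique.
    apply (is_RInt_ext (fun t => scal (c1 tau) (w t * ker1 m (c tau) (cos t) a b))).
    - intros t _. unfold w, scal; simpl; unfold mult; simpl. ring.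
    - now apply @is_RInt_scal. }
  assert (HJ2 : J2 tau = c1 tau ^ 2 * R2 + - eps * c tau * R1).
  { apply is_RInt_unique.
    apply (is_RInt_ext (fun t => plus (scal (c1 tau ^ 2) (w t * ker2 m (c tau) (cos t) a b))
       (scal (- eps * c tau) (w t * ker1 m (c tau) (cos t) a b)))).
    - intros t _. unfold w, plus, scal; simpl; unfold mult; simpl. ring.
    - apply @is_RInt_plus; now apply @is_RInt_scal. }
  assert (HG : (1 - c tau ^ 2) * R2 + (- (2 * (INR m + 1) * c tau)) * R1
     + legendre_eig m n * J tau = 0).
  { assert (G : is_RInt (fun t => w t * ((1 - cos t ^ 2) * ker2 m (cos t) (c tau) a b
       - 2 * (INR m + 1) * cos t * ker1 m (cos t) (c tau) a b
       + legendre_eig m n * ker m (cos t) (c tau) a b)) 0 PI 0).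
    { apply (legendre_green m n (fun x => ker m x (c tau) a b)
        (fun x => ker1 m x (c tau) a b) (fun x => ker2 m x (c tau) a b)).
      - intros t _. now apply is_derive_ker, good_swap, Hgood.
      - intros t _. now apply is_derive_ker1, good_swap, Hgood.
      - intros t _. apply continuous_ker2; [apply continuous_cos|apply continuous_const ..
          |now apply good_swap, Hgood]. }
    apply (@is_RInt_unique R_CompleteNormedModule) in G. etransitivity; [|exact G].
    symmetry. apply (@is_RInt_unique R_CompleteNormedModule).
    apply (is_RInt_ext (fun t => plus (plus
       (scal (1 - c tau ^ 2) (w t * ker2 m (c tau) (cos t) a b))
       (scal (- (2 * (INR m + 1) * c tau)) (w t * ker1 m (c tau) (cos t) a b)))
       (scal (legendre_eig m n) (w t * ker m (c tau) (cos t) a b)))).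
    - intros t _. unfold plus, scal; simpl; unfold mult; simpl. fold w.
      pose proof (ker_pde m _ _ _ _ (Hgood tau Ha t)) as P.
      rewrite (ker_swap m (cos t)).
      transitivity (w t * ((1 - c tau ^ 2) * ker2 m (c tau) (cos t) a b
        - 2 * (INR m + 1) * c tau * ker1 m (c tau) (cos t) a b
        + legendre_eig m n * ker m (c tau) (cos t) a b)); [ring|].
      simpl pow in P |- *. rewrite P. ring.
    - apply @is_RInt_plus; [apply @is_RInt_plus|]; now apply @is_RInt_scal. }
  rewrite HJ1, HJ2, Hsq. specialize (Hne tau Ht).
  transitivity (eps * ((1 - c tau ^ 2) * R2 + - (2 * (INR m + 1) * c tau) * R1
     + legendre_eig m n * J tau) + eps * (2 * INR m + 1) * c tau * R1
     - eps * legendre_eig m n * J tau); [ring|].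
  rewrite HG. field. easy.
Qed.

(** The difference of the two sides solves the linear equation shared by [J] and [P_n^(m)(c tau)],
    and it vanishes at 0 with its derivative, since [c1 0 = 0]. The cross-multiplied form requires
    no division by [P_n^(m)(1)]. *)
Lemma ker_integral_separate tau : 0 <= tau < L ->
  RInt (fun t => legendre_weight m n t * ker m (c tau) (cos t) a b) 0 PI * legendre_deriv n m 1 =
  legendre_deriv n m (c tau) * RInt (fun t => legendre_weight m n t * ker m 1 (cos t) a b) 0 PI.
Proof.
  intros Ht.
  assert (EJ0 : RInt (fun t => legendre_weight m n t * ker m 1 (cos t) a b) 0 PI = J 0)
    by (unfold J; now rewrite c_0).
  rewrite EJ0. clear EJ0. fold (J tau).
  set (p := legendre_deriv n m). set (p1 := legendre_deriv n (S m)).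
  set (p2 := legendre_deriv n (S (S m))).
  apply Rminus_diag_uniq.
  assert (DP : forall z, is_derive (fun z => p (c z)) z (p1 (c z) * c1 z)).
  { intros z. apply (is_derive_comp_R p c); [apply is_derive_legendre_deriv|apply Hc]. }
  assert (DP1 : forall z, is_derive (fun z => p1 (c z) * c1 z) z
     (p2 (c z) * c1 z * c1 z + p1 (c z) * (- eps * c z))).
  { intros z. apply (is_derive_mult_R (fun z => p1 (c z)) c1); [|apply Hc1].
    apply (is_derive_comp_R p1 c); [apply is_derive_legendre_deriv|apply Hc]. }
  assert (Dv : forall z, Rabs z < L ->
     is_derive (fun z => J z * p 1 - p (c z) * J 0) z (J1 z * p 1 - p1 (c z) * c1 z * J 0)).
  { intros z Hz. pose proof (is_derive_J z Hz) as A. specialize (DP z).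
    eapply is_derive_eq.
    - apply (is_derive_minus (fun z => J z * p 1) (fun z => p (c z) * J 0)).
      + apply (is_derive_mult_R J (fun _ => p 1)); [exact A|apply @is_derive_const].
      + apply (is_derive_mult_R (fun z => p (c z)) (fun _ => J 0));
          [exact DP|apply @is_derive_const].
    - unfold minus, plus, opp, zero; simpl. ring. }
  assert (Dv1 : forall z, Rabs z < L ->
     is_derive (fun z => J1 z * p 1 - p1 (c z) * c1 z * J 0) z
       (J2 z * p 1 - (p2 (c z) * c1 z * c1 z + p1 (c z) * (- eps * c z)) * J 0)).
  { intros z Hz. pose proof (is_derive_J1 z Hz) as A. specialize (DP1 z).
    eapply is_derive_eq.
    - apply (is_derive_minus (fun z => J1 z * p 1) (fun z => p1 (c z) * c1 z * J 0)).
      + apply (is_derive_mult_R J1 (fun _ => p 1)); [exact A|apply @is_derive_const].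
      + apply (is_derive_mult_R (fun z => p1 (c z) * c1 z) (fun _ => J 0));
          [exact DP1|apply @is_derive_const].
    - unfold minus, plus, opp, zero; simpl. ring. }
  apply (linear_ode_unique (fun z => J z * p 1 - p (c z) * J 0)
    (fun z => J1 z * p 1 - p1 (c z) * c1 z * J 0)
    (fun z => (2 * INR m + 1) * (- eps * c z / c1 z)) L M (- eps * legendre_eig m n)); trivial.
  - intros z Hz. apply Dv. rewrite Rabs_pos_eq; lra.
  - intros z Hz. eapply is_derive_eq; [apply Dv1; rewrite Rabs_pos_eq; lra|].
    rewrite (J_ode z Hz).
    pose proof (legendre_deriv_ode n m (c z)) as O. fold p p1 p2 in O.
    specialize (Hne z Hz). specialize (Hsq z).
    replace (p2 (c z) * c1 z * c1 z) with (eps * ((1 - c z ^ 2) * p2 (c z)))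
      by (rewrite <- Rmult_assoc, <- Hsq; ring).
    replace ((1 - c z ^ 2) * p2 (c z)) with (2 * (INR m + 1) * c z * p1 (c z)
      - legendre_eig m n * p (c z)) by (unfold legendre_eig; lra).
    field. easy.
  - apply @ex_derive_continuous. eexists. apply Dv1. rewrite Rabs_R0. lra.
  - rewrite c_0. ring.
  - assert (J1 0 = 0) as ->.
    { unfold J1. rewrite c1_0. transitivity (RInt (fun _ => 0) 0 PI).
      { apply RInt_ext. intros t _.
        change (legendre_weight m n t * (ker1 m (c 0) (cos t) a b * 0) = 0). ring. }
      rewrite RInt_const. unfold scal; simpl; unfold mult; simpl. ring. }
    rewrite c1_0. ring.
Qed.
End Separation.

(** * Moments and the Neumann-type integral *)

Definition legendre_moment (m n j : nat) : R :=
  RInt (fun t => legendre_weight m n t * cos t ^ j) 0 PI.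

Lemma is_RInt_legendre_moment m n j :
  is_RInt (fun t => legendre_weight m n t * cos t ^ j) 0 PI (legendre_moment m n j).
Proof.
  apply (@RInt_correct R_CompleteNormedModule), @ex_RInt_continuous. intros t _.
  apply cont_mult; [apply continuous_legendre_weight, continuous_id|].
  apply cont_pow, continuous_cos.
Qed.

Lemma is_RInt_uniq (f : R -> R) (a b l l' : R) : is_RInt f a b l -> is_RInt f a b l' -> l = l'.
Proof.
  intros H H'. apply (@is_RInt_unique R_CompleteNormedModule) in H, H'. congruence.
Qed.

Lemma is_RInt_lin2 (f g : R -> R) (a b u v lf lg : R) : is_RInt f a b lf -> is_RInt g a b lg ->
  is_RInt (fun t => u * f t + v * g t) a b (u * lf + v * lg).
Proof. intros. apply @is_RInt_plus; now apply @is_RInt_scal. Qed.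

Lemma is_derive_pow_S k (x : R) : is_derive (fun x => x ^ S k) x ((INR k + 1) * x ^ k).
Proof.
  eapply is_derive_eq; [apply (is_derive_pow (fun x => x) (S k) x 1), @is_derive_id|].
  rewrite S_INR. simpl pred. ring.
Qed.

(** Green's identity with [phi = x^(j+2)]: the operator maps this power to a combination of [x^j]
    and itself. *)
Lemma legendre_moment_SS m n j :
  ((INR j + 2) * (INR j + 1)) * legendre_moment m n j
  + (legendre_eig m n - (INR j + 2) * (INR j + 2 * INR m + 3)) * legendre_moment m n (S (S j)) = 0.
Proof.
  eapply is_RInt_uniq.
  - apply is_RInt_lin2; apply is_RInt_legendre_moment.
  - eapply is_RInt_ext; [|apply (legendre_green m n (fun x => x ^ S (S j))
      (fun x => (INR j + 2) * x ^ S j) (fun x => (INR j + 2) * ((INR j + 1) * x ^ j)))].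
    + intros t _. unfold legendre_weight. simpl. ring.
    + intros t _. eapply is_derive_eq; [apply is_derive_pow_S|]. rewrite S_INR. ring.
    + intros t _. apply (is_derive_scal (fun x => x ^ S j)), is_derive_pow_S.
    + intros t _. repeat cont_step. apply continuous_id.
Qed.

Lemma legendre_moment_0 m n : legendre_eig m n * legendre_moment m n 0 = 0.
Proof.
  eapply is_RInt_uniq.
  - apply (is_RInt_scal (fun t => legendre_weight m n t * cos t ^ 0)).
    apply is_RInt_legendre_moment.
  - eapply is_RInt_ext; [|apply (legendre_green m n (fun x => 1) (fun x => 0) (fun x => 0))].
    + intros t _. unfold scal; simpl; unfold mult; simpl. ring.
    + intros t _. auto_derive; trivial.
    + intros t _. auto_derive; trivial.
    + intros t _. apply continuous_const.
Qed.

Lemma legendre_moment_1 m n :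
  (legendre_eig m n - 2 * (INR m + 1)) * legendre_moment m n 1 = 0.
Proof.
  eapply is_RInt_uniq.
  - apply (is_RInt_scal (fun t => legendre_weight m n t * cos t ^ 1)).
    apply is_RInt_legendre_moment.
  - eapply is_RInt_ext; [|apply (legendre_green m n (fun x => x) (fun x => 1) (fun x => 0))].
    + intros t _. unfold scal; simpl; unfold mult; simpl. ring.
    + intros t _. auto_derive; trivial.
    + intros t _. auto_derive; trivial.
    + intros t _. apply continuous_const.
Qed.

Lemma legendre_eig_factor m d : legendre_eig m (m + d) = INR d * (INR d + 2 * INR m + 1).
Proof. unfold legendre_eig. rewrite plus_INR. ring. Qed.

(** Orthogonality to low powers and parity at once. Going up by two from 0 or 1, the new moment has
    coefficient [(d - j - 2) (d + 2m + j + 3)], which is zero only when [j + 2] reaches [d]. *)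
Lemma legendre_moment_vanish m d j : (forall k, j <> d + 2 * k)%nat ->
  legendre_moment m (m + d) j = 0.
Proof.
  pose proof (pos_INR m) as Pm. pose proof (pos_INR d) as Pd.
  induction j as [| |j IH _] using nat_ind2; intros Hj.
  - pose proof (legendre_moment_0 m (m + d)) as H. rewrite legendre_eig_factor in H.
    apply Rmult_integral in H as [H|H]; trivial.
    assert (INR d <> 0) by (apply not_0_INR; specialize (Hj 0%nat); lia).
    apply Rmult_integral in H as [H|H]; lra.
  - pose proof (legendre_moment_1 m (m + d)) as H. rewrite legendre_eig_factor in H.
    apply Rmult_integral in H as [H|H]; trivial.
    assert (INR d <> 1) by (apply not_1_INR; specialize (Hj 0%nat); lia).
    replace (INR d * (INR d + 2 * INR m + 1) - 2 * (INR m + 1))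
      with ((INR d - 1) * (INR d + 2 * INR m + 2)) in H by ring.
    apply Rmult_integral in H as [H|H]; lra.
  - pose proof (legendre_moment_SS m (m + d) j) as H.
    rewrite IH, legendre_eig_factor in H by (intros k; specialize (Hj (S k)); lia).
    rewrite Rmult_0_r, Rplus_0_l in H.
    apply Rmult_integral in H as [H|H]; trivial.
    pose proof (pos_INR j).
    assert (INR d <> INR j + 2).
    { intros E. replace (INR j + 2) with (INR (S (S j))) in E by (rewrite !S_INR; ring).
      apply INR_eq in E. specialize (Hj 0%nat). lia. }
    replace (INR d * (INR d + 2 * INR m + 1) - (INR j + 2) * (INR j + 2 * INR m + 3))
      with ((INR d - (INR j + 2)) * (INR d + 2 * INR m + 1 + INR j + 2)) in H by ring.
    apply Rmult_integral in H as [H|H]; lra.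
Qed.

Lemma legendre_moment_ratio m d k :
  2 * (INR k + 1) * (2 * INR (m + d) + 2 * INR k + 3) * legendre_moment m (m + d) (d + 2 * S k) =
  (INR d + 2 * INR k + 2) * (INR d + 2 * INR k + 1) * legendre_moment m (m + d) (d + 2 * k).
Proof.
  pose proof (legendre_moment_SS m (m + d) (d + 2 * k)) as H.
  rewrite legendre_eig_factor in H.
  replace (S (S (d + 2 * k))) with (d + 2 * S k)%nat in H by lia.
  rewrite plus_INR, mult_INR in H. rewrite (plus_INR m d). simpl (INR 2) in H. lra.
Qed.

(** Integration by parts: [(1-x^2)^(m+1) P_n^(m+1)] has derivative
    [- (n-m) (n+m+1) (1-x^2)^m P_n^(m)], and the factor [n - m] cancels against the exponent of
    [x^(n-m)]. This reduces the lowest moment to [m = 0]. *)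
Lemma legendre_moment_step m n : (m < n)%nat ->
  legendre_moment (S m) n (n - S m) = (INR n + INR m + 1) * legendre_moment m n (n - m).
Proof.
  intros Hmn. set (e := (n - S m)%nat). replace (n - m)%nat with (S e) by (unfold e; lia).
  assert (He : INR n = INR m + INR e + 1)
    by (replace n with (m + S e)%nat by (unfold e; lia); rewrite plus_INR, S_INR; ring).
  pose proof (pos_INR e).
  apply (Rmult_eq_reg_l (INR e + 1)); [|lra].
  apply Rminus_diag_uniq.
  replace ((INR e + 1) * legendre_moment (S m) n e
      - (INR e + 1) * ((INR n + INR m + 1) * legendre_moment m n (S e)))
    with ((INR e + 1) * legendre_moment (S m) n e
      + - legendre_eig m n * legendre_moment m n (S e))
    by (unfold legendre_eig; rewrite He; ring).
  eapply is_RInt_uniq; [apply is_RInt_lin2; apply is_RInt_legendre_moment|].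
  pose (Z := fun t => - sin t ^ (2 * m + 2) * (legendre_deriv n (S m) (cos t) * cos t ^ S e)).
  pose proof PI_RGT_0.
  replace 0 with (minus (Z PI) (Z 0)) at 2.
  - apply (is_RInt_derive Z); rewrite Rmin_left, Rmax_right by lra; intros t Ht.
    + assert (Dc : is_derive cos t (- sin t)) by (auto_derive; trivial; ring).
      assert (Dsin : is_derive sin t (cos t)) by (auto_derive; trivial; ring).
      pose proof (is_derive_opp _ _ _ (is_derive_pow sin (2 * m + 2) t _ Dsin)) as Ds.
      pose proof (is_derive_comp_R _ cos t _ _ (is_derive_legendre_deriv n (S m) (cos t)) Dc) as P1.
      pose proof (is_derive_pow cos (S e) t _ Dc) as Pw.
      eapply is_derive_eq;
        [exact (is_derive_mult_R _ _ _ _ _ Ds (is_derive_mult_R _ _ _ _ _ P1 Pw))|].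
      pose proof (legendre_deriv_ode n m (cos t)) as O.
      unfold legendre_weight, legendre_eig.
      replace (pred (2 * m + 2)) with (2 * m + 1)%nat by lia.
      replace (2 * S m + 1)%nat with (S (S (2 * m + 1))) by lia.
      replace (2 * m + 2)%nat with (S (2 * m + 1)) by lia.
      replace (INR (S (2 * m + 1))) with (2 * INR m + 2)
        by (rewrite S_INR, plus_INR, mult_INR; simpl; ring).
      rewrite (S_INR e). unfold opp. simpl pred.
      change (sin t ^ S (S (2 * m + 1))) with (sin t * (sin t * sin t ^ (2 * m + 1))).
      change (sin t ^ S (2 * m + 1)) with (sin t * sin t ^ (2 * m + 1)).
      change (cos t ^ S e) with (cos t * cos t ^ e).
      set (w := sin t ^ (2 * m + 1)). set (ce := cos t ^ e). clearbody w ce.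
      pose proof (sin2_cos2' t) as SC.
      set (c := cos t) in *. set (s := sin t) in *.
      set (p0 := legendre_deriv n m c) in *. set (p1 := legendre_deriv n (S m) c) in *.
      set (p2 := legendre_deriv n (S (S m)) c) in *. clearbody p0 p1 p2. simpl.
      transitivity (w * ce * (- 2 * (INR m + 1) * c * p1 * c + (s ^ 2 * p2) * c
         + s ^ 2 * p1 * (INR e + 1))); [ring|].
      replace (s ^ 2 * p2) with (2 * (INR m + 1) * c * p1
        - (INR n * (INR n + 1) - INR m * (INR m + 1)) * p0) by (rewrite SC; lra).
      ring.
    + repeat cont_step; lazymatch goal with
      | |- continuous (fun _ => legendre_weight _ _ _) _ =>
          apply continuous_legendre_weight, continuous_id
      | |- _ => apply continuous_id end.
  - unfold Z. rewrite sin_PI, sin_0, pow_i by lia. unfold minus, plus, opp; simpl. ring.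
Qed.

Lemma legendre_moment_000 : legendre_moment 0 0 0 = 2.
Proof.
  eapply is_RInt_uniq; [apply is_RInt_legendre_moment|].
  pose proof PI_RGT_0.
  replace 2 with (minus (- cos PI) (- cos 0)).
  - eapply is_RInt_ext; [|apply (is_RInt_derive (fun t => - cos t) sin)].
    + intros t _. unfold legendre_weight, legendre_deriv. simpl. ring.
    + intros t _. auto_derive; trivial. ring.
    + intros t _. apply continuous_sin.
  - rewrite cos_PI, cos_0. unfold minus, plus, opp; simpl. ring.
Qed.

(** Bonnet's recurrence tested against [x^n], to which [P_(n+2)] is orthogonal. *)
Lemma legendre_moment_diag_S n :
  (2 * INR n + 3) * legendre_moment 0 (S n) (S n) = (INR n + 1) * legendre_moment 0 n n.
Proof.
  assert (V : legendre_moment 0 (S (S n)) n = 0).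
  { apply (legendre_moment_vanish 0 (S (S n)) n). intros k. lia. }
  apply Rminus_diag_uniq.
  replace ((2 * INR n + 3) * legendre_moment 0 (S n) (S n)
      - (INR n + 1) * legendre_moment 0 n n)
    with ((2 * INR n + 3) * legendre_moment 0 (S n) (S n)
      + - (INR n + 1) * legendre_moment 0 n n) by ring.
  replace 0 with ((INR n + 2) * legendre_moment 0 (S (S n)) n) by (rewrite V; ring).
  eapply is_RInt_uniq; [apply is_RInt_lin2; apply is_RInt_legendre_moment|].
  eapply is_RInt_ext; [|apply (is_RInt_scal (fun t => legendre_weight 0 (S (S n)) t * cos t ^ n)),
    is_RInt_legendre_moment].
  intros t _. unfold scal; simpl; unfold mult; simpl. unfold legendre_weight.
  rewrite legendre_deriv_bonnet. simpl. field. pose proof (pos_INR n); lra.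
Qed.

Lemma gamma_half_pos j : 0 < gamma_half j.
Proof.
  induction j as [|j IH]; simpl; [apply sqrt_lt_R0, PI_RGT_0|].
  pose proof (pos_INR j). apply Rmult_lt_0_compat; lra.
Qed.

Lemma legendre_moment_diag n :
  legendre_moment 0 n n = INR (Factorial.fact n) * sqrt PI / (2 ^ n * gamma_half (n + 1)).
Proof.
  assert (P := sqrt_lt_R0 PI PI_RGT_0).
  induction n as [|n IH].
  - rewrite legendre_moment_000. simpl. field. lra.
  - pose proof (pos_INR n). apply (Rmult_eq_reg_l (2 * INR n + 3)); [|lra].
    rewrite legendre_moment_diag_S, IH, fact_simpl, mult_INR.
    rewrite !Nat.add_1_r. change (gamma_half (S (S n))) with (gamma_half (S n) * (INR (S n) + /2)).
    rewrite S_INR. simpl pow. pose proof (gamma_half_pos (S n)).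
    assert (0 < 2 ^ n) by (apply pow_lt; lra).
    field. repeat split; lra.
Qed.

Lemma legendre_moment_base m n : (m <= n)%nat -> legendre_moment m n (n - m) =
  INR (Factorial.fact (n + m)) * sqrt PI / (2 ^ n * gamma_half (n + 1)).
Proof.
  induction m as [|m IH]; intros Hmn.
  - rewrite Nat.sub_0_r, Nat.add_0_r. apply legendre_moment_diag.
  - rewrite legendre_moment_step, IH by lia.
    rewrite <- (plus_n_Sm n m), fact_simpl, mult_INR, S_INR, plus_INR.
    field. split; [pose proof (gamma_half_pos (n + 1)); lra|]. apply pow_nonzero; lra.
Qed.

Lemma PSeries_tail_bound (c : nat -> R) (r z : R) (N : nat) :
  (forall k, 0 <= c k) -> Rabs z <= r -> ex_series (fun k => c k * r ^ k) ->
  Rabs (PSeries c z - sum_n (fun k => c k * z ^ k) N) <=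
  PSeries c r - sum_n (fun k => c k * r ^ k) N.
Proof.
  intros Hc Hz Hr.
  assert (T : forall k, Rabs (c k * z ^ k) <= c k * r ^ k).
  { intros k. rewrite Rabs_mult, (Rabs_pos_eq (c k)) by trivial.
    apply Rmult_le_compat_l; trivial. rewrite <- RPow_abs. apply pow_incr. split; trivial.
    apply Rabs_pos. }
  assert (Hz' : ex_series (fun k => Rabs (c k * z ^ k))).
  { apply (@ex_series_le R_AbsRing R_CompleteNormedModule _ (fun k => c k * r ^ k)); trivial.
    intros k. change norm with Rabs. now rewrite Rabs_Rabsolu. }
  unfold PSeries.
  rewrite (Series_incr_n _ (S N)) by (try lia; now apply ex_series_Rabs).
  rewrite (Series_incr_n (fun k => c k * r ^ k) (S N)) by (trivial; lia).
  simpl pred. rewrite !sum_n_Reals.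
  match goal with |- Rabs (?s + ?x - ?s) <= ?u + ?y - ?u =>
    replace (s + x - s) with x by ring; replace (u + y - u) with y by ring end.
  eapply Rle_trans; [apply Series_Rabs|apply Series_le].
  - now apply (ex_series_incr_n (fun k => Rabs (c k * z ^ k)) (S N)).
  - intros k. split; [apply Rabs_pos|apply T].
  - now apply (ex_series_incr_n (fun k => c k * r ^ k) (S N)).
Qed.

Lemma continuous_bounded (f : R -> R) a b : a <= b ->
  (forall t, a <= t <= b -> continuous f t) -> exists W, forall t, a <= t <= b -> Rabs (f t) <= W.
Proof.
  intros Hab Hf.
  destruct (continuity_ab_maj (fun t => Rabs (f t)) a b Hab) as [M [HM _]].
  - intros t Ht. apply continuity_pt_filterlim.
    apply (continuous_comp f Rabs); [now apply Hf|apply continuous_Rabs].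
  - exists (Rabs (f M)). exact HM.
Qed.

(* Termwise integration, uniformly convergent because the tail at [r cos t] is at most that at [r]. *)
Lemma legendre_weight_series_integral m n (c : nat -> R) (r : R) :
  (forall k, 0 <= c k) -> 0 <= r -> ex_series (fun k => c k * r ^ k) ->
  ex_RInt (fun t => legendre_weight m n t * PSeries c (r * cos t)) 0 PI ->
  RInt (fun t => legendre_weight m n t * PSeries c (r * cos t)) 0 PI =
  PSeries (fun k => c k * legendre_moment m n k) r.
Proof.
  intros Hc Hr Hs Hex. pose proof PI_RGT_0 as HPI.
  set (w := legendre_weight m n).
  destruct (continuous_bounded w 0 PI ltac:(lra)) as [W HW].
  { intros t _. apply continuous_legendre_weight, continuous_id. }
  set (I := RInt _ 0 PI).
  assert (HI : is_RInt (fun t => w t * PSeries c (r * cos t)) 0 PI I)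
    by now apply (@RInt_correct R_CompleteNormedModule).
  symmetry. apply is_series_unique.
  assert (Hp : forall N, is_RInt (fun t => w t * sum_n (fun k => c k * (r * cos t) ^ k) N) 0 PI
     (sum_n (fun k => c k * legendre_moment m n k * r ^ k) N)).
  { induction N as [|N IH].
    - rewrite sum_O. apply (is_RInt_ext (fun t => scal (c 0%nat) (w t * cos t ^ 0))).
      + intros t _. rewrite sum_O. unfold scal; simpl; unfold mult; simpl. ring.
      + replace (c 0%nat * legendre_moment m n 0 * r ^ 0)
          with (scal (c 0%nat) (legendre_moment m n 0))
          by (unfold scal; simpl; unfold mult; simpl; ring).
        apply @is_RInt_scal, is_RInt_legendre_moment.
    - rewrite sum_Sn.
      apply (is_RInt_ext (fun t => plus (w t * sum_n (fun k => c k * (r * cos t) ^ k) N)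
        (scal (c (S N) * r ^ S N) (w t * cos t ^ S N)))).
      + intros t _. rewrite sum_Sn, Rpow_mult_distr.
        unfold plus, scal; simpl; unfold mult; simpl. ring.
      + apply @is_RInt_plus; [exact IH|].
        replace (c (S N) * legendre_moment m n (S N) * r ^ S N)
          with (scal (c (S N) * r ^ S N) (legendre_moment m n (S N)))
          by (unfold scal; simpl; unfold mult; simpl; ring).
        apply @is_RInt_scal, is_RInt_legendre_moment. }
  assert (Htail : is_lim_seq (fun N => PI * (W * (PSeries c r - sum_n (fun k => c k * r ^ k) N))) 0).
  { replace (Finite 0) with (Finite (PI * (W * (PSeries c r - PSeries c r)))) by (f_equal; ring).
    apply (is_lim_seq_scal_l _ PI (W * (PSeries c r - PSeries c r))).
    apply (is_lim_seq_scal_l _ W (PSeries c r - PSeries c r)).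
    apply is_lim_seq_minus'; [apply is_lim_seq_const|].
    exact (Series_correct _ Hs). }
  assert (HB : forall N, Rabs (sum_n (fun k => c k * legendre_moment m n k * r ^ k) N - I) <=
     PI * (W * (PSeries c r - sum_n (fun k => c k * r ^ k) N))).
  { intros N.
    pose proof (is_RInt_minus _ _ _ _ _ _ (Hp N) HI) as D.
    change (minus (sum_n (fun k => c k * legendre_moment m n k * r ^ k) N) I)
      with (sum_n (fun k => c k * legendre_moment m n k * r ^ k) N - I) in D.
    rewrite <- (@is_RInt_unique R_CompleteNormedModule _ _ _ _ D).
    eapply Rle_trans.
    - apply (abs_RInt_le_const _ 0 PI (W * (PSeries c r - sum_n (fun k => c k * r ^ k) N)));
        [lra|eexists; exact D|].
      intros t Ht. unfold minus, plus, opp; simpl.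
      replace (w t * sum_n (fun k => c k * (r * cos t) ^ k) N
         + - (w t * PSeries c (r * cos t)))
        with (- (w t * (PSeries c (r * cos t) - sum_n (fun k => c k * (r * cos t) ^ k) N)))
        by ring.
      rewrite Rabs_Ropp, Rabs_mult.
      apply Rmult_le_compat; try apply Rabs_pos; [now apply HW|].
      apply PSeries_tail_bound; trivial.
      rewrite Rabs_mult, (Rabs_pos_eq r) by trivial.
      assert (Rabs (cos t) <= 1) by (apply Rabs_le; pose proof (COS_bound t); lra).
      nra.
    - rewrite Rminus_0_r. lra. }
  assert (HL : is_lim_seq (fun N => sum_n (fun k => c k * legendre_moment m n k * r ^ k) N - I) 0).
  { apply is_lim_seq_abs_0.
    apply (is_lim_seq_le_le (fun _ => 0) _ _ 0) with (3 := Htail).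
    - intros N. split; [apply Rabs_pos|apply HB].
    - apply is_lim_seq_const. }
  change (is_lim_seq (sum_n (fun k => c k * legendre_moment m n k * r ^ k)) I).
  apply (is_lim_seq_ext (fun N => sum_n (fun k => c k * legendre_moment m n k * r ^ k) N - I + I)).
  - intros; ring.
  - replace (Finite I) with (Finite (0 + I)) by (f_equal; ring).
    apply is_lim_seq_plus'; [exact HL|apply is_lim_seq_const].
Qed.

Lemma poch_fact k j : poch (INR k + 1) j = INR (Factorial.fact (k + j)) / INR (Factorial.fact k).
Proof.
  induction j as [|j IH]; simpl poch.
  - rewrite Nat.add_0_r. field. apply INR_fact_neq_0.
  - rewrite IH, <- plus_n_Sm, fact_simpl, mult_INR, S_INR, plus_INR. field. apply INR_fact_neq_0.
Qed.

Definition Q_coef (m n k : nat) : R :=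
  poch ((INR n + INR m) / 2 + 1) k * poch ((INR n + INR m + 1) / 2) k
  * / gamma_half (n + k + 1) / INR (Factorial.fact k).

Lemma Q_coef_S m n k :
  (INR k + 1) * (INR n + INR k + 3 / 2) * Q_coef m n (S k) =
  ((INR n + INR m) / 2 + 1 + INR k) * ((INR n + INR m + 1) / 2 + INR k) * Q_coef m n k.
Proof.
  unfold Q_coef. replace (n + S k + 1)%nat with (S (n + k + 1)) by lia.
  rewrite fact_simpl, mult_INR, S_INR. simpl poch.
  change (gamma_half (S (n + k + 1))) with (gamma_half (n + k + 1) * (INR (n + k + 1) + /2)).
  rewrite !plus_INR. simpl (INR 1).
  pose proof (pos_INR k). pose proof (pos_INR n). pose proof (gamma_half_pos (n + k + 1)).
  field. repeat split; try apply INR_fact_neq_0; lra.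
Qed.

Lemma Q_coef_pos m n k : 0 < Q_coef m n k.
Proof.
  pose proof (pos_INR m). pose proof (pos_INR n).
  repeat apply Rmult_lt_0_compat; try apply poch_pos; try lra;
    apply Rinv_0_lt_compat; [apply gamma_half_pos|apply INR_fact_lt_0].
Qed.

Lemma CV_radius_Q m n : CV_radius (Q_coef m n) = 1.
Proof.
  apply CV_radius_1; [apply Q_coef_pos|].
  pose proof (pos_INR m). pose proof (pos_INR n).
  replace (Finite 1) with (Finite (1 * 1)) by (f_equal; ring).
  apply is_lim_seq_ext with (2 := is_lim_seq_mult' _ _ _ _
    (is_lim_seq_shift_ratio ((INR n + INR m) / 2 + 1) 1 Rlt_0_1)
    (is_lim_seq_shift_ratio ((INR n + INR m + 1) / 2) (INR n + 3 / 2) ltac:(lra))).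
  intros k. pose proof (Q_coef_pos m n k). pose proof (pos_INR k).
  pose proof (Q_coef_S m n k) as E.
  apply (Rmult_eq_reg_r ((INR k + 1) * (INR n + INR k + 3 / 2) * Q_coef m n k)).
  - transitivity (((INR n + INR m) / 2 + 1 + INR k) * ((INR n + INR m + 1) / 2 + INR k)
      * Q_coef m n k).
    + field. split; lra.
    + rewrite <- E. field. lra.
  - assert (0 < (INR k + 1) * (INR n + INR k + 3 / 2)) by nra. nra.
Qed.

(** From [k] to [k + 1] the left side gains two consecutive binomial ratios and one moment ratio.
    Their product is the ratio of hypergeometric coefficients, with the linear factors split into
    even and odd ones. *)
Lemma binom_moment_Q m d k :
  binom_coef (2 * INR m + 1) (d + 2 * k) * legendre_moment m (m + d) (d + 2 * k) =
  binom_coef (2 * INR m + 1) d * legendre_moment m (m + d) d * gamma_half (m + d + 1)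
  * Q_coef m (m + d) k.
Proof.
  induction k as [|k IH].
  - rewrite Nat.mul_0_r, Nat.add_0_r. unfold Q_coef. rewrite Nat.add_0_r. simpl. field.
    pose proof (gamma_half_pos (m + d + 1)). lra.
  - pose proof (Q_coef_S m (m + d) k) as E. pose proof (legendre_moment_ratio m d k) as Mo.
    pose proof (binom_coef_S (2 * INR m + 1) (d + 2 * k)) as B1.
    pose proof (binom_coef_S (2 * INR m + 1) (S (d + 2 * k))) as B2.
    replace (S (S (d + 2 * k))) with (d + 2 * S k)%nat in B2 by lia.
    rewrite S_INR in B2. rewrite plus_INR, mult_INR in B1, B2. simpl (INR 2) in B1, B2.
    rewrite plus_INR in E, Mo.
    pose proof (pos_INR k). pose proof (pos_INR d). pose proof (pos_INR m).
    set (D := INR d) in *. set (K := INR k) in *. set (M := INR m) in *.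
    set (b0 := binom_coef _ (d + 2 * k)) in *. set (b1 := binom_coef _ (S (d + 2 * k))) in *.
    set (b2 := binom_coef _ (d + 2 * S k)) in *.
    set (m0 := legendre_moment _ _ (d + 2 * k)) in *.
    set (m2 := legendre_moment _ _ (d + 2 * S k)) in *.
    set (q0 := Q_coef m (m + d) k) in *. set (q1 := Q_coef m (m + d) (S k)) in *.
    set (C := binom_coef _ d * _ * _) in *. clearbody b0 b1 b2 m0 m2 q0 q1 C D K M.
    apply (Rmult_eq_reg_l (4 * (K + 1) * (M + D + K + 3 / 2) * (D + 2 * K + 2) * (D + 2 * K + 1))).
    + transitivity ((2 * (K + 1) * (2 * (M + D) + 2 * K + 3) * m2)
        * (b2 * (D + (1 + 1) * K + 1 + 1)) * (D + 2 * K + 1)); [field|].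
      rewrite Mo, B2.
      transitivity ((D + 2 * K + 2) * (D + 2 * K + 1) * m0 * (2 * M + 1 + (D + (1 + 1) * K + 1))
        * (b1 * (D + (1 + 1) * K + 1))); [ring|].
      rewrite B1.
      transitivity ((D + 2 * K + 2) * (D + 2 * K + 1) * (2 * M + 1 + (D + (1 + 1) * K + 1))
        * (2 * M + 1 + (D + (1 + 1) * K)) * (b0 * m0)); [ring|].
      rewrite IH.
      transitivity (4 * (D + 2 * K + 2) * (D + 2 * K + 1) * C
        * ((K + 1) * (M + D + K + 3 / 2) * q1)); [rewrite E; field|field].
    + repeat apply Rmult_integral_contrapositive_currified; lra.
Qed.

Lemma binom_series_pow m r : Rabs r < 1 ->
  PSeries (binom_coef (2 * INR m + 1)) r = / (1 - r) ^ (2 * m + 1).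
Proof.
  intros Hr. pose proof (pos_INR m).
  pose proof (binomial_series (2 * INR m + 1) r ltac:(lra) Hr) as B.
  apply Rabs_def2 in Hr.
  assert (P : 0 < (1 - r) ^ (2 * m + 1)) by (apply pow_lt; lra).
  replace (2 * INR m + 1) with (INR (2 * m + 1)) in B at 2
    by (rewrite plus_INR, mult_INR; simpl; ring).
  rewrite Rpower_pow in B by lra.
  apply (Rmult_eq_reg_r ((1 - r) ^ (2 * m + 1))); [|lra].
  rewrite B. field. lra.
Qed.

(** Only the powers [cos t ^ (d + 2 k)] of the expansion survive, so the result is [a^(-2m-1-d)]
    times a series in [1 / a^2]. Writing the degree as [m + d] avoids truncated subtraction. *)
Lemma neumann_integral m d a : 1 < a ->
  RInt (fun t => legendre_weight m (m + d) t * / (a - cos t) ^ (2 * m + 1)) 0 PI =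
  / a ^ (2 * m + d + 1) * (binom_coef (2 * INR m + 1) d * legendre_moment m (m + d) d
     * gamma_half (m + d + 1)) * PSeries (Q_coef m (m + d)) (/ a ^ 2).
Proof.
  intros Ha. set (n := (m + d)%nat). set (r := / a).
  assert (Hr : 0 < r < 1).
  { unfold r. split; [apply Rinv_0_lt_compat; lra|]. rewrite <- Rinv_1. apply Rinv_lt_contravar; lra. }
  pose proof (pos_INR m).
  assert (Hcos : forall t, Rabs (r * cos t) < 1).
  { intros t. rewrite Rabs_mult, (Rabs_pos_eq r) by lra.
    assert (Rabs (cos t) <= 1) by (apply Rabs_le; pose proof (COS_bound t); lra).
    pose proof (Rabs_pos (cos t)). nra. }
  set (c := binom_coef (2 * INR m + 1)).
  assert (Hc : forall k, 0 < c k) by (intros; apply binom_coef_pos; lra).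
  assert (Hpt : forall t, / (a - cos t) ^ (2 * m + 1) = r ^ (2 * m + 1) * PSeries c (r * cos t)).
  { intros t. unfold c. rewrite binom_series_pow by apply Hcos.
    unfold r. rewrite pow_inv, <- Rinv_mult, <- Rpow_mult_distr.
    do 2 f_equal. field. lra. }
  assert (Cont : forall t, continuous (fun t => legendre_weight m n t * PSeries c (r * cos t)) t).
  { intros t. apply cont_mult; [apply continuous_legendre_weight, continuous_id|].
    apply (cont_comp (PSeries c) (fun t => r * cos t) t (PSeries (PS_derive c) (r * cos t))).
    - repeat cont_step. apply continuous_id.
    - apply is_derive_PSeries. unfold c. rewrite CV_radius_binom by lra. apply Hcos. }
  assert (Hex : ex_RInt (fun t => legendre_weight m n t * PSeries c (r * cos t)) 0 PI)
    by (apply @ex_RInt_continuous; intros; apply Cont).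
  transitivity (r ^ (2 * m + 1) * RInt (fun t => legendre_weight m n t * PSeries c (r * cos t)) 0 PI).
  { apply (@is_RInt_unique R_CompleteNormedModule).
    eapply is_RInt_ext; [|apply (is_RInt_scal (fun t => legendre_weight m n t * PSeries c (r * cos t)))].
    - intros t _. rewrite Hpt. unfold scal; simpl; unfold mult; simpl. ring.
    - now apply (@RInt_correct R_CompleteNormedModule). }
  assert (Hser : ex_series (fun k => c k * r ^ k)).
  { apply (ex_series_ext (fun k => scal (pow_n r k) (c k))).
    - intros k. rewrite pow_n_pow. apply Rmult_comm.
    - apply (ex_pseries_in_unit c r); [apply CV_radius_binom; lra|].
      rewrite Rabs_pos_eq; lra. }
  rewrite legendre_weight_series_integral; trivial; [|intros; now apply Rlt_le|lra].
  (* The moments below [d] vanish, so [r ^ d] factors out; of the remaining ones the odd offsets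
     vanish by parity. *)
  rewrite (PSeries_decr_n_aux _ d).
  2:{ intros k Hk. unfold n. rewrite legendre_moment_vanish by (intros; lia). apply Rmult_0_r. }
  set (C0 := c d * legendre_moment m n d * gamma_half (n + 1)).
  assert (Hr2 : Rabs (r ^ 2) < 1) by (rewrite Rabs_pos_eq; nra).
  assert (Ev : forall k, PS_decr_n (fun k => c k * legendre_moment m n k) d (2 * k)%nat =
     PS_scal C0 (Q_coef m n) k).
  { intros k. unfold PS_decr_n, PS_scal, c, n, C0. now rewrite binom_moment_Q. }
  assert (Od : forall k, PS_decr_n (fun k => c k * legendre_moment m n k) d (2 * k + 1)%nat = 0).
  { intros k. unfold PS_decr_n, n. rewrite legendre_moment_vanish by (intros; lia). apply Rmult_0_r. }
  rewrite PSeries_odd_even.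
  - rewrite (PSeries_ext _ _ _ Ev), PSeries_scal.
    rewrite (PSeries_ext _ (fun _ => 0) _ Od), PSeries_const_0.
    replace (r ^ 2) with (/ a ^ 2) by (unfold r; now rewrite pow_inv).
    replace (/ a ^ (2 * m + d + 1)) with (r ^ (2 * m + 1) * r ^ d).
    + unfold C0, c, n. match goal with |- ?x = ?y => change (@eq R x y) end. ring.
    + rewrite <- pow_add. unfold r. rewrite pow_inv. do 2 f_equal. lia.
  - apply (ex_pseries_ext (PS_scal C0 (Q_coef m n))); [intros; now rewrite Ev|].
    apply ex_pseries_scal; [apply Rmult_comm|]. apply ex_pseries_in_unit; trivial.
    apply CV_radius_Q.
  - apply (ex_pseries_ext (PS_scal 0 (Q_coef m n))).
    { intros k. rewrite Od. apply Rmult_0_l. }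
    apply ex_pseries_scal; [apply Rmult_comm|]. apply ex_pseries_in_unit; trivial.
    apply CV_radius_Q.
Qed.

(** * The separation carried out for the radius and for the angle *)

Lemma good_rot x y a b : good x y a b -> good b x y a.
Proof.
  unfold good. replace (Sq b x y a) with (Sq x y a b) by (unfold Sq; ring).
  now replace (Pi4 b x y a) with (Pi4 x y a b) by (unfold Pi4; ring).
Qed.

Lemma ker_integral_sigma m n s s' t' : 0 <= s' < s ->
  RInt (fun t => legendre_weight m n t * ker m (cosh s') (cos t) (cos t') (cosh s)) 0 PI
    * legendre_deriv n m 1 =
  legendre_deriv n m (cosh s') *
  RInt (fun t => legendre_weight m n t * ker m 1 (cos t) (cos t') (cosh s)) 0 PI.
Proof.
  intros Hs.
  (* The strip ends at [s], where the two radii would meet; the lower bound is 0 because [coth] is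
     positive there. *)
  apply (ker_integral_separate m n (cos t') (cosh s) s 0 (-1) cosh sinh); trivial.
  - intros z. apply is_derive_Reals, derivable_pt_lim_cosh.
  - intros z. replace (- (-1) * cosh z) with (cosh z) by ring.
    apply is_derive_Reals, derivable_pt_lim_sinh.
  - intros z. rewrite cosh2_sinh2. ring.
  - apply cosh_0.
  - apply sinh_0.
  - intros z Hz t. apply Rabs_def2 in Hz. apply good_rot, good_trig_neq; lra.
  - intros z Hz. pose proof (sinh_pos z); lra.
  - intros z Hz. pose proof (sinh_pos z ltac:(lra)). pose proof (cosh_ge_1 z).
    pose proof (pos_INR m).
    assert (0 < - (-1) * cosh z / sinh z) by (apply Rdiv_lt_0_compat; lra). nra.
Qed.

Lemma ker_integral_theta m n s t' : 0 < s -> 0 < t' < PI ->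
  RInt (fun t => legendre_weight m n t * ker m (cos t') (cos t) 1 (cosh s)) 0 PI
    * legendre_deriv n m 1 =
  legendre_deriv n m (cos t') *
  RInt (fun t => legendre_weight m n t * ker m 1 (cos t) 1 (cosh s)) 0 PI.
Proof.
  intros Hs Ht.
  (* [cot] tends to minus infinity at [PI], so the strip stops halfway between [t'] and [PI]; up to
     [L] one has [cot z >= -1 / sin L]. *)
  apply (ker_integral_separate m n 1 (cosh s) ((t' + PI) / 2)
    ((2 * INR m + 1) / sin ((t' + PI) / 2)) 1 cos (fun t => - sin t)); trivial.
  - intros z. auto_derive; trivial. ring.
  - intros z. auto_derive; trivial. ring.
  - intros z. pose proof (sin2_cos2' z). lra.
  - apply cos_0.
  - rewrite sin_0. ring.
  - intros z Hz t. pose proof (good_trig_neq 0 s z t) as G. rewrite cosh_0 in G. apply G; lra.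
  - intros z Hz. pose proof (sin_gt_0 z). lra.
  - intros z Hz. assert (Z : 0 < sin z) by (apply sin_gt_0; lra).
    set (L := (t' + PI) / 2) in *. assert (HL : 0 < sin L) by (apply sin_gt_0; unfold L; lra).
    pose proof (pos_INR m).
    replace (- (1) * cos z / - sin z) with (cos z / sin z) by (field; lra).
    replace (- ((2 * INR m + 1) / sin L)) with ((2 * INR m + 1) * (- 1 / sin L)) by (field; lra).
    apply Rmult_le_compat_l; [lra|].
    destruct (Rle_dec z (PI / 2)) as [Hz2|Hz2].
    + apply Rle_trans with 0.
      * assert (0 < / sin L) by now apply Rinv_0_lt_compat. lra.
      * apply Rmult_le_pos; [apply cos_ge_0; lra|]. now apply Rlt_le, Rinv_0_lt_compat.
    + assert (sin L <= sin z) by (apply Rlt_le, sin_decreasing_1; unfold L in *; lra).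
      pose proof (COS_bound z).
      apply Rle_trans with (- 1 / sin z).
      * assert (/ sin z <= / sin L) by now apply Rinv_le_contravar. lra.
      * apply Rmult_le_compat_r; [now apply Rlt_le, Rinv_0_lt_compat|lra].
  - split; lra.
Qed.

(** * Closed form of the integral for distinct radii *)

Lemma Series_finite (c : nat -> R) N : (forall k, (N < k)%nat -> c k = 0) ->
  Series c = sum_f_R0 c N.
Proof.
  intros Hc. apply is_series_unique.
  change (is_lim_seq (sum_n c) (sum_f_R0 c N)).
  apply (is_lim_seq_ext_loc (fun _ => sum_f_R0 c N)); [|apply is_lim_seq_const].
  exists N. intros k Hk. rewrite sum_n_Reals. induction Hk as [|k Hk IH]; trivial.
  simpl. rewrite <- IH, Hc by lia. ring.
Qed.

Lemma Derive_n_legendre_deriv n m k : forall x,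
  Derive_n (legendre_deriv n m) k x = legendre_deriv n (m + k) x.
Proof.
  induction k as [|k IH]; intros x; simpl.
  - now rewrite Nat.add_0_r.
  - rewrite (Derive_ext _ _ _ IH), <- plus_n_Sm. apply is_derive_unique, is_derive_legendre_deriv.
Qed.

Lemma legendre_deriv_taylor n m z : 1 < z ->
  legendre_deriv n m z =
  sum_f_R0 (fun k => (z - 1) ^ k / INR (Factorial.fact k) * legendre_deriv n (m + k) 1) n.
Proof.
  intros Hz. destruct (Taylor_Lagrange (legendre_deriv n m) n 1 z Hz) as [c [_ E]].
  { intros t _ k _. destruct k as [|k]; simpl; trivial.
    apply (ex_derive_ext (legendre_deriv n (m + k))).
    - intros; now rewrite Derive_n_legendre_deriv.
    - eexists; apply is_derive_legendre_deriv. }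
  (* The Lagrange remainder contains a derivative of [P_n] of order above [n]. *)
  rewrite E, Derive_n_legendre_deriv, (legendre_deriv_gt n (m + S n)), Rmult_0_r, Rplus_0_r by lia.
  apply sum_eq. intros k _. now rewrite Derive_n_legendre_deriv.
Qed.

Lemma poch_neg n k : (n < k)%nat -> poch (- INR n) k = 0.
Proof.
  induction k as [|k IH]; intros Hk; [lia|]. simpl.
  destruct (Nat.eq_dec k n) as [->|]; [ring|]. rewrite IH by lia. ring.
Qed.

(** The reciprocal Gamma factors vanish for [k < m] and [(-n)_k] for [k > n], so the series is
    [(z-1)^m] times the Taylor polynomial of [P_n^(m)] at 1; the prefactor turns [(z-1)^m] into
    [(z^2-1)^(m/2)]. *)
Lemma legP_cosh m n s : 0 < s -> legP m n (cosh s) = sinh s ^ m * legendre_deriv n m (cosh s).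
Proof.
  intros Hs. assert (Hz : 1 < cosh s) by (apply cosh_gt_1; lra).
  pose proof (sinh_pos s Hs) as Hsh. pose proof (cosh2_sinh2 s) as E.
  set (z := cosh s) in *. unfold legP, hyp2F1reg.
  rewrite (Series_incr_n_aux _ m).
  2:{ intros k Hk. unfold rgamma_int.
    replace (1 - Z.of_nat m + Z.of_nat k <=? 0)%Z with true by (symmetry; apply Z.leb_le; lia).
    unfold Rdiv. ring. }
  rewrite (Series_finite _ n).
  2:{ intros k Hk. rewrite poch_neg by lia. unfold Rdiv. ring. }
  rewrite (sum_eq _ (fun k => (z - 1) ^ k / INR (Factorial.fact k) * legendre_deriv n (m + k) 1
     * (z - 1) ^ m)).
  2:{ intros k _. unfold rgamma_int.
    replace (1 - Z.of_nat m + Z.of_nat (m + k) <=? 0)%Z with false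
      by (symmetry; apply Z.leb_gt; lia).
    replace (Z.to_nat (1 - Z.of_nat m + Z.of_nat (m + k) - 1)) with k by lia.
    rewrite legendre_deriv_at_1.
    replace ((1 - z) / 2) with (- / 2 * (z - 1)) by field.
    rewrite Rpow_mult_distr, (pow_add (z - 1)).
    field. split; apply INR_fact_neq_0. }
  rewrite <- scal_sum, <- legendre_deriv_taylor by trivial.
  rewrite <- Rmult_assoc, <- Rpow_mult_distr. do 2 f_equal.
  apply Rsqr_inj; [|lra|].
  - apply Rmult_le_pos; [apply sqrt_pos|lra].
  - rewrite Rsqr_mult, Rsqr_sqrt by (apply Rlt_le, Rdiv_lt_0_compat; lra).
    unfold Rsqr. transitivity (z ^ 2 - 1); [field; lra|]. rewrite E. ring.
Qed.

Lemma legQ_cosh m n s : 0 < s -> legQ m n (cosh s) =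
  (-1) ^ m * sqrt PI * INR (Factorial.fact (n + m)) * sinh s ^ m
  / (2 ^ (n + 1) * cosh s ^ (n + m + 1)) * PSeries (Q_coef m n) (/ cosh s ^ 2).
Proof.
  intros Hs. unfold legQ. pose proof (sinh_pos s Hs).
  replace (cosh s ^ 2 - 1) with (sinh s ^ 2) by (rewrite cosh2_sinh2; ring).
  rewrite sqrt_pow2 by lra. reflexivity.
Qed.

(** Duplication at half-integers; it provides the [(2m)!] to cancel the one from the binomial
    coefficients of exponent [2m + 1]. *)
Lemma gamma_half_fact m :
  gamma_half m = INR (Factorial.fact (2 * m)) * sqrt PI / (4 ^ m * INR (Factorial.fact m)).
Proof.
  induction m as [|m IH].
  - simpl. field.
  - simpl gamma_half. rewrite IH. replace (2 * S m)%nat with (S (S (2 * m))) by lia.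
    rewrite !fact_simpl, !mult_INR, !S_INR, mult_INR. simpl (INR 2). simpl pow.
    pose proof (pos_INR m). assert (0 < 4 ^ m) by (apply pow_lt; lra).
    field. repeat split; try apply INR_fact_neq_0; lra.
Qed.

Lemma ker_at_foci m x a : x < a -> ker m 1 x 1 a = / INR (Factorial.fact m) * / (a - x) ^ (2 * m + 1).
Proof.
  intros Hx. unfold ker, ker_arg, hpow.
  replace (Pi4 1 x 1 a) with 0 by (unfold Pi4; ring).
  replace (Sq 1 x 1 a) with ((a - x) ^ 2) by (unfold Sq; ring).
  unfold Rdiv at 1. rewrite Rmult_0_l, G0_at_0, sqrt_pow2 by lra.
  do 2 f_equal. rewrite <- pow_mult, pow_add. ring.
Qed.

Lemma ker_sym_foci m x y a : ker m 1 x y a = ker m y x 1 a.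
Proof.
  unfold ker, ker_arg. replace (Sq y x 1 a) with (Sq 1 x y a) by (unfold Sq; ring).
  now replace (Pi4 y x 1 a) with (Pi4 1 x y a) by (unfold Pi4; ring).
Qed.

(** The factor in the integrand that does not depend on [t]. Its power of order [m + 1/2] comes from
    [chi^(-m-1/2)], whose powers of 2 cancel those in [legQhalf]; the sign is that of the Ferrers
    function. *)
Definition integral_const (m : nat) (s s' t' : R) : R :=
  (-1) ^ m * sqrt PI * gamma_half m
  * ((sinh s * sinh s' * sin t') ^ m * sqrt (sinh s * sinh s' * sin t')).

(** Each separation divides by [P_n^(m)(1)], hence the square; the last factor is the integral at
    [b = y = 1] expressed through [legQ]. *)
Lemma ker_integral_value m n s s' t' : (m <= n)%nat -> 0 < s' < s -> 0 < t' < PI ->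
  RInt (fun t => legendre_weight m n t * ker m (cosh s') (cos t) (cos t') (cosh s)) 0 PI =
  legendre_deriv n m (cosh s') * legendre_deriv n m (cos t') *
  (2 ^ m * INR (Factorial.fact m) * INR (Factorial.fact (n - m))
    / INR (Factorial.fact (n + m))) ^ 2
  * (2 * (-1) ^ m * INR (Factorial.fact (n + m))
      / (INR (Factorial.fact (2 * m)) * INR (Factorial.fact (n - m)) * INR (Factorial.fact m))
     * legQ m n (cosh s) / sinh s ^ m).
Proof.
  intros Hmn Hs Ht.
  pose proof (ker_integral_sigma m n s s' t' ltac:(lra)) as A.
  rewrite (RInt_ext (fun t => legendre_weight m n t * ker m 1 (cos t) (cos t') (cosh s))
    (fun t => legendre_weight m n t * ker m (cos t') (cos t) 1 (cosh s))) in A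
    by (intros; now rewrite ker_sym_foci).
  pose proof (ker_integral_theta m n s t' ltac:(lra) Ht) as B.
  assert (Ha : 1 < cosh s) by (apply cosh_gt_1; lra).
  assert (N : RInt (fun t => legendre_weight m n t * ker m 1 (cos t) 1 (cosh s)) 0 PI =
    2 * (-1) ^ m * INR (Factorial.fact (n + m))
      / (INR (Factorial.fact (2 * m)) * INR (Factorial.fact (n - m)) * INR (Factorial.fact m))
     * legQ m n (cosh s) / sinh s ^ m).
  { destruct (Nat.le_exists_sub m n Hmn) as [d [-> _]].
    rewrite (Nat.add_comm d m).
    replace (m + d - m)%nat with d by lia.
    transitivity (/ INR (Factorial.fact m) *
      RInt (fun t => legendre_weight m (m + d) t * / (cosh s - cos t) ^ (2 * m + 1)) 0 PI).
    - apply (@is_RInt_unique R_CompleteNormedModule).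
      eapply is_RInt_ext; [|apply (is_RInt_scal
        (fun t => legendre_weight m (m + d) t * / (cosh s - cos t) ^ (2 * m + 1)))].
      + intros t _. pose proof (COS_bound t). rewrite ker_at_foci by lra.
        unfold scal; simpl; unfold mult; simpl. ring.
      + apply (@RInt_correct R_CompleteNormedModule), @ex_RInt_continuous. intros t _.
        apply cont_mult; [apply continuous_legendre_weight, continuous_id|].
        pose proof (COS_bound t).
        apply cont_inv; [|apply pow_nonzero; lra].
        repeat cont_step. apply continuous_id.
    - rewrite neumann_integral by trivial. rewrite legQ_cosh by lra.
      pose proof (legendre_moment_base m (m + d) ltac:(lia)) as Mo.
      replace (m + d - m)%nat with d in Mo by lia. rewrite Mo.
      unfold binom_coef.
      replace (2 * INR m + 1) with (INR (2 * m) + 1) by (rewrite mult_INR; simpl; ring).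
      rewrite poch_fact.
      replace (2 * m + d)%nat with (m + d + m)%nat by lia.
      rewrite (pow_add 2 (m + d) 1). simpl (2 ^ 1).
      assert (S1 : (-1) ^ m * (-1) ^ m = 1)
        by (rewrite <- Rpow_mult_distr; replace (-1 * -1) with 1 by ring; apply pow1).
      pose proof (sinh_pos s ltac:(lra)) as Hsh.
      assert (0 < sinh s ^ m) by now apply pow_lt.
      assert (0 < cosh s ^ (m + d + m + 1)) by (apply pow_lt; lra).
      assert (0 < 2 ^ (m + d)) by (apply pow_lt; lra).
      pose proof (gamma_half_pos (m + d + 1)).
      set (sg := (-1) ^ m) in *.
      match goal with |- ?x = ?y => change (@eq R x y) end.
      transitivity (sg * sg * (/ INR (Factorial.fact m) *
        (/ cosh s ^ (m + d + m + 1) * (INR (Factorial.fact (m + d + m)) /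
          INR (Factorial.fact (2 * m)) / INR (Factorial.fact d) *
          (INR (Factorial.fact (m + d + m)) * sqrt PI / (2 ^ (m + d) * gamma_half (m + d + 1))) *
          gamma_half (m + d + 1)) * PSeries (Q_coef m (m + d)) (/ cosh s ^ 2))));
        [rewrite S1; ring|].
      field. repeat split; try apply INR_fact_neq_0; lra. }
  rewrite N in B. rewrite legendre_deriv_at_1_fact in A, B by trivial.
  assert (Aux : forall i0 i1 p q x k f : R, f <> 0 -> k <> 0 ->
    i0 * (f / k) = p * i1 -> i1 * (f / k) = q * x -> i0 = p * q * (k / f) ^ 2 * x).
  { intros i0 i1 p q x k f Hf Hk H0 H1.
    replace i0 with (i0 * (f / k) * (k / f)) by (field; split; trivial). rewrite H0.
    replace i1 with (i1 * (f / k) * (k / f)) by (field; split; trivial). rewrite H1. ring. }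
  refine (Aux _ _ _ _ _ _ _ _ _ A B); [apply INR_fact_neq_0|].
  repeat apply Rmult_integral_contrapositive_currified; try apply INR_fact_neq_0.
  apply pow_nonzero; lra.
Qed.

Lemma ferrersP_cos m n t : 0 <= t <= PI ->
  ferrersP m n (cos t) = (-1) ^ m * sin t ^ m * legendre_deriv n m (cos t).
Proof.
  intros Ht. unfold ferrersP. rewrite Derive_n_legendre, <- sin2_cos2'.
  rewrite sqrt_pow2; trivial. now apply sin_ge_0.
Qed.

Definition rhs_value (m n : nat) (s s' t' : R) : R :=
  2 * PI * (-1) ^ m * INR (Factorial.fact (n - m)) / INR (Factorial.fact (n + m))
    * sqrt (sinh s * sinh s' * sin t') * ferrersP m n (cos t')
    * legP m n (cosh s') * legQ m n (cosh s).

Lemma ker_integral_rhs m n s s' t' : (m <= n)%nat -> 0 < s' < s -> 0 < t' < PI ->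
  integral_const m s s' t' *
  RInt (fun t => legendre_weight m n t * ker m (cosh s') (cos t) (cos t') (cosh s)) 0 PI
  = rhs_value m n s s' t'.
Proof.
  intros Hmn Hs Ht. rewrite ker_integral_value by trivial.
  unfold integral_const, rhs_value. rewrite legP_cosh, ferrersP_cos by lra.
  rewrite gamma_half_fact.
  assert (P : PI = sqrt PI * sqrt PI) by (symmetry; apply sqrt_sqrt, Rlt_le, PI_RGT_0).
  rewrite P at 3. rewrite !Rpow_mult_distr.
  replace (4 ^ m) with (2 ^ m * 2 ^ m) by (rewrite <- Rpow_mult_distr; f_equal; ring).
  pose proof (sinh_pos s ltac:(lra)).
  assert (0 < sinh s ^ m) by (apply pow_lt; lra).
  assert (0 < 2 ^ m) by (apply pow_lt; lra).
  set (E := sqrt (sinh s * sinh s' * sin t')). set (sp := sqrt PI) in *.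
  set (sm := sinh s ^ m) in *. set (sm' := sinh s' ^ m) in *. set (tm := sin t' ^ m) in *.
  set (t2 := 2 ^ m) in *. set (sg := (-1) ^ m) in *. unfold Rdiv. rewrite !Rpow_mult_distr.
  field. repeat split; try apply INR_fact_neq_0; lra.
Qed.

Lemma legQhalf_G0 m z : legQhalf m z =
  sqrt PI * gamma_half m / (2 ^ m * sqrt 2 * (z ^ m * sqrt z)) * G0 m (/ z ^ 2).
Proof. reflexivity. Qed.

(** The powers of [sin t] collect as [1/2] from the root, [m] from the Ferrers function and
    [m + 1/2] from [chi]. The identity is algebraic, so it also holds at the singular point, where
    both sides contain the same value [G0 m 1]. *)
Lemma integrand_ker m n s s' t' t : 0 < s -> 0 < s' -> 0 < t' < PI -> 0 <= t <= PI ->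
  legQhalf m (chi s s' t t') * ferrersP m n (cos t) * sqrt (sin t) =
  integral_const m s s' t' *
  (legendre_weight m n t * ker m (cosh s') (cos t) (cos t') (cosh s)).
Proof.
  intros Hs Hs' Ht' Ht. rewrite ferrersP_cos by trivial.
  (* At the endpoints [chi] is a division by zero, but both sides carry a vanishing factor. *)
  destruct (Req_dec (sin t) 0) as [S0|S0].
  { unfold legendre_weight. rewrite S0, sqrt_0, (pow_i (2 * m + 1)) by lia. ring. }
  assert (St : 0 < sin t) by (pose proof (sin_ge_0 t (proj1 Ht) (proj2 Ht)); lra).
  assert (St' : 0 < sin t') by (apply sin_gt_0; lra).
  pose proof (sinh_pos s Hs). pose proof (sinh_pos s' Hs').
  set (E := sinh s * sinh s' * sin t').
  assert (HE : 0 < E) by (apply Rmult_lt_0_compat; [apply Rmult_lt_0_compat|]; trivial).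
  assert (HS : 2 * E * sin t <= Sq (cos t) (cos t') (cosh s) (cosh s')).
  { pose proof (Sq_factor_minus s s' t t') as F.
    assert (0 <= (cosh (s + s') - cos (t + t')) * (cosh (s - s') - cos (t - t'))).
    { pose proof (cosh_ge_1 (s + s')). pose proof (cosh_ge_1 (s - s')).
      pose proof (COS_bound (t + t')). pose proof (COS_bound (t - t')).
      apply Rmult_le_pos; lra. }
    rewrite <- F in *. unfold E. lra. }
  assert (Hker : ker m (cosh s') (cos t) (cos t') (cosh s) = ker m (cos t) (cos t') (cosh s) (cosh s'))
    by (symmetry; apply ker_rot).
  rewrite Hker. unfold ker, ker_arg. rewrite Pi4_trig.
  assert (Hchi : chi s s' t t' = Sq (cos t) (cos t') (cosh s) (cosh s') / (2 * E * sin t)).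
  { unfold chi. rewrite (sin2_cos2' t), (sin2_cos2' t'). unfold Sq, E. f_equal; ring. }
  rewrite Hchi. replace (2 * sinh s * sinh s' * sin t * sin t') with (2 * E * sin t)
    by (unfold E; ring).
  assert (HD : 0 < 2 * E * sin t) by (apply Rmult_lt_0_compat; lra).
  set (Q := Sq _ _ _ _) in *. clearbody Q.
  rewrite legQhalf_G0. unfold integral_const, legendre_weight, hpow. fold E.
  replace (/ (Q / (2 * E * sin t)) ^ 2) with ((2 * E * sin t) ^ 2 / Q ^ 2) by (field; lra).
  rewrite sqrt_div_alt by lra.
  rewrite (sqrt_mult (2 * E)), (sqrt_mult 2 E) by lra.
  unfold Rdiv at 1 2. rewrite (Rpow_mult_distr Q). rewrite pow_inv.
  rewrite (Rpow_mult_distr (2 * E)), (Rpow_mult_distr 2).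
  replace (2 * m + 1)%nat with (m + m + 1)%nat by lia. rewrite !pow_add.
  assert (E1 : sqrt (sin t) * sqrt (sin t) = sin t) by (apply sqrt_sqrt; lra).
  assert (0 < sqrt (sin t)) by now apply sqrt_lt_R0.
  assert (0 < sqrt E) by now apply sqrt_lt_R0.
  assert (0 < sqrt 2) by (apply sqrt_lt_R0; lra).
  assert (0 < sqrt Q) by (apply sqrt_lt_R0; lra).
  assert (0 < Q ^ m) by (apply pow_lt; lra).
  assert (0 < E ^ m) by (apply pow_lt; lra).
  assert (0 < 2 ^ m) by (apply pow_lt; lra).
  assert (0 < sin t ^ m) by (apply pow_lt; lra).
  simpl (sin t ^ 1).
  set (g := G0 m _). clearbody g.
  set (x1 := sqrt (sin t)) in *. set (x2 := sin t ^ m) in *.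
  set (L := legendre_deriv n m (cos t)). clearbody L.
  replace (sin t * 1) with (x1 * x1) by (rewrite E1; ring).
  clearbody x1 x2. field. repeat split; lra.
Qed.

(** * Estimates at the logarithmic singularity *)

(** With [y = |x| / 2 <= 2], [sin y >= y - y^3 / 6 >= y / 3]; then [1 - cos x = 2 sin^2 y] gives the
    constant [2 / 9 / 4 = 1 / 18]. *)
Lemma one_minus_cos_lower x : Rabs x <= PI -> x ^ 2 / 18 <= 1 - cos x.
Proof.
  intros Hx.
  set (y := Rabs x / 2). pose proof (Rabs_pos x). pose proof PI_4.
  assert (Ey : x ^ 2 = 4 * y ^ 2) by (unfold y; rewrite <- (pow2_abs x); field).
  assert (Ec : cos x = 1 - 2 * sin y * sin y).
  { rewrite <- cos_2a_sin. unfold y. replace (2 * (Rabs x / 2)) with (Rabs x) by field.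
    unfold Rabs. destruct (Rcase_abs x); [now rewrite cos_neg|easy]. }
  assert (B : y - y ^ 3 / 6 <= sin y).
  { destruct (sin_bound y 0 ltac:(unfold y; lra) ltac:(unfold y; lra)) as [L _].
    unfold sin_approx, sin_term in L. simpl in L. lra. }
  assert (Hy : 0 <= y <= 2) by (unfold y; lra).
  assert (B' : y / 3 <= sin y).
  { assert (0 <= y * (4 - y ^ 2)) by (apply Rmult_le_pos; nra). nra. }
  rewrite Ec, Ey. assert (y / 3 * (y / 3) <= sin y * sin y) by (apply Rmult_le_compat; lra). nra.
Qed.

Lemma cosh_le a b : 0 <= a <= b -> cosh a <= cosh b.
Proof.
  intros H. pose proof (cosh2_sinh2 a). pose proof (cosh2_sinh2 b).
  pose proof (cosh_ge_1 a). pose proof (cosh_ge_1 b).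
  assert (0 <= sinh a) by (destruct (Req_dec a 0) as [->|]; [rewrite sinh_0; lra|];
    apply Rlt_le, sinh_pos; lra).
  assert (sinh a <= sinh b) by (destruct (Req_dec a b) as [->|]; [lra|];
    apply Rlt_le, sinh_lt; lra).
  nra.
Qed.

Section SingularBound.
Variables (m n : nat) (s t' : R).
Hypotheses (Hs : 0 < s) (Ht' : 0 < t' < PI).

(** Keeps [cos (t + t')] away from 1 uniformly in [t], so that only the factor with the differences
    degenerates. *)
Let cos_sum_lt t : 0 <= t <= PI -> cos (t + t') <= Rabs (cos t').
Proof.
  intros Ht. destruct (Rle_dec (t + t') PI) as [H|H].
  - apply Rle_trans with (cos t'); [|apply Rle_abs].
    destruct (Req_dec t 0) as [->|]; [rewrite Rplus_0_l; lra|].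
    apply Rlt_le, cos_decreasing_1; lra.
  - apply Rle_trans with (- cos t'); [|rewrite <- Rabs_Ropp; apply Rle_abs].
    rewrite <- neg_cos.
    destruct (Req_dec t PI) as [->|]; [rewrite Rplus_comm; lra|].
    apply Rlt_le, cos_increasing_1; lra.
Qed.

Let abs_cos_lt : Rabs (cos t') < 1.
Proof.
  assert (0 < sin t') by (apply sin_gt_0; lra).
  pose proof (sin2_cos2' t'). apply Rabs_def1; nra.
Qed.

Lemma ker_singular_good s' t : 0 < s' -> 0 <= t <= PI -> t <> t' ->
  good (cosh s') (cos t) (cos t') (cosh s).
Proof.
  intros Hs' Ht Hne. apply good_rot.
  assert (1 < cosh (s + s')) by (apply cosh_gt_1; lra).
  pose proof (cosh_ge_1 (s - s')). pose proof (COS_bound (t + t')). pose proof (COS_bound (t - t')).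
  pose proof (cos_sum_lt t Ht). pose proof abs_cos_lt.
  apply good_trig; try lra.
  assert (0 < (t - t') ^ 2) by (rewrite <- Rsqr_pow2; apply Rsqr_pos_lt; lra).
  pose proof (one_minus_cos_lower (t - t') ltac:(apply Rabs_le; lra)). lra.
Qed.

(** With [D] the denominator of [chi], [1 - u = (S - D) (S + D) / S^2]. Uniformly in [s'], [S + D]
    stays away from 0 and [S - D] is at least a multiple of [(t - t')^2]; the growth bound on [G0]
    does the rest. *)
Lemma ker_dominated : exists C, 0 <= C /\ forall s' t, s / 2 <= s' <= s -> 0 <= t <= PI -> t <> t' ->
  Rabs (legendre_weight m n t * ker m (cosh s') (cos t) (cos t') (cosh s))
  <= C * / sqrt (sqrt ((t - t') ^ 2)).
Proof.
  destruct (G0_bound m) as [CG [HCG HG]].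
  destruct (continuous_bounded (legendre_weight m n) 0 PI) as [W HW].
  { pose proof PI_RGT_0; lra. }
  { intros t _. apply continuous_legendre_weight, continuous_id. }
  (* [k1] bounds the factors with [cosh (s + s')] from below, [c0] bounds [S + D] from below, [Sm]
     bounds [S] from above, and [c2] is the resulting constant in [1 - u >= c2 (t - t')^2]. *)
  set (k1 := cosh s - 1). assert (Hk1 : 0 < k1) by (pose proof (cosh_gt_1 s); unfold k1; lra).
  set (c0 := k1 * (1 - Rabs (cos t'))).
  assert (Hc0 : 0 < c0) by (apply Rmult_lt_0_compat; [|pose proof abs_cos_lt]; lra).
  set (Sm := 4 * cosh s ^ 2). assert (HSm : 0 < Sm) by (unfold Sm, k1 in *; nra).
  set (c2 := k1 * c0 / (18 * Sm ^ 2)).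
  assert (Hc2 : 0 < c2) by (apply Rdiv_lt_0_compat; nra).
  assert (HW0 : 0 <= W) by (eapply Rle_trans; [apply Rabs_pos|apply (HW 0); pose proof PI_RGT_0; lra]).
  assert (Hpm : 0 < (c0 / 2) ^ m) by (apply pow_lt; lra).
  assert (Hsm : 0 < sqrt (c0 / 2)) by (apply sqrt_lt_R0; lra).
  assert (Hr : 0 < Rpower c2 (/4)) by apply exp_pos.
  set (C := W * (CG / Rpower c2 (/4) * / ((c0 / 2) ^ m * sqrt (c0 / 2)))).
  exists C. split.
  { unfold C. apply Rmult_le_pos; [trivial|]. apply Rmult_le_pos.
    - apply Rlt_le, Rdiv_lt_0_compat; lra.
    - apply Rlt_le, Rinv_0_lt_compat; nra. }
  intros s' t Hs' Ht Hne.
  pose proof (ker_singular_good s' t ltac:(lra) Ht Hne) as Hgood.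
  assert (Hker : ker m (cosh s') (cos t) (cos t') (cosh s) = ker m (cos t) (cos t') (cosh s) (cosh s'))
    by (symmetry; apply ker_rot).
  rewrite Hker.
  set (S := Sq (cos t) (cos t') (cosh s) (cosh s')).
  set (D := 2 * sinh s * sinh s' * sin t * sin t').
  pose proof (Sq_factor_minus s s' t t') as Fm. pose proof (Sq_factor_plus s s' t t') as Fp.
  fold S D in Fm, Fp.
  assert (Hk : cosh s <= cosh (s + s')) by (apply cosh_le; lra).
  pose proof (cosh_ge_1 (s - s')). pose proof (COS_bound (t + t')). pose proof (COS_bound (t - t')).
  pose proof (cos_sum_lt t Ht) as Hcs. pose proof abs_cos_lt as Hac.
  assert (Hx : (t - t') ^ 2 / 18 <= 1 - cos (t - t')).
  { apply one_minus_cos_lower. apply Rabs_le; lra. }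
  assert (Hx0 : 0 < (t - t') ^ 2) by (rewrite <- Rsqr_pow2; apply Rsqr_pos_lt; lra).
  set (x2 := (t - t') ^ 2) in *. clearbody x2.
  assert (Bm : k1 * (x2 / 18) <= S - D).
  { rewrite Fm. pose proof (cosh_ge_1 s). apply Rmult_le_compat; unfold k1; lra. }
  assert (Bp : c0 <= S + D).
  { rewrite Fp. unfold c0. apply Rmult_le_compat; unfold k1 in *; lra. }
  assert (BS : c0 / 2 <= S) by nra.
  assert (BSm : S <= Sm).
  { unfold S, Sm, Sq. assert (1 <= cosh s' <= cosh s)
      by (split; [apply cosh_ge_1|apply cosh_le; lra]).
    pose proof (COS_bound t). pose proof (COS_bound t').
    assert (cos t ^ 2 <= 1) by nra. assert (cos t' ^ 2 <= 1) by nra.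
    assert (cosh s' ^ 2 <= cosh s ^ 2) by nra.
    assert (P1 : - 1 <= cos t * cos t' <= 1) by (split; nra).
    assert (P2 : 0 <= cosh s * cosh s' <= cosh s ^ 2) by (split; nra).
    assert (- (cos t * cos t') * (cosh s * cosh s') <= cosh s ^ 2) by nra. nra. }
  assert (Hu : ker_arg (cos t) (cos t') (cosh s) (cosh s') = D ^ 2 / S ^ 2)
    by (unfold ker_arg; now rewrite Pi4_trig).
  assert (HS0 : 0 < S) by lra.
  assert (Hu0 : 0 <= D ^ 2 / S ^ 2).
  { apply Rmult_le_pos; [apply pow2_ge_0|]. apply Rlt_le, Rinv_0_lt_compat; nra. }
  assert (Hlow : c2 * x2 <= 1 - D ^ 2 / S ^ 2).
  { replace (1 - D ^ 2 / S ^ 2) with ((S - D) * (S + D) * / S ^ 2) by (field; lra).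
    replace (c2 * x2) with (k1 * (x2 / 18) * c0 * / Sm ^ 2) by (unfold c2; field; lra).
    assert (k1 * (x2 / 18) * c0 <= (S - D) * (S + D)) by (apply Rmult_le_compat; nra).
    assert (/ Sm ^ 2 <= / S ^ 2) by (apply Rinv_le_contravar; nra).
    apply Rmult_le_compat; trivial; [|apply Rlt_le, Rinv_0_lt_compat; nra].
    apply Rmult_le_pos; [apply Rmult_le_pos; lra|lra]. }
  assert (Hc2x : 0 < c2 * x2) by now apply Rmult_lt_0_compat.
  destruct (HG (D ^ 2 / S ^ 2) ltac:(lra)) as [G0p G0b].
  assert (HP : Rpower c2 (/4) * sqrt (sqrt x2) <= Rpower (1 - D ^ 2 / S ^ 2) (/4)).
  { replace (sqrt (sqrt x2)) with (Rpower x2 (/4)).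
    - rewrite Rpower_mult_distr by trivial. apply Rle_Rpower_l; lra.
    - rewrite <- (Rpower_sqrt x2), <- Rpower_sqrt by (trivial; apply exp_pos).
      rewrite Rpower_mult. f_equal. field. }
  assert (Hq : 0 < sqrt (sqrt x2)) by now apply sqrt_lt_R0, sqrt_lt_R0.
  set (q := sqrt (sqrt x2)) in *.
  rewrite Rabs_mult. unfold C. rewrite Rmult_assoc.
  apply Rmult_le_compat; try apply Rabs_pos; [now apply HW|].
  unfold ker. fold S. rewrite Hu.
  assert (Hh : 0 < hpow m S <= / ((c0 / 2) ^ m * sqrt (c0 / 2))).
  { unfold hpow. assert (0 < S ^ m) by now apply pow_lt.
    assert (0 < sqrt S) by now apply sqrt_lt_R0.
    split; [apply Rinv_0_lt_compat; nra|].
    apply Rinv_le_contravar; [nra|].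
    apply Rmult_le_compat; try lra; [apply pow_incr; lra|apply sqrt_le_1_alt; lra]. }
  rewrite Rabs_pos_eq by (apply Rmult_le_pos; lra).
  assert (HGq : G0 m (D ^ 2 / S ^ 2) <= CG / Rpower c2 (/4) * / q).
  { apply (Rmult_le_reg_r (Rpower c2 (/4) * q)); [nra|].
    replace (CG / Rpower c2 (/4) * / q * (Rpower c2 (/4) * q)) with CG by (field; lra).
    eapply Rle_trans; [|exact G0b]. apply Rmult_le_compat_l; lra. }
  replace (CG / Rpower c2 (/ 4) * / ((c0 / 2) ^ m * sqrt (c0 / 2)) * / q)
    with (CG / Rpower c2 (/ 4) * / q * / ((c0 / 2) ^ m * sqrt (c0 / 2))) by ring.
  apply Rmult_le_compat; lra.
Qed.

Definition approach (N : nat) : R := s - s / 2 * / (INR N + 1).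

Lemma approach_bounds N : s / 2 <= approach N < s.
Proof.
  unfold approach. pose proof (pos_INR N).
  assert (0 < / (INR N + 1) <= 1).
  { split; [apply Rinv_0_lt_compat; lra|]. rewrite <- Rinv_1. apply Rinv_le_contravar; lra. }
  nra.
Qed.

Lemma is_lim_approach : is_lim_seq approach s.
Proof.
  unfold approach. replace (Finite s) with (Finite (s - s / 2 * 0)) by (f_equal; ring).
  apply is_lim_seq_minus'; [apply is_lim_seq_const|].
  apply (is_lim_seq_scal_l _ (s / 2) 0).
  replace (Finite 0) with (Rbar_inv p_infty) by reflexivity.
  apply is_lim_seq_inv; [|easy].
  eapply is_lim_seq_plus; [apply is_lim_seq_INR|apply is_lim_seq_const|reflexivity].
Qed.

Let is_lim_approach_comp (f : R -> R) : continuous f s -> is_lim_seq (fun N => f (approach N)) (f s).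
Proof.
  intros Hf. apply is_lim_seq_continuous; [now apply continuity_pt_filterlim|apply is_lim_approach].
Qed.

Let continuous_cosh_s : continuous cosh s.
Proof. apply @ex_derive_continuous. eexists. apply is_derive_Reals, derivable_pt_lim_cosh. Qed.
Let continuous_sinh_s : continuous sinh s.
Proof. apply @ex_derive_continuous. eexists. apply is_derive_Reals, derivable_pt_lim_sinh. Qed.

Let continuous_E : continuous (fun s' => sinh s * sinh s' * sin t') s.
Proof. repeat cont_step. apply continuous_sinh_s. Qed.

Lemma is_lim_integrand t : 0 <= t <= PI -> t <> t' ->
  is_lim_seq (fun N => integral_const m s (approach N) t' *
    (legendre_weight m n t * ker m (cosh (approach N)) (cos t) (cos t') (cosh s)))
  (integral_const m s s t' *
    (legendre_weight m n t * ker m (cosh s) (cos t) (cos t') (cosh s))).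
Proof.
  intros Ht Hne.
  apply (is_lim_approach_comp (fun s' => integral_const m s s' t' *
    (legendre_weight m n t * ker m (cosh s') (cos t) (cos t') (cosh s)))).
  unfold integral_const.
  apply cont_mult; apply cont_mult.
  - apply continuous_const.
  - apply cont_mult; [apply cont_pow|apply cont_sqrt]; apply continuous_E.
  - apply continuous_const.
  - apply continuous_ker; [apply continuous_cosh_s|apply continuous_const ..|].
    now apply ker_singular_good.
Qed.

Lemma is_lim_rhs_value :
  is_lim_seq (fun N => rhs_value m n s (approach N) t') (rhs_value m n s s t').
Proof.
  unfold rhs_value. rewrite (legP_cosh m n s) by trivial.
  apply (is_lim_seq_ext (fun N => 2 * PI * (-1) ^ m * INR (Factorial.fact (n - m))
    / INR (Factorial.fact (n + m)) * sqrt (sinh s * sinh (approach N) * sin t')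
    * ferrersP m n (cos t')
    * (sinh (approach N) ^ m * legendre_deriv n m (cosh (approach N))) * legQ m n (cosh s))).
  { intros N. rewrite legP_cosh; trivial. pose proof (approach_bounds N); lra. }
  apply (is_lim_approach_comp (fun s' => 2 * PI * (-1) ^ m * INR (Factorial.fact (n - m))
    / INR (Factorial.fact (n + m)) * sqrt (sinh s * sinh s' * sin t')
    * ferrersP m n (cos t')
    * (sinh s' ^ m * legendre_deriv n m (cosh s')) * legQ m n (cosh s))).
  apply cont_mult; [|apply continuous_const]. apply cont_mult.
  - apply cont_mult; [|apply continuous_const]. apply cont_mult; [apply continuous_const|].
    apply cont_sqrt, continuous_E.
  - apply cont_mult; [apply cont_pow, continuous_sinh_s|].
    apply continuous_legendre_deriv, continuous_cosh_s.
Qed.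

Lemma integral_const_bounded :
  exists K, forall N, Rabs (integral_const m s (approach N) t') <= K.
Proof.
  destruct (filterlim_bounded (fun N => integral_const m s (approach N) t')) as [K HK].
  - exists (integral_const m s s t').
    apply (is_lim_approach_comp (fun s' => integral_const m s s' t')).
    unfold integral_const. apply cont_mult; [apply continuous_const|].
    apply cont_mult; [apply cont_pow|apply cont_sqrt]; apply continuous_E.
  - exists K. exact HK.
Qed.
End SingularBound.

(** A continuous approximation from below to [|x|^(-1/2)], increasing as [e] decreases to 0. *)
Definition sing_reg (e x : R) : R := / sqrt (sqrt (x ^ 2 + e)).

Lemma continuous_sing_reg e t' t : 0 < e -> continuous (fun t => sing_reg e (t - t')) t.
Proof.
  intros He. unfold sing_reg. pose proof (pow2_ge_0 (t - t')).
  apply cont_inv.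
  - apply cont_sqrt, cont_sqrt. repeat cont_step. apply continuous_id.
  - apply Rgt_not_eq, sqrt_lt_R0, sqrt_lt_R0. lra.
Qed.

(* [sing_reg e] is at most twice the derivative of [x sing_reg e x], which is bounded uniformly in [e]. *)
Lemma RInt_sing_reg e t' : 0 < e -> 0 <= t' <= PI ->
  RInt (fun t => sing_reg e (t - t')) 0 PI <= 8.
Proof.
  intros He Ht'. pose proof PI_RGT_0 as HPI.
  pose (A := fun t => 2 * ((t - t') * sing_reg e (t - t'))).
  pose (dA := fun t => 2 * (((t - t') ^ 2 / 2 + e) / ((t - t') ^ 2 + e)) * sing_reg e (t - t')).
  assert (P : forall t, 0 < (t - t') ^ 2 + e) by (intros t; pose proof (pow2_ge_0 (t - t')); lra).
  assert (IA : is_RInt dA 0 PI (minus (A PI) (A 0))).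
  { apply (is_RInt_derive A dA).
    - intros t _. unfold A, dA, sing_reg. specialize (P t).
      assert (Q1 := sqrt_lt_R0 _ P). assert (Q2 := sqrt_lt_R0 _ Q1).
      assert (E1 := sqrt_sqrt _ (Rlt_le _ _ P)). assert (E2 := sqrt_sqrt _ (Rlt_le _ _ Q1)).
      auto_derive.
      + replace ((t + - t') * ((t + - t') * 1) + e) with ((t - t') ^ 2 + e) by ring.
        repeat split; trivial. lra.
      + replace ((t + - t') * ((t + - t') * 1) + e) with ((t - t') ^ 2 + e) by ring.
        set (r := sqrt (sqrt ((t - t') ^ 2 + e))) in *.
        set (r2 := sqrt ((t - t') ^ 2 + e)) in *.
        replace (t + - t') with (t - t') by ring.
        assert (Ee : e = r2 * r2 - (t - t') ^ 2) by lra.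
        clearbody r r2. rewrite Ee. rewrite <- E2. field. nra.
    - intros t _. unfold dA. pose proof (P t).
      apply cont_mult; [|now apply continuous_sing_reg].
      repeat cont_step; try apply continuous_id; lra. }
  assert (IS : ex_RInt (fun t => sing_reg e (t - t')) 0 PI)
    by (apply @ex_RInt_continuous; intros; now apply continuous_sing_reg).
  assert (Pos : forall t, 0 < sing_reg e (t - t')).
  { intros t. apply Rinv_0_lt_compat, sqrt_lt_R0, sqrt_lt_R0, P. }
  apply Rle_trans with (RInt dA 0 PI).
  { apply RInt_le; trivial; [lra|eexists; exact IA|].
    intros t _. unfold dA. specialize (P t).
    assert (1 <= 2 * (((t - t') ^ 2 / 2 + e) / ((t - t') ^ 2 + e))).
    { apply (Rmult_le_reg_r ((t - t') ^ 2 + e)); trivial.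
      replace (2 * (((t - t') ^ 2 / 2 + e) / ((t - t') ^ 2 + e)) * ((t - t') ^ 2 + e))
        with ((t - t') ^ 2 + 2 * e) by (field; lra). lra. }
    specialize (Pos t). nra. }
  rewrite (@is_RInt_unique R_CompleteNormedModule _ _ _ _ IA).
  (* The product is at most [sqrt |t - t'|], and [PI <= 4]. Since [A] is twice the product, its two
     boundary values differ by at most 8. *)
  assert (B : forall t, Rabs (t - t') <= 4 -> Rabs ((t - t') * sing_reg e (t - t')) <= 2).
  { intros t Ht. rewrite Rabs_mult, (Rabs_pos_eq (sing_reg _ _)) by apply Rlt_le, Pos.
    unfold sing_reg. specialize (P t).
    assert (Q1 := sqrt_lt_R0 _ P). assert (Q2 := sqrt_lt_R0 _ Q1).
    assert (E1 := sqrt_sqrt _ (Rlt_le _ _ P)). assert (E2 := sqrt_sqrt _ (Rlt_le _ _ Q1)).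
    set (r := sqrt (sqrt ((t - t') ^ 2 + e))) in *. set (r2 := sqrt ((t - t') ^ 2 + e)) in *.
    apply (Rmult_le_reg_r r); trivial. rewrite Rmult_assoc, Rinv_l, Rmult_1_r by lra.
    rewrite <- pow2_abs in E1. set (x := Rabs (t - t')) in *.
    assert (0 <= x) by apply Rabs_pos.
    assert (x <= r2) by (apply Rsqr_incr_0_var; unfold Rsqr; nra).
    apply Rsqr_incr_0_var; unfold Rsqr; nra. }
  pose proof PI_4.
  assert (B1 := B PI ltac:(apply Rabs_le; lra)). assert (B2 := B 0 ltac:(apply Rabs_le; lra)).
  apply Rabs_le_between in B1, B2. unfold A, minus, plus, opp; simpl. lra.
Qed.

Definition integrand (m n : nat) (s s' t' t : R) : R :=
  integral_const m s s' t' *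
  (legendre_weight m n t * ker m (cosh s') (cos t) (cos t') (cosh s)).

Lemma integrand_continuous m n s s' t' t : 0 < s' < s -> continuous (integrand m n s s' t') t.
Proof.
  intros Hs. apply cont_mult; [apply continuous_const|].
  apply cont_mult; [apply continuous_legendre_weight, continuous_id|].
  apply continuous_ker; [apply continuous_const|apply continuous_cos|apply continuous_const ..|].
  apply good_rot, good_trig_neq; lra.
Qed.

Lemma RInt_integrand m n s s' t' : (m <= n)%nat -> 0 < s' < s -> 0 < t' < PI ->
  RInt (integrand m n s s' t') 0 PI = rhs_value m n s s' t'.
Proof.
  intros Hmn Hs Ht. rewrite <- ker_integral_rhs by trivial.
  apply (@is_RInt_unique R_CompleteNormedModule).
  apply (is_RInt_scal (fun t => legendre_weight m n t * ker m (cosh s') (cos t) (cos t') (cosh s))).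
  apply (@RInt_correct R_CompleteNormedModule), @ex_RInt_continuous. intros t _.
  apply cont_mult; [apply continuous_legendre_weight, continuous_id|].
  apply continuous_ker; [apply continuous_const|apply continuous_cos|apply continuous_const ..|].
  apply good_rot, good_trig_neq; lra.
Qed.

Lemma derivable_pt_lim_RInt (f : R -> R) a x : (forall t, continuous f t) ->
  derivable_pt_lim (fun x => RInt f a x) x (f x).
Proof.
  intros Hf. apply is_derive_Reals.
  apply (is_derive_RInt f (fun x => RInt f a x) a x); [|apply Hf].
  exists (mkposreal 1 Rlt_0_1). intros y _.
  apply (@RInt_correct R_CompleteNormedModule), @ex_RInt_continuous. intros; apply Hf.
Qed.

Lemma integrand_dominated m n s t' : 0 < s -> 0 < t' < PI ->
  exists C, 0 <= C /\ forall N t, 0 <= t <= PI -> t <> t' ->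
    Rabs (integrand m n s (approach s N) t' t) <= C * / sqrt (sqrt ((t - t') ^ 2)).
Proof.
  intros Hs Ht. destruct (ker_dominated m n s t' Hs Ht) as [C [HC H]].
  destruct (integral_const_bounded m s t' Ht) as [K HK].
  assert (0 <= K) by (eapply Rle_trans; [apply Rabs_pos|apply (HK O)]).
  exists (K * C). split; [now apply Rmult_le_pos|]. intros N t Htt Hne.
  unfold integrand. rewrite Rabs_mult, Rmult_assoc.
  pose proof (approach_bounds s Hs N).
  apply Rmult_le_compat; try apply Rabs_pos; [apply HK|apply H; trivial; lra].
Qed.

Lemma sing_reg_pos e x : 0 < e -> 0 < sing_reg e x.
Proof.
  intros He. pose proof (pow2_ge_0 x).
  apply Rinv_0_lt_compat, sqrt_lt_R0, sqrt_lt_R0. lra.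
Qed.

Lemma sing_reg_antitone e e' x : 0 < e' <= e -> sing_reg e x <= sing_reg e' x.
Proof.
  intros He. pose proof (pow2_ge_0 x). apply Rinv_le_contravar.
  - apply sqrt_lt_R0, sqrt_lt_R0. lra.
  - apply sqrt_le_1_alt, sqrt_le_1_alt. lra.
Qed.

Lemma sing_reg_lim x : x <> 0 ->
  Un_cv (fun N => sing_reg (/ (INR N + 1)) x) (/ sqrt (sqrt (x ^ 2))).
Proof.
  intros Hx. apply is_lim_seq_Reals.
  assert (0 < x ^ 2) by (rewrite <- Rsqr_pow2; now apply Rsqr_pos_lt).
  replace (/ sqrt (sqrt (x ^ 2))) with (sing_reg 0 x)
    by (unfold sing_reg; now rewrite Rplus_0_r).
  apply (is_lim_seq_continuous (fun e => sing_reg e x)).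
  - apply continuity_pt_filterlim. unfold sing_reg.
    apply (cont_inv (fun e => sqrt (sqrt (x ^ 2 + e)))).
    + apply cont_sqrt, cont_sqrt. apply (cont_plus (fun _ => x ^ 2) (fun e => e));
        [apply continuous_const|apply continuous_id].
    + apply Rgt_not_eq, Rlt_gt, sqrt_lt_R0, sqrt_lt_R0. lra.
  - replace (Finite 0) with (Rbar_inv p_infty) by reflexivity.
    apply is_lim_seq_inv; [|easy].
    eapply is_lim_seq_plus; [apply is_lim_seq_INR|apply is_lim_seq_const|reflexivity].
Qed.

Lemma chi_sym s s' t t' : chi s s' t t' = chi s' s t t'.
Proof. unfold chi. f_equal; ring. Qed.

(** * Lebesgue integration *)

From mathcomp Require Import all_boot all_order all_algebra.
From mathcomp Require Import all_classical all_reals all_analysis measurable_realfun.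
From mathcomp Require Import Rstruct Rstruct_topology.
Import Order.TTheory GRing.Theory Num.Theory numFieldNormedType.Exports.

Section LebesgueFTC.
Local Open Scope classical_set_scope.
Local Open Scope ring_scope.
Context (R : realType).
Local Notation mu := (@lebesgue_measure R).

Lemma derive1_epsP (f : R -> R) (x l : R) :
  (forall e, 0 < e -> exists2 d, 0 < d &
     forall h, h != 0 -> `|h| < d -> `|(f (x + h) - f x) / h - l| < e) ->
  derivable f x 1 /\ derive1 f x = l.
Proof.
move=> H.
have C : (fun h : R => h^-1 *: (f (h + x) - f x)) @ 0^' --> l.
  apply/cvgrPdist_lt => e /H[d d0 Hd].
  near=> h.
  have h0 : h != 0 by near: h; exact: nbhs_dnbhs_neq.
  have hd : `|h| < d by near: h; apply: dnbhs0_lt.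
  by rewrite distrC [h^-1 *: _]mulrC (addrC h); exact: Hd.
split; last exact: cvg_lim C.
apply/cvg_ex; exists l.
rewrite (_ : (fun h : R => h^-1 *: ((f \o shift x) (h *: 1) - f x)) =
  (fun h : R => h^-1 *: (f (h + x) - f x)))//.
by apply/funext => h /=; rewrite [h *: 1]mulr1.
Unshelve. all: by end_near. Qed.

(** The derivative is given by an epsilon-delta condition on difference quotients, the form in which
    it can be handed over from [derivable_pt_lim] without comparing two notions of derivative. *)
Lemma integral_primitive (f F : R -> R) (a b : R) : a < b -> continuous f ->
  (forall x e, 0 < e -> exists2 d, 0 < d &
     forall h, h != 0 -> `|h| < d -> `|(F (x + h) - F x) / h - f x| < e) ->
  mu.-integrable `[a, b] (EFin \o f) /\
  (\int[mu]_(x in `[a, b]) (f x)%:E = (F b - F a)%:E)%E.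
Proof.
move=> ab cf dF.
have dF' x : derivable F x 1 /\ derive1 F x = f x by apply: derive1_epsP; exact: dF.
have cf' : {within `[a, b], continuous f} by exact: continuous_subspaceT.
have cF x : F y @[y --> x] --> F x.
  by apply/differentiable_continuous; rewrite -derivable1_diffP; have [] := dF' x.
split.
  by apply: continuous_compact_integrable => //; exact: segment_compact.
rewrite EFinB; apply: (@continuous_FTC2 _ f F) => //.
- split; [by move=> x _; have [] := dF' x | exact/cvg_at_right_filter/cF
         | exact/cvg_at_left_filter/cF].
- by move=> x _; have [] := dF' x.
Qed.

Let D (a b c : R) : set R := `[a, b] `\ c.

Let measurable_D a b c : measurable (D a b c).
Proof. by apply: measurableD => //; exact: measurable_itv. Qed.

Let measurable_cont (f : R -> R) (A : set R) : continuous f ->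
  measurable_fun A (EFin \o f).
Proof.
move=> cf; apply: measurable_funTS; apply/measurable_EFinP.
by apply: continuous_measurable_fun.
Qed.

(** Monotone convergence bounds the integral of the limit by [K]. The point [c] is removed, since
    the approximations may diverge there, and this changes no integral. *)
Lemma monotone_limit_integrable (h_ : nat -> R -> R) (h : R -> R) (a b c K : R) :
  (forall n, continuous (h_ n)) -> (forall n x, 0 <= h_ n x) ->
  (forall n m x, (n <= m)%N -> h_ n x <= h_ m x) ->
  (forall x, x != c -> h_ ^~ x @ \oo --> h x) ->
  (forall n, \int[mu]_(x in `[a, b]) (h_ n x)%:E <= K%:E)%E ->
  mu.-integrable (D a b c) (EFin \o h).
Proof.
move=> ch h0 ndh hh hK.
have mh_ n : measurable_fun (D a b c) (EFin \o h_ n) by exact: measurable_cont.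
have hcvg x : D a b c x -> (EFin \o h_ ^~ x) @ \oo --> (h x)%:E.
  by case=> _ /= /eqP xc; apply: cvg_EFin; [exact: nearW|exact: hh].
have mh : measurable_fun (D a b c) (EFin \o h).
  exact: (emeasurable_fun_cvg (fun n => EFin \o h_ n)).
have hge0 x : D a b c x -> 0 <= h x.
  move=> [_ /= /eqP xc]; rewrite -(cvg_lim _ (hh x xc))//.
  apply: limr_ge; first by apply/cvg_ex; exists (h x); exact: hh.
  exact: nearW.
apply/integrableP; split => //.
have -> : (\int[mu]_(x in D a b c) `|(EFin \o h) x| =
    \int[mu]_(x in D a b c) limn (fun n => (h_ n x)%:E))%E.
  apply: eq_integral => x; rewrite inE => Dx.
  by rewrite gee0_abs ?lee_fin ?hge0//; apply/esym/cvg_lim => //; exact: hcvg.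
rewrite (@monotone_convergence _ _ _ mu (D a b c) (measurable_D a b c)
  (fun n => EFin \o h_ n))//; last 2 first.
- by move=> n x _; rewrite /= lee_fin.
- by move=> x _ n m nm; rewrite /= lee_fin; exact: ndh.
apply: (@le_lt_trans _ _ K%:E); last exact: ltry.
apply: lime_le.
  apply: ereal_nondecreasing_is_cvgn => n m nm.
  apply: (@ge0_le_integral _ _ _ mu _ (measurable_D a b c) (EFin \o h_ n) (EFin \o h_ m)).
  - by move=> x _; rewrite lee_fin.
  - exact: mh_.
  - exact: mh_.
  - by move=> x _; rewrite lee_fin; exact: ndh.
apply: nearW => n; apply: le_trans (hK n).
by rewrite (@integral_setD1 R (EFin \o h_ n) c `[a, b] (measurable_D a b c) (mh_ n)).
Qed.

(** Dominated convergence is applied off [c], where convergence and the majorant are available; the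
    null set [c] is then put back on both sides. *)
Lemma dominated_punctured (f_ : nat -> R -> R) (f g : R -> R) (v_ : nat -> R) (v a b c : R) :
  (forall n, continuous (f_ n)) ->
  (forall x, a <= x <= b -> x != c -> f_ ^~ x @ \oo --> f x) ->
  mu.-integrable (D a b c) (EFin \o g) ->
  (forall n x, a <= x <= b -> x != c -> `|f_ n x| <= g x) ->
  (forall n, \int[mu]_(x in `[a, b]) (f_ n x)%:E = (v_ n)%:E)%E ->
  v_ @ \oo --> v ->
  mu.-integrable `[a, b] (EFin \o f) /\ (\int[mu]_(x in `[a, b]) (f x)%:E = v%:E)%E.
Proof.
move=> cf ff ig fg fv vv.
have mf_ n : measurable_fun (D a b c) (EFin \o f_ n) by exact: measurable_cont.
have Dab x : D a b c x -> a <= x <= b /\ x != c.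
  by move=> [/= + /eqP xc]; rewrite in_itv/= => xab; split.
have fcvg x : D a b c x -> (EFin \o f_ ^~ x) @ \oo --> (f x)%:E.
  by move=> /Dab[xab xc]; apply: cvg_EFin; [exact: nearW|exact: ff].
have mf : measurable_fun (D a b c) (EFin \o f).
  exact: (emeasurable_fun_cvg (fun n => EFin \o f_ n)).
have dom n x : D a b c x -> (`|(f_ n x)%:E| <= (g x)%:E)%E.
  by move=> /Dab[xab xc]; rewrite lee_fin; exact: fg.
have [iff _ cvg_int] : [/\ mu.-integrable (D a b c) (EFin \o f),
    [sequence \int[mu]_(x in D a b c) `|(f_ n x)%:E - (f x)%:E|]_n @ \oo --> 0 &
    [sequence \int[mu]_(x in D a b c) (f_ n x)%:E]_n @ \oo -->
      \int[mu]_(x in D a b c) (f x)%:E]%E.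
  apply: (@dominated_convergence _ _ _ mu (D a b c) (measurable_D a b c)
    (fun n => EFin \o f_ n) (EFin \o f) (EFin \o g)) => //.
  - by apply: aeW => x; exact: fcvg.
  - by apply: aeW => x n; exact: dom.
have int_eq : (\int[mu]_(x in `[a, b]) (f x)%:E = \int[mu]_(x in D a b c) (f x)%:E)%E.
  by rewrite -(@integral_setD1 R (EFin \o f) c `[a, b] (measurable_D a b c) mf).
split.
  apply/integrableP; split.
    (* Measurability on the full interval: nothing is assumed about [f c], but every function is
       measurable on a singleton. *)
    have [cab|cab] := pselect (`[a, b]%classic c); last by rewrite -(not_setD1 cab).
    rewrite -(setD1K cab); apply/measurable_funU => //; first exact: measurable_D.
    by split => //; exact: measurable_fun_set1.
  rewrite -(@integral_setD1 R (abse \o (EFin \o f)) c `[a, b] (measurable_D a b c)).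
    by have /integrableP[] := iff.
  exact: measurableT_comp.
rewrite int_eq; apply: (cvg_unique _ cvg_int) => //=.
rewrite (_ : (fun n => _) = EFin \o v_); first by apply: cvg_EFin => //; exact: nearW.
apply/funext => n /=; rewrite -fv.
exact: (@integral_setD1 R (EFin \o f_ n) c `[a, b] (measurable_D a b c) (mf_ n)).
Qed.
End LebesgueFTC.

From Stdlib Require Import Reals Lra.
From Coquelicot Require Import Coquelicot.

(** * Transfer from the Riemann to the Lebesgue integral *)

Lemma lebesgue_integral_RInt (f : R -> R) (a b : R) : (a < b)%R ->
  (forall t, continuous f t) ->
  (@lebesgue_measure R).-integrable `[a, b] (EFin \o f) /\
  (\int[@lebesgue_measure R]_(t in `[a, b]) (f t)%:E)%E = (RInt f a b)%:E.
Proof.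
move=> /RltP ab cf.
have cf' : forall x : R, continuous_at x f.
  by move=> x; apply/continuity_pt_cvg; exact/continuity_pt_filterlim/cf.
have [H1 H2] := @integral_primitive R f (fun x => RInt f a x) a b ab cf'
  (fun x e e0 => ltac:(
    have /RltP e0' := e0;
    have [d Hd] := derivable_pt_lim_RInt f a x cf e e0';
    exists (RIneq.pos d); [by apply/RltP; exact: RIneq.cond_pos|
    by move=> h /eqP h0; rewrite -RabsE => /RltP hd; rewrite -RabsE; apply/RltP; exact: Hd])).
split => //; rewrite H2; congr EFin.
by rewrite RInt_point; change (Rminus (RInt f a b) 0 = RInt f a b); rewrite Rminus_0_r.
Qed.

Lemma Un_cv_cvg (u : nat -> R) (l : R) : Un_cv u l -> (u @ \oo --> l)%classic.
Proof.
move=> H; apply/cvg_ballP => e /RltP /H[N HN].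
exists N => // n /= /ssrnat.leP Nn.
by have /RltP := HN n Nn; rewrite Rdist_sym RdistE.
Qed.

Lemma dominated_sqrt_singularity (f_ : nat -> R -> R) (f : R -> R) (v_ : nat -> R) (v c C : R) :
  (0 <= c <= PI)%R -> (0 <= C)%R ->
  (forall N t, continuous (f_ N) t) ->
  (forall t, (0 <= t <= PI)%R -> t <> c -> Un_cv (fun N => f_ N t) (f t)) ->
  (forall N t, (0 <= t <= PI)%R -> t <> c -> (Rabs (f_ N t) <= C * / sqrt (sqrt ((t - c) ^ 2)))%R) ->
  (forall N, RInt (f_ N) 0 PI = v_ N) -> Un_cv v_ v ->
  (@lebesgue_measure R).-integrable `[0%R, PI] (EFin \o f) /\
  (\int[@lebesgue_measure R]_(t in `[0%R, PI]) (f t)%:E)%E = v%:E.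
Proof.
move=> c0 C0 cf ff fg fv vv.
have PI0 : (0 < PI)%R by exact: PI_RGT_0.
have cR (h : R -> R) : (forall t, continuous h t) -> forall x : R, continuous_at x h.
  by move=> ch x; apply/continuity_pt_cvg; exact/continuity_pt_filterlim/ch.
(* Decreasing parameters make the functions [h_ N] nondecreasing in [N], as monotone convergence
   requires; their integrals are bounded by [C * 8]. *)
pose e N := (/ (INR N + 1))%R.
have e0 N : (0 < e N)%R by apply: Rinv_0_lt_compat; have := pos_INR N; lra.
pose h_ N t := (C * sing_reg (e N) (t - c))%R.
have ch N t : continuous (h_ N) t.
  by apply: cont_mult; [exact: continuous_const|exact: continuous_sing_reg].
have ig := @monotone_limit_integrable R h_ (fun t => (C * / sqrt (sqrt ((t - c) ^ 2)))%R)
  0%R PI c (C * 8)%R.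
have {}ig : (@lebesgue_measure R).-integrable (`[0%R, PI] `\ c)%classic
    (EFin \o (fun t => (C * / sqrt (sqrt ((t - c) ^ 2)))%R)).
  apply: ig.
  - by move=> N; exact/cR/ch.
  - by move=> N x; apply/RleP; apply: Rmult_le_pos => //; exact/Rlt_le/sing_reg_pos.
  - move=> N M x /ssrnat.leP NM; apply/RleP; apply: Rmult_le_compat_l => //.
    apply: sing_reg_antitone; split => //.
    apply: Rinv_le_contravar; first by have := pos_INR N; lra.
    by have := le_INR _ _ NM; lra.
  - move=> x /eqP xc; apply: Un_cv_cvg; apply/is_lim_seq_Reals.
    apply: (is_lim_seq_scal_l _ C (/ sqrt (sqrt ((x - c) ^ 2)))%R).
    by apply/is_lim_seq_Reals; apply: sing_reg_lim; lra.
  - move=> N; have [_ ->] := lebesgue_integral_RInt (h_ N) 0%R PI PI0 (ch N).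
    rewrite lee_fin; apply/RleP.
    have ex : ex_RInt (fun t => sing_reg (e N) (t - c)) 0%R PI.
      by apply: ex_RInt_continuous => t _; exact: continuous_sing_reg.
    rewrite (is_RInt_unique _ _ _ _ (is_RInt_scal _ _ _ C _ (RInt_correct _ _ _ ex))).
    apply: Rmult_le_compat_l => //; exact: RInt_sing_reg.
apply: (@dominated_punctured R f_ f _ v_ v 0%R PI c _ _ ig).
- by move=> N; exact/cR/cf.
- by move=> x /andP[/RleP ax /RleP xb] /eqP xc; apply: Un_cv_cvg; exact: ff.
- by move=> N x /andP[/RleP ax /RleP xb] /eqP xc; rewrite -RabsE; apply/RleP; exact: fg.
- by move=> N; have [_ ->] := lebesgue_integral_RInt (f_ N) 0%R PI PI0 (cf N); rewrite fv.
- exact: Un_cv_cvg.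
Qed.

Lemma integral_integrand (m n : nat) (s s' t' : R) :
  (m <= n)%coq_nat -> (0 < s')%R -> (s' <= s)%R -> (0 < t')%R -> (t' < PI)%R ->
  (@lebesgue_measure R).-integrable `[0%R, PI] (EFin \o integrand m n s s' t') /\
  (\int[@lebesgue_measure R]_(t in `[0%R, PI]) (integrand m n s s' t' t)%:E)%E =
  (rhs_value m n s s' t')%:E.
Proof.
move=> mn s'0 s's t'0 t'pi.
have PI0 : (0 < PI)%R by exact: PI_RGT_0.
have [lt|eq] := Rle_lt_or_eq_dec _ _ s's.
  have [H1 ->] := lebesgue_integral_RInt (integrand m n s s' t') 0 PI PI0
    (fun t => integrand_continuous m n s s' t' t (conj s'0 lt)).
  by split => //; rewrite RInt_integrand.
rewrite eq in s'0 *.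
have [C [C0 HC]] := integrand_dominated m n s t' s'0 (conj t'0 t'pi).
have ap N := approach_bounds s s'0 N.
apply: (@dominated_sqrt_singularity (fun N => integrand m n s (approach s N) t') _
  (fun N => rhs_value m n s (approach s N) t') _ t' C) => //.
- by lra.
- by move=> N t; apply: integrand_continuous; have := ap N; lra.
- by move=> t tpi tt'; apply/is_lim_seq_Reals; exact: is_lim_integrand.
- by move=> N; apply: RInt_integrand => //; have := ap N; lra.
- by apply/is_lim_seq_Reals; exact: is_lim_rhs_value.
Qed.

Theorem theorem3p3 (m n : nat) (s s' t' : R) :
  (m <= n)%coq_nat -> (0 < s)%R -> (0 < s')%R -> (0 < t')%R -> (t' < PI)%R ->
  let f := fun t : R =>
    (legQhalf m (chi s s' t t') * ferrersP m n (cos t) * sqrt (sin t))%R in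
  (@lebesgue_measure R).-integrable `[0%R, PI] (EFin \o f) /\
  (\int[@lebesgue_measure R]_(t in `[0%R, PI]) (f t)%:E)%E =
  ((2 * PI * (-1) ^ m * INR (Factorial.fact (n - m)) / INR (Factorial.fact (n + m))
    * sqrt (sinh s * sinh s' * sin t')
    * ferrersP m n (cos t')
    * legP m n (cosh (Rmin s s')) * legQ m n (cosh (Rmax s s')))%R)%:E.
Proof.
move=> mn s0 s'0 t'0 t'pi f.
(* [chi] and the right-hand side are symmetric in the two radii. *)
wlog s's : s s' s0 s'0 @f / (s' <= s)%R.
  move=> H; have [s's|ss'] := Rle_dec s' s; first exact: H.
  have ss : (s <= s')%R by apply: Rlt_le; apply: Rnot_le_lt.
  pose f' t := (legQhalf m (chi s' s t t') * ferrersP m n (cos t) * sqrt (sin t))%R.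
  have f'E : f' = f by apply/funext => t; rewrite /f' /f chi_sym.
  have [H1 H2] := H s' s s'0 s0 ss.
  split; first by rewrite -f'E.
  by rewrite -f'E [LHS]H2 (Rmin_comm s') (Rmax_comm s') (Rmult_comm (sinh s')).
have [H1 H2] := integral_integrand m n s s' t' mn s'0 s's t'0 t'pi.
(* The rewriting is confined to the interval of integration, where [sqrt (1 - cos t ^ 2)] in the
   Ferrers function is [sin t]. *)
have fE t : t \in `[0%R, PI]%classic -> integrand m n s s' t' t = f t.
  rewrite inE /= in_itv /= => /andP[/RleP t0 /RleP tpi].
  by rewrite /f integrand_ker.
rewrite (Rmin_right s s') // (Rmax_left s s') //.
split.
  by apply: eq_integrable H1 => // t tI /=; rewrite fE.
by rewrite -[RHS]H2; apply: eq_integral => t tI; rewrite fE.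
Qed.
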